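(* Let $X\in\{B,C,D\}$, with $n\ge2$ if $X=B$ or $C$ and $n\ge 3$ if $X=D$. Let $\nu,\mu\in P^+_{X_n}$ be two generalized partitions of length $n$ (for $X=D$ the last parts $\nu_{\overline1},\mu_{\overline1}$ may be negative), and let $\mu'=(\mu_{\overline{n-1}},\dots,\mu_{\overline1})$. Let $p$ be the lowest integer in $\{1,\dots,n\}$ such that $\nu_{\overline p}+p-\mu_{\overline n}-n\ge0$ (such an integer being supposed to exist, i.e. $\nu_{\overline n}\ge\mu_{\overline n}$). For $k\in\{p,p+1,\dots,n\}$ let $\gamma_k$ be the generalized partition of length $n-1$ $$\gamma_k=(\nu_{\overline n}+1,\nu_{\overline{n-1}}+1,\dots,\nu_{\overline{k+1}}+1,\nu_{\overline{k-1}},\dots,\nu_{\overline1}),$$ and put $R_k=\nu_{\overline k}+k-\mu_{\overline n}-n$. Then (sums over $r+2m=R_k$ being over integers $r,m\ge0$): (i) $\displaystyle K^{B_n}_{\nu,\mu}(q)=\sum_{k=p}^n(-1)^{n-k}\,q^{R_k}\sum_{r+2m=R_k}\ \sum_{\lambda\in(\gamma_k\otimes r)_{B_{n-1}}}b^\lambda_{\gamma_k,r}K^{B_{n-1}}_{\lambda,\mu'}(q)$ if $X=B$; (ii) $\displaystyle K^{C_n}_{\nu,\mu}(q)=\sum_{k=p}^n(-1)^{n-k}\sum_{r+2m=R_k}\ \sum_{\lambda\in(\gamma_k\otimes r)_{C_{n-1}}}q^{R_k-m}\,c^\lambda_{\gamma_k,r}K^{C_{n-1}}_{\lambda,\mu'}(q)$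 if $X=C$; (iii) $\displaystyle K^{D_n}_{\nu,\mu}(q)=\sum_{k=p}^n(-1)^{n-k}\,q^{R_k}\sum_{r+2m=R_k}\ \sum_{\lambda\in(\gamma_k\otimes r)_{D_{n-1}}}d^\lambda_{\gamma_k,r}K^{D_{n-1}}_{\lambda,\mu'}(q)$ if $X=D$.
   Context: Let $\varepsilon_{\overline 1},\dots,\varepsilon_{\overline k}$ be an orthonormal basis of $\mathbb R^k$ and write $\beta=(\beta_{\overline k},\dots,\beta_{\overline 1})$ for $\sum_i\beta_{\overline i}\varepsilon_{\overline i}$. Types $B_k,C_k,D_k$ correspond to $so_{2k+1},sp_{2k},so_{2k}$. Positive roots: $R^+_{B_k}=\{\varepsilon_{\overline i}\pm\varepsilon_{\overline j}:j<i\}\cup\{\varepsilon_{\overline i}\}$, $R^+_{C_k}=\{\varepsilon_{\overline i}\pm\varepsilon_{\overline j}:j<i\}\cup\{2\varepsilon_{\overline i}\}$, $R^+_{D_k}=\{\varepsilon_{\overline i}\pm\varepsilon_{\overline j}:j<i\}$ ($1\le i,j\le k$). Half sums of positive roots: $\rho_{B_k}=(k-\tfrac12,\dots,\tfrac12)$, $\rho_{C_k}=(k,\dots,1)$, $\rho_{D_k}=(k-1,\dots,0)$. Dominant weights (identified with generalized partitions of length $k$): $P^+_{B_k}$ is the set of $\beta\in\mathbb Z^k\cup(\tfrac12+\mathbb Z)^k$ with $\beta_{\overline k}\ge\cdots\ge\beta_{\overline1}\ge0$; $P^+_{C_k}$ the set of $\beta\in\mathbb Z^k$ with $\beta_{\overline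 k}\ge\cdots\ge\beta_{\overline1}\ge0$; $P^+_{D_k}$ the set of $\beta\in\mathbb Z^k\cup(\tfrac12+\mathbb Z)^k$ with $\beta_{\overline k}\ge\cdots\ge\beta_{\overline2}\ge|\beta_{\overline1}|$. Weyl groups $W$: all signed permutations of coordinates for $B_k,C_k$; those with an even number of sign changes for $D_k$; $l$ is the length function. The $q$-partition function $\mathcal P_q$ is defined by $\prod_{\alpha\in R^+}\frac1{1-qx^\alpha}=\sum_\beta\mathcal P_q(\beta)x^\beta$, with $\mathcal P_q(\beta)=0$ if $\beta$ is not a nonnegative integral combination of positive roots, and the Kostka-Foulkes polynomial is $K_{\lambda,\mu}(q)=\sum_{\sigma\in W}(-1)^{l(\sigma)}\mathcal P_q(\sigma(\lambda+\rho)-(\mu+\rho))$ for $\lambda,\mu$ dominant. For $\gamma$ dominant of rank $n-1$ and an integer $r\ge0$, the numbers $b^\lambda_{\gamma,r}$, $c^\lambda_{\gamma,r}$, $d^\lambda_{\gamma,r}$ are the multiplicities of the irreducible module $V(\lambda)$ in $V(\gamma)\otimes V(r\varepsilon_{\overline{n-1}})$ for $so_{2n-1}$, $sp_{2n-2}$, $so_{2n-2}$ respectively, and $(\gamma\otimes r)_{B_{n-1}}$, $(\gamma\otimes r)_{C_{n-1}}$, $(\gamma\otimes r)_{D_{n-1}}$ are the sets of dominant $\lambda$ for which the corresponding multiplicity is nonzero.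
   Formalization: Part (iii) is false as printed (e.g. n=3, ν=(2,2,-2), μ=(0,0,0): left side q^6, right side q^6-q^3); for X=D it is proved under the added hypothesis that minus the last part of ν is less than μ_n+n-1 (μ_n the first part of μ), automatic when the last part of ν is ≥0. *)

(* Defs.v *)
From HB Require Import structures.
From mathcomp Require Import all_boot all_order all_algebra perm.
From mathcomp Require Import archimedean ring mxtens.
From mathcomp Require Import boolp classical_sets cardinality fsbigop.

Set Implicit Arguments.
Unset Strict Implicit.
Unset Printing Implicit Defensive.

Import Order.TTheory GRing.Theory Num.Theory.
Local Open Scope ring_scope.

Inductive lie_type := TypeB | TypeC | TypeD.

(** * Roots, weights and Weyl groups

    Vectors of R^k have rational coordinates here (all weights lie in
    (1/2)Z^k).  The coordinate indexed by "overline i" is the one of index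
    i - 1, so that the tuple (beta_k, ..., beta_1) is the row vector beta read
    from right to left. *)

Section Roots.
Variable (X : lie_type) (k : nat).
Implicit Types a b beta lambda mu : 'rV[rat]_k.

Definition eps (i : 'I_k) : 'rV[rat]_k := delta_mx 0 i.

Definition pos_roots : seq 'rV[rat]_k :=
  [seq eps ij.1 + eps ij.2 | ij in [pred ij : 'I_k * 'I_k | (ij.2 < ij.1)%N]]
  ++ [seq eps ij.1 - eps ij.2 | ij in [pred ij : 'I_k * 'I_k | (ij.2 < ij.1)%N]]
  ++ match X with
     | TypeB => [seq eps i | i : 'I_k]
     | TypeC => [seq 2 *: eps i | i : 'I_k]
     | TypeD => [::]
     end.

Definition rho : 'rV[rat]_k :=
  \row_i match X with
         | TypeB => i%:R + 2^-1
         | TypeC => i.+1%:R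
         | TypeD => i%:R
         end.

Definition dominant beta : bool :=
  [&& match X with
      | TypeC => [forall i, beta 0 i \is a Num.int]
      | _ => [forall i, beta 0 i \is a Num.int]
             || [forall i, beta 0 i - 2^-1 \is a Num.int]
      end,
      [forall i : 'I_k, forall j : 'I_k, (i <= j)%N ==> (beta 0 i <= beta 0 j)]
    & match X with
      | TypeD => [forall i : 'I_k, forall j : 'I_k,
                   (i == 0 :> nat) && (0 < j)%N ==> (`|beta 0 i| <= beta 0 j)]
      | _ => [forall i, 0 <= beta 0 i]
      end].

(** A pair (s, e) is the signed permutation sending beta to the vector of
    coordinates (-1)^(e i) * beta_(s i), see [weyl_act]. *)
Definition signed_perm : finType := ('S_k * {ffun 'I_k -> bool})%type.

Definition weyl : {set signed_perm} :=
  match X with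
  | TypeD => [set w : signed_perm | ~~ odd #|[set i : 'I_k | w.2 i]|]
  | _ => [set: signed_perm]
  end.

Definition weyl_mx (w : signed_perm) : 'M[rat]_k :=
  \matrix_(i, j) ((-1) ^+ (w.2 j) * (i == w.1 j)%:R).

Definition weyl_act (w : signed_perm) beta : 'rV[rat]_k := beta *m weyl_mx w.

Lemma weyl_actE w beta i : weyl_act w beta 0 i = (-1) ^+ (w.2 i) * beta 0 (w.1 i).
Proof.
rewrite mxE (bigD1 (w.1 i)) //= mxE eqxx mulr1 big1 ?addr0 1?mulrC// => j /negPf h.
by rewrite mxE h !mulr0.
Qed.

Definition simple_roots : seq 'rV[rat]_k :=
  [seq a <- pos_roots | ~~ has (fun b => a - b \in pos_roots) pos_roots].

(** Right multiplication by this matrix sends beta to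
    beta - 2 (beta, a) / (a, a) a. *)
Definition reflection_mx a : 'M[rat]_k :=
  1%:M - (2 / (a *m a^T) 0 0) *: (a^T *m a).

(** The least length of a word in the simple reflections that represents w; the
    search may stop at the number of signed permutations, since the prefixes
    of a word of least length represent pairwise distinct elements. *)
Definition weyl_length (w : signed_perm) : nat :=
  find (fun l => [exists t : l.-tuple (seq_sub simple_roots),
          \big[mulmx/1%:M]_(a <- t) reflection_mx (val a) == weyl_mx w])
       (iota 0 #|signed_perm|).

(** ** The q-partition function

    Expanding each factor 1/(1 - q x^a) as a geometric series, the coefficient
    of q^d x^beta in their product is the number of families (m_a) of natural
    numbers indexed by the positive roots with sum of the m_a equal to d and
    sum of the m_a a equal to beta.  All such m_a are at most d. *)

Definition root_partitions beta (d : nat) :=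
  [set m : {ffun seq_sub pos_roots -> 'I_d.+1} |
     (\sum_a m a == d)%N && (\sum_a val a *+ m a == beta)].

(** A linear form that is at least 1 on every positive root; it bounds the
    degree of the q-partition function. *)
Definition root_height beta : rat := \sum_(i < k) beta 0 i * i.+1%:R.

Definition qpartition beta : {poly int} :=
  \poly_(d < (Num.truncn (root_height beta)).+1) #|root_partitions beta d|%:R.

Fact root_height_is_zmod_morphism : zmod_morphism root_height.
Proof.
move=> u v; rewrite /root_height -sumrB.
by apply: eq_bigr => i _; rewrite !mxE mulrBl.
Qed.

HB.instance Definition _ := GRing.isZmodMorphism.Build 'rV[rat]_k rat
  root_height root_height_is_zmod_morphism.

Lemma root_height_eps i : root_height (eps i) = i.+1%:R.
Proof.
rewrite /root_height (bigD1 i) //= mxE !eqxx mul1r big1 ?addr0// => j /negPf h.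
by rewrite mxE h andbF mul0r.
Qed.

Lemma root_height_ge1 a : a \in pos_roots -> 1 <= root_height a.
Proof.
have le1 (m : nat) : (0 < m)%N -> 1 <= m%:R :> rat by rewrite ler1n.
rewrite /pos_roots !mem_cat => /or3P[h|h|].
- have [[i j] /= ij ->] := fintype.imageP h; rewrite raddfD /= !root_height_eps -natrD.
  by rewrite le1// addSn.
- have [[i j] /= ij ->] := fintype.imageP h; rewrite raddfB /= !root_height_eps.
  by rewrite -natrB ?subSS ?ltnS ?(ltnW ij)// le1// subn_gt0.
case: X => // h; have [i _ ->] := fintype.imageP h; first by rewrite root_height_eps le1.
by rewrite scaler_nat raddfMn /= root_height_eps -mulrnA le1.
Qed.

Lemma coef_qpartition beta d : (qpartition beta)`_d = #|root_partitions beta d|%:R.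
Proof.
rewrite coef_poly ltnS; case: leqP => // lt_h.
suff -> : root_partitions beta d = finset.set0 by rewrite cards0.
apply/finset.setP => m; rewrite finset.inE finset.in_set0.
apply: contraTF lt_h => /andP[/eqP sm /eqP sb]; rewrite -leqNgt.
have hd : d%:R <= root_height beta.
  rewrite -sb raddf_sum -{1}sm natr_sum ler_sum// => a _.
  by rewrite raddfMn ler_wMn2r// root_height_ge1// (ssvalP a).
have h0 : 0 <= root_height beta by exact: le_trans hd.
by rewrite truncn_ge_nat.
Qed.

Definition kostka_foulkes lambda mu : {poly int} :=
  \sum_(w in weyl)
    (-1) ^+ weyl_length w * qpartition (weyl_act w (lambda + rho) - (mu + rho)).

End Roots.

(** * The orthogonal and symplectic Lie algebras and their modules

    C is the complex numbers, or any other algebraically closed numeric field.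
    The algebras so_(2k+1), sp_(2k), so_(2k) are those of the antidiagonal
    bilinear forms, for which the diagonal (resp. upper triangular) elements
    form a Cartan (resp. Borel) subalgebra. *)

Definition natural_dim (X : lie_type) (k : nat) : nat :=
  if X is TypeB then k.*2.+1 else k.*2.

Lemma rank_le_natural_dim X k : (k <= natural_dim X k)%N.
Proof. by case: X => /=; rewrite -addnn ?leqW ?leq_addr. Qed.

Section LieModules.
Variables (C : numClosedFieldType) (X : lie_type) (k : nat).
Let N := natural_dim X k.

Definition form_mx : 'M[C]_N :=
  \matrix_(i, j) (if j == rev_ord i then
                    if X is TypeC then (-1) ^+ (k <= i)%N else 1
                  else 0).

Definition lie_alg : {pred 'M[C]_N} :=
  [pred A : 'M[C]_N | A^T *m form_mx + form_mx *m A == 0].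

(** The underlying space is that of row vectors, and A . v is v *m mact A; only
    the values of mact on the Lie algebra matter. *)
Record lie_module := LieModule {
  mdim : nat;
  mact : {linear 'M[C]_N -> 'M[C]_mdim};
  mact_bracket : forall A B, A \in lie_alg -> B \in lie_alg ->
    mact (A *m B - B *m A) = mact B *m mact A - mact A *m mact B
}.

Definition module_iso (M M' : lie_module) : Prop :=
  exists f : 'M[C]_(mdim M, mdim M'),
    [/\ row_free f, row_full f &
        forall A, A \in lie_alg -> mact M A *m f = f *m mact M' A].

Definition irreducible_module (M : lie_module) : Prop :=
  (0 < mdim M)%N /\
  forall U : 'M[C]_(mdim M),
    (forall A, A \in lie_alg -> stablemx U (mact M A)) -> U != 0 -> row_full U.

(** The rows of the diagonal Cartan elements are indexed by
    k, ..., 1, (0), -1, ..., -k; [cartan_pos i] is the row of index i + 1, on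
    which eps i is evaluated. *)
Definition cartan_pos (i : 'I_k) : 'I_N :=
  widen_ord (rank_le_natural_dim X k) (rev_ord i).

(** Upper triangular elements act on a highest weight vector through their
    diagonal part; in particular the strictly upper triangular ones kill it. *)
Definition has_highest_weight (M : lie_module) (lambda : 'rV[rat]_k) : Prop :=
  exists v : 'rV[C]_(mdim M), v != 0 /\
    forall A, A \in lie_alg -> (forall i j : 'I_N, (j < i)%N -> A i j = 0) ->
      v *m mact M A =
        (\sum_i ratr (lambda 0 i) * A (cartan_pos i) (cartan_pos i)) *: v.

Definition is_irreducible_of (lambda : 'rV[rat]_k) (M : lie_module) : Prop :=
  irreducible_module M /\ has_highest_weight M lambda.

Section Tensor.
Variables M M' : lie_module.

Definition tensor_act (A : 'M[C]_N) : 'M[C]_(mdim M * mdim M') :=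
  mact M A *t 1%:M + 1%:M *t mact M' A.

Fact tensor_act_is_linear : linear tensor_act.
Proof.
move=> c A B; rewrite /tensor_act; apply/matrixP => i j.
by rewrite !linearP !mxE; ring.
Qed.

HB.instance Definition _ := GRing.isLinear.Build C 'M[C]_N
  'M[C]_(mdim M * mdim M') *:%R tensor_act tensor_act_is_linear.

Fact tensor_act_bracket A B : A \in lie_alg -> B \in lie_alg ->
  tensor_act (A *m B - B *m A)
  = tensor_act B *m tensor_act A - tensor_act A *m tensor_act B.
Proof.
move=> gA gB; rewrite /tensor_act !mact_bracket//.
rewrite !mulmxDl !mulmxDr !tensmx_mul !mul1mx !mulmx1.
by apply/matrixP => i j; rewrite !mxE; ring.
Qed.

Definition tensor_module : lie_module := LieModule tensor_act_bracket.
End Tensor.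

Section DirectSum.
Variables M M' : lie_module.

Definition dsum_act (A : 'M[C]_N) : 'M[C]_(mdim M + mdim M') :=
  block_mx (mact M A) 0 0 (mact M' A).

Fact dsum_act_is_linear : linear dsum_act.
Proof.
move=> c A B.
by rewrite /dsum_act !linearP scale_block_mx add_block_mx !scaler0 !addr0.
Qed.

HB.instance Definition _ := GRing.isLinear.Build C 'M[C]_N
  'M[C]_(mdim M + mdim M') *:%R dsum_act dsum_act_is_linear.

Fact dsum_act_bracket A B : A \in lie_alg -> B \in lie_alg ->
  dsum_act (A *m B - B *m A)
  = dsum_act B *m dsum_act A - dsum_act A *m dsum_act B.
Proof.
move=> gA gB; rewrite /dsum_act !mact_bracket// !mulmx_block.
by rewrite !mul0mx !mulmx0 !addr0 !add0r opp_block_mx add_block_mx !subr0.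
Qed.

Definition dsum_module : lie_module := LieModule dsum_act_bracket.
End DirectSum.

Fact zero_act_bracket A B : A \in lie_alg -> B \in lie_alg ->
  (\0 : {linear 'M[C]_N -> 'M[C]_0}) (A *m B - B *m A)
  = (\0%R : 'M[C]_N -> 'M[C]_0) B *m (\0%R : 'M[C]_N -> 'M[C]_0) A
    - (\0%R : 'M[C]_N -> 'M[C]_0) A *m (\0%R : 'M[C]_N -> 'M[C]_0) B.
Proof. by move=> _ _; apply/matrixP => -[]. Qed.

Definition zero_module : lie_module := LieModule zero_act_bracket.

(** M is the direct sum of m copies of the irreducible module L and of
    irreducible modules that are not isomorphic to L. *)
Definition multiplicity (M L : lie_module) (m : nat) : Prop :=
  exists s : seq lie_module,
    List.Forall (fun S => irreducible_module S /\ ~ module_iso S L) s /\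
    module_iso M (foldr dsum_module zero_module (nseq m L ++ s)).

End LieModules.

(** * The data of the recurrence

    The big rank is n.+1 and the small one is n. *)

(** r times the first vector of the basis (the one of largest index). *)
Definition row_weight (n r : nat) : 'rV[rat]_n := \row_i (r * (i.+1 == n))%:R.

Definition weight_tail (n : nat) (mu : 'rV[rat]_n.+1) : 'rV[rat]_n :=
  \row_i mu 0 (lift ord_max i).

Definition weight_gamma (n : nat) (nu : 'rV[rat]_n.+1) (k : 'I_n.+1) : 'rV[rat]_n :=
  \row_i (nu 0 (lift k i) + (k <= i)%N%:R).

(** Both k and n are one less than in nu_k + k - mu_n - n. *)
Definition R_index (n : nat) (nu mu : 'rV[rat]_n.+1) (k : 'I_n.+1) : rat :=
  nu 0 k + k%:R - mu 0 ord_max - n%:R.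

(** The set of dominant weights of nonzero multiplicity in V(gamma) (x) V(r),
    given the multiplicities b. *)
Definition tensor_set (X : lie_type) (n : nat)
    (b : 'rV[rat]_n -> nat -> 'rV[rat]_n -> nat) (gamma : 'rV[rat]_n) (r : nat) :
    classical_sets.set 'rV[rat]_n :=
  [set lambda | dominant X lambda /\ b gamma r lambda <> 0%N]%classic.

(* Main.v *)
(** Put a_b = \sum_(w in W) sgn(w) e^(w b).  Weyl's character formula turns each
    number b^lambda_(gamma, r) into a coefficient: in the group algebra of the
    weights, the sum over lambda of b^lambda_(gamma, r) a_(lambda + rho) is
    a_(gamma + rho) a_(r eps_max + rho) / a_rho.  The series in t of the
    quotients a_(r eps_max + rho) / a_rho is the product over i of
    1 / ((1 - t e^(eps_i)) (1 - t e^(-eps_i))) times 1 + t, 1 or 1 - t^2 in type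
    B, C or D, because the coefficients of the inverse of this product give a
    linear recurrence satisfied by r |-> a_(r eps_max + rho), whose initial
    values vanish or are known by antisymmetry.

    On the other side, the positive roots that involve the last coordinate are
    eps_n +- eps_i, and eps_n or 2 eps_n, so that the q-partition function of
    rank n + 1 is the convolution of that of rank n with the coefficients of the
    same product at q t, times 1 / (1 - q t), 1 / (1 - q t^2) or 1.  In the sum
    defining K_(nu, mu), the signed permutations that put +nu_k in last position
    contribute the term of index k, and the others contribute 0, since the last
    coordinate of their argument is negative.

    The character formula is proved with the Casimir element: the traces of
    products of opposite root vectors show that e^rho \prod_(a > 0) (1 - e^(-a))
    times the character is an eigenvector of the Laplacian with eigenvalue
    |lambda + rho|^2, and an alternating element supported on one sphere below
    its highest weight is a multiple of a_(lambda + rho). *)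

From HB Require Import structures.
Require Import Defs.
From mathcomp Require Import all_boot all_order all_algebra perm mxtens.
From mathcomp Require Import archimedean boolp classical_sets cardinality fsbigop.
From mathcomp Require Import functions ring lra zify.

Set Implicit Arguments.
Unset Strict Implicit.
Unset Printing Implicit Defensive.
Import Order.TTheory GRing.Theory Num.Theory.
Local Open Scope ring_scope.

(** * Group algebras *)

(** Multiplicities are specified by abstract module isomorphisms, whereas the recurrence lives in
    [{poly int}]. The bridge is linear: the functional [kostka_form] sends e^x to the q-partition
    function at x - (mu + rho), hence a_(lambda + rho) to a Kostka-Foulkes polynomial, so that it is
    enough to compare elements of group algebras, with coefficients in the field, in [int] and in
    [{poly int}]. The fraction a_(gamma + rho) / a_rho enters as an actual element, the character of
    V(gamma).

    The series in q t of the partition side is that of the character side times 1 / (1 - q t^2) in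
    type C and 1 / (1 - q^2 t^2) in types B and D. Expanding this factor produces the sum over m
    with r + 2m = R_k and the powers R_k - m and R_k of q.

    In type D the part nu_1 may be negative, and a signed permutation that puts -nu_1 last can then
    have an argument with nonnegative last coordinate. The hypothesis of the third clause, which
    reads -nu_1 < mu_n + n - 1 for the big rank n, excludes these permutations. *)

Section GroupAlgebra.
Variables (G : zmodType) (R : comNzRingType).

Definition finite_support : {pred G -> R} :=
  fun f => `[< exists s : seq G, forall x, x \notin s -> f x = 0 >].

Record galg := GAlg {gcoef :> G -> R; _ : gcoef \in finite_support}.
HB.instance Definition _ := [isSub of galg for gcoef].
HB.instance Definition _ := [Choice of galg by <:].

Fact finite_support_zmod_closed : zmod_closed finite_support.
Proof.
split=> [|f g /asboolP[s hs] /asboolP[t ht]]; apply/asboolP; first by exists [::].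
exists (s ++ t) => x; rewrite mem_cat negb_or => /andP[/hs fx /ht gx].
by rewrite -[LHS]/(f x - g x) fx gx subr0.
Qed.
HB.instance Definition _ := GRing.isZmodClosed.Build (G -> R) finite_support
  finite_support_zmod_closed.
HB.instance Definition _ := [SubChoice_isSubZmodule of galg by <:].

Implicit Types f g h : galg.

Lemma galgP f g : (forall x, f x = g x) -> f = g.
Proof. by move=> fg; apply: val_inj; apply/funext. Qed.

Lemma gcoef0 x : (0 : galg) x = 0. Proof. by []. Qed.
Lemma gcoefD f g x : (f + g) x = f x + g x. Proof. by []. Qed.
Lemma gcoefN f x : (- f) x = - f x. Proof. by []. Qed.
Lemma gcoefB f g x : (f - g) x = f x - g x. Proof. by []. Qed.
Lemma gcoef_sum I (r : seq I) (P : pred I) (F : I -> galg) x :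
  (\sum_(i <- r | P i) F i) x = \sum_(i <- r | P i) F i x.
Proof. by elim/big_rec2: _ => // i y z _ <-. Qed.
Lemma gcoefMn f n x : (f *+ n) x = f x *+ n.
Proof. by elim: n => // n ih; rewrite !mulrS gcoefD ih. Qed.

Lemma gsupp_ex f : exists s : seq G, forall x, x \notin s -> f x = 0.
Proof. by have /asboolP := valP f. Qed.

(** A chosen list that merely contains the support: [f] may vanish at some of its points, so sums
    over such lists are compared through [sum_supp_widen]. *)
Definition gsupp f : seq G := undup (projT1 (cid (gsupp_ex f))).

Lemma gsupp_uniq f : uniq (gsupp f). Proof. exact: undup_uniq. Qed.

Lemma gsuppP f x : x \notin gsupp f -> f x = 0.
Proof. by rewrite mem_undup; exact: (projT2 (cid (gsupp_ex f))). Qed.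

Lemma gsupp_in f x : f x != 0 -> x \in gsupp f.
Proof. by apply: contraNT => /gsuppP->. Qed.

Lemma sum_supp_widen (A : nmodType) (s t : seq G) (F : G -> A) : uniq s -> uniq t ->
  (forall x, F x != 0 -> x \in s) -> (forall x, F x != 0 -> x \in t) ->
  \sum_(x <- s) F x = \sum_(x <- t) F x.
Proof.
move=> us ut hs ht.
rewrite (bigID (fun x => F x == 0)) /= big1 ?add0r => [|i /eqP//].
rewrite [RHS](bigID (fun x => F x == 0)) /= [in RHS]big1 ?add0r => [|i /eqP//].
rewrite -big_filter -[RHS]big_filter; apply: perm_big.
apply: uniq_perm; rewrite ?filter_uniq// => x; rewrite !mem_filter.
by case: eqP => //= /eqP h; rewrite hs ?ht.
Qed.

Lemma sum_gsupp (A : nmodType) f (s : seq G) (F : G -> A) : uniq s ->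
  (forall x, F x != 0 -> f x != 0) -> (forall x, F x != 0 -> x \in s) ->
  \sum_(x <- gsupp f) F x = \sum_(x <- s) F x.
Proof.
by move=> us h1 h2; apply: sum_supp_widen; rewrite ?gsupp_uniq// => x /h1/gsupp_in.
Qed.

Fact gmonom_subproof c k : (fun x => if x == k then c else 0) \in finite_support.
Proof. by apply/asboolP; exists [:: k] => x; rewrite inE => /negPf->. Qed.
Definition gmonom c k : galg := GAlg (gmonom_subproof c k).
(** The formal exponential e^k. *)
Definition ge k := gmonom 1 k.

Lemma gcoef_monom c k x : gmonom c k x = if x == k then c else 0.
Proof. by []. Qed.
Lemma gcoef_ge k x : ge k x = (x == k)%:R.
Proof. by rewrite gcoef_monom; case: eqP. Qed.

Fact gmul_subproof f g :
  (fun x => \sum_(y <- gsupp f) f y * g (x - y)) \in finite_support.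
Proof.
apply/asboolP; exists [seq y + z | y <- gsupp f, z <- gsupp g] => x hx.
rewrite big1_seq// => y /andP[_ hy]; rewrite [g _]gsuppP ?mulr0//.
apply: contra hx => hz; apply/allpairsP; exists (y, x - y); split=> //=.
by rewrite addrC subrK.
Qed.
Definition gmul f g : galg := GAlg (gmul_subproof f g).

Lemma gmulE f g x (s : seq G) : uniq s -> (forall y, f y != 0 -> y \in s) ->
  gmul f g x = \sum_(y <- s) f y * g (x - y).
Proof.
move=> us hs; apply: sum_gsupp => // y h; last apply: hs.
all: by apply: contraNneq h => ->; rewrite mul0r.
Qed.

Fact gmulC : commutative gmul.
Proof.
move=> f g; apply: galgP => x; rewrite /gmul /=.
rewrite [RHS](@sum_supp_widen _ _ [seq x - y | y <- gsupp f] (fun y => g y * f (x - y))).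
- by rewrite big_map; apply: eq_bigr => y _; rewrite subKr mulrC.
- exact: gsupp_uniq.
- by rewrite map_inj_uniq ?gsupp_uniq//; apply: subrI.
- by move=> y h; apply: gsupp_in; apply: contraNneq h => ->; rewrite mul0r.
- move=> y h; apply/mapP; exists (x - y); last by rewrite subKr.
  by apply: gsupp_in; apply: contraNneq h => ->; rewrite mulr0.
Qed.

Fact gmulDl : left_distributive gmul +%R.
Proof.
move=> f g h; apply: galgP => x; rewrite gcoefD.
pose s := undup (gsupp f ++ gsupp g).
have us : uniq s by exact: undup_uniq.
rewrite !(@gmulE _ _ _ s)// -?big_split/=.
- by apply: eq_bigr => y _; rewrite mulrDl.
- by move=> y; rewrite mem_undup mem_cat => /gsupp_in->; rewrite orbT.
- by move=> y; rewrite mem_undup mem_cat => /gsupp_in->.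
move=> y; rewrite mem_undup mem_cat; apply: contraNT; rewrite negb_or => /andP[hf hg].
by rewrite -[(_ + _) y]/(f y + g y) !gsuppP ?addr0.
Qed.

Lemma gmul_monom c k f x : gmul (gmonom c k) f x = c * f (x - k).
Proof.
rewrite (@gmulE _ _ _ [:: k])// ?big_seq1 ?gcoef_monom ?eqxx// => y.
by rewrite gcoef_monom inE; case: (y =P k) => // _; rewrite eqxx.
Qed.

Lemma gsum_monom f : f = \sum_(k <- gsupp f) gmonom (f k) k.
Proof.
apply: galgP => x; rewrite gcoef_sum.
case: (boolP (x \in gsupp f)) => hx; last first.
  rewrite gsuppP// big1_seq// => k /andP[_ kf]; rewrite gcoef_monom.
  by case: (x =P k) => // xk; rewrite xk kf in hx.
rewrite (bigD1_seq x) ?gsupp_uniq//= eqxx big1 ?addr0// => k /negPf h.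
by rewrite eq_sym h.
Qed.

Lemma gmul_suml (r : seq G) (F : G -> galg) g :
  gmul (\sum_(k <- r) F k) g = \sum_(k <- r) gmul (F k) g.
Proof.
elim: r => [|k r ih]; last by rewrite !big_cons gmulDl ih.
by rewrite !big_nil; apply: galgP => x; rewrite /= big1// => y _; rewrite mul0r.
Qed.

(** By linearity the left factor may be taken to be a monomial, and multiplying by a monomial only
    translates the argument. *)
Fact gmulA : associative gmul.
Proof.
move=> f g h; rewrite (gsum_monom f) !gmul_suml; apply: eq_bigr => k _.
apply: galgP => x; rewrite gmul_monom.
rewrite (@gmulE g h _ (gsupp g)) ?gsupp_uniq//; last exact: gsupp_in.
rewrite (@gmulE (gmul _ g) h _ [seq y + k | y <- gsupp g]); first last.
- move=> y; rewrite gmul_monom => H; apply/mapP; exists (y - k); last by rewrite subrK.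
  by apply: gsupp_in; apply: contraNneq H => ->; rewrite mulr0.
- by rewrite map_inj_uniq ?gsupp_uniq//; apply: addIr.
rewrite big_map mulr_sumr; apply: eq_bigr => y _.
by rewrite gmul_monom addrK mulrA opprD addrA addrAC.
Qed.

Fact gmul1r : left_id (ge 0) gmul.
Proof. by move=> f; apply: galgP => x; rewrite gmul_monom mul1r subr0. Qed.

Fact gone_neq0 : ge 0 != 0.
Proof.
apply/eqP => /(congr1 (fun f : galg => f 0)); rewrite gcoef_ge eqxx => /eqP.
by rewrite oner_eq0.
Qed.

HB.instance Definition _ :=
  GRing.Zmodule_isComNzRing.Build galg gmulA gmulC gmul1r gmulDl gone_neq0.

Lemma gcoefM f g x : (f * g) x = \sum_(y <- gsupp f) f y * g (x - y).
Proof. by []. Qed.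
Lemma gcoefM_seq f g x (s : seq G) : uniq s -> (forall y, f y != 0 -> y \in s) ->
  (f * g) x = \sum_(y <- s) f y * g (x - y).
Proof. exact: gmulE. Qed.
Lemma gcoef_monomM c k f x : (gmonom c k * f) x = c * f (x - k).
Proof. exact: gmul_monom. Qed.
Lemma gcoef_geM k f x : (ge k * f) x = f (x - k).
Proof. by rewrite gcoef_monomM mul1r. Qed.
Lemma gcoef1 x : (1 : galg) x = (x == 0)%:R. Proof. exact: gcoef_ge. Qed.

Lemma gmonomM c d k l : gmonom c k * gmonom d l = gmonom (c * d) (k + l).
Proof.
apply: galgP => x; rewrite gcoef_monomM !gcoef_monom subr_eq addrC.
by rewrite addrC; case: eqP; rewrite ?mulr0.
Qed.

Lemma ge0 : ge 0 = 1. Proof. by []. Qed.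
Lemma geD k l : ge (k + l) = ge k * ge l.
Proof. by apply: galgP => x; rewrite gcoef_geM !gcoef_ge subr_eq addrC. Qed.
Lemma geN k : ge k * ge (- k) = 1. Proof. by rewrite -geD subrr. Qed.
Lemma ge_sum I (r : seq I) (P : pred I) (F : I -> G) :
  ge (\sum_(i <- r | P i) F i) = \prod_(i <- r | P i) ge (F i).
Proof. by elim/big_rec2: _ => // i y z _ <-; rewrite geD. Qed.
Lemma geMn k n : ge (k *+ n) = ge k ^+ n.
Proof. by elim: n => // n ih; rewrite mulrS geD ih exprS. Qed.

Fact gweight_subproof (Q : G -> R) f : (fun x => Q x * f x) \in finite_support.
Proof. by apply/asboolP; exists (gsupp f) => x /gsuppP->; rewrite mulr0. Qed.
(** The operators that are diagonal on exponentials: derivations when [Q] is additive, the Laplacian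
    when [Q x] is (x, x). *)
Definition gweight Q f : galg := GAlg (gweight_subproof Q f).

Lemma gcoef_weight Q f x : gweight Q f x = Q x * f x. Proof. by []. Qed.

Fact gweight_is_zmod_morphism Q : zmod_morphism (gweight Q).
Proof. by move=> f g; apply: galgP => x; rewrite !gcoef_weight mulrBr. Qed.
HB.instance Definition _ Q := GRing.isZmodMorphism.Build galg galg (gweight Q)
  (gweight_is_zmod_morphism Q).

Lemma gweightM I (r : seq I) (A B : I -> G -> R) (Q : G -> R) f g :
  (forall x y, Q (x + y) = \sum_(i <- r) A i x * B i y) ->
  gweight Q (f * g) = \sum_(i <- r) gweight (A i) f * gweight (B i) g.
Proof.
move=> QE; apply: galgP => x; rewrite gcoef_sum gcoef_weight gcoefM.
under [RHS]eq_bigr => i _.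
  rewrite (@gcoefM_seq _ _ _ (gsupp f)) ?gsupp_uniq//; last first.
    by move=> y h; apply: gsupp_in; apply: contraNneq h; rewrite gcoef_weight => ->; rewrite mulr0.
  over.
rewrite exchange_big mulr_sumr /=; apply: eq_bigr => y _.
have {1}-> : x = y + (x - y) by rewrite addrC subrK.
by rewrite QE mulr_suml; apply: eq_bigr => i _; rewrite ?gcoef_weight; ring.
Qed.

Lemma gweight_derivation (D : G -> R) f g : {morph D : x y / x + y} ->
  gweight D (f * g) = gweight D f * g + f * gweight D g.
Proof.
move=> DD.
rewrite (@gweightM _ [:: true; false] (fun b => if b then D else fun=> 1)
  (fun b => if b then fun=> 1 else D)); last first.
  by move=> x y; rewrite !big_cons big_nil DD mulr1 mul1r addr0.
have w1 u : gweight (fun=> 1) u = u by apply: galgP => x; rewrite gcoef_weight mul1r.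
by rewrite !big_cons big_nil addr0 !w1.
Qed.

Lemma gweight_ge Q k : gweight Q (ge k) = gmonom (Q k) k.
Proof.
by apply: galgP => x; rewrite gcoef_weight gcoef_ge gcoef_monom; case: eqP => [->|_];
  rewrite ?mulr1 ?mulr0.
Qed.

Section Eval.
Variables (S : comNzRingType) (phi : {rmorphism R -> S}) (u : G -> S).
(** Linear extension of a map on exponents, along [phi] on coefficients. The Weyl action, the
    changes of coefficients or of exponents and the functional [kostka_form] are all instances. *)
Definition geval f : S := \sum_(x <- gsupp f) phi (f x) * u x.

Lemma geval_seq f (s : seq G) : uniq s -> (forall y, f y != 0 -> y \in s) ->
  geval f = \sum_(x <- s) phi (f x) * u x.
Proof.
move=> us hs; apply: sum_gsupp => // y h; last apply: hs.
all: by apply: contraNneq h => ->; rewrite rmorph0 mul0r.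
Qed.

Fact geval_is_zmod_morphism : zmod_morphism geval.
Proof.
move=> f g; pose s := undup (gsupp f ++ gsupp g).
have us : uniq s by exact: undup_uniq.
rewrite !(@geval_seq _ s)// -?sumrB/=.
- by apply: eq_bigr => y _; rewrite rmorphB mulrBl.
- by move=> y; rewrite mem_undup mem_cat => /gsupp_in->; rewrite orbT.
- by move=> y; rewrite mem_undup mem_cat => /gsupp_in->.
move=> y; rewrite mem_undup mem_cat; apply: contraNT; rewrite negb_or => /andP[hf hg].
by rewrite -[(_ - _) y]/(f y - g y) !gsuppP ?subr0.
Qed.
HB.instance Definition _ := GRing.isZmodMorphism.Build galg S geval
  geval_is_zmod_morphism.

Lemma geval_monom c k : geval (gmonom c k) = phi c * u k.
Proof.
rewrite (@geval_seq _ [:: k])// ?big_seq1 ?gcoef_monom ?eqxx// => y.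
by rewrite gcoef_monom inE; case: (y =P k) => // _; rewrite eqxx.
Qed.
Lemma geval_ge k : geval (ge k) = u k.
Proof. by rewrite geval_monom rmorph1 mul1r. Qed.

Lemma gevalM : (forall x y, u (x + y) = u x * u y) -> {morph geval : f g / f * g}.
Proof.
move=> uD f g; rewrite (gsum_monom f) mulr_suml !raddf_sum /= mulr_suml.
apply: eq_bigr => k _; rewrite (gsum_monom g) mulr_sumr !raddf_sum /= mulr_sumr.
apply: eq_bigr => l _; rewrite gmonomM !geval_monom uD rmorphM; ring.
Qed.
End Eval.

End GroupAlgebra.

Arguments gcoef : simpl never.

(** * Signed permutations *)

Section Dot.
Variable k : nat.
Implicit Types a b c : 'rV[rat]_k.
Definition dot a b : rat := \sum_i a 0 i * b 0 i.

Lemma dotC a b : dot a b = dot b a.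
Proof. by apply: eq_bigr => i _; rewrite mulrC. Qed.
Lemma dotDl a b c : dot (a + b) c = dot a c + dot b c.
Proof. by rewrite -big_split; apply: eq_bigr => i _; rewrite mxE mulrDl. Qed.
Lemma dotDr a b c : dot c (a + b) = dot c a + dot c b.
Proof. by rewrite dotC dotDl !(dotC _ c). Qed.
Lemma dotNl a b : dot (- a) b = - dot a b.
Proof. by rewrite -sumrN; apply: eq_bigr => i _; rewrite mxE mulNr. Qed.
Lemma dotNr a b : dot a (- b) = - dot a b.
Proof. by rewrite dotC dotNl dotC. Qed.
Lemma dotBl a b c : dot (a - b) c = dot a c - dot b c.
Proof. by rewrite dotDl dotNl. Qed.
Lemma dotBr a b c : dot a (b - c) = dot a b - dot a c.
Proof. by rewrite dotDr dotNr. Qed.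
Lemma dotZl x a b : dot (x *: a) b = x * dot a b.
Proof. by rewrite mulr_sumr; apply: eq_bigr => i _; rewrite mxE mulrA. Qed.
Lemma dotZr x a b : dot a (x *: b) = x * dot a b.
Proof. by rewrite dotC dotZl dotC. Qed.
Lemma dot0l a : dot 0 a = 0.
Proof. by apply: big1 => i _; rewrite mxE mul0r. Qed.
Lemma dot0r a : dot a 0 = 0. Proof. by rewrite dotC dot0l. Qed.
Lemma dot_epsr a i : dot a (eps i) = a 0 i.
Proof.
rewrite /dot (bigD1 i)//= mxE !eqxx mulr1 big1 ?addr0// => j /negPf h.
by rewrite mxE h andbF mulr0.
Qed.
Lemma dot_epsl a i : dot (eps i) a = a 0 i. Proof. by rewrite dotC dot_epsr. Qed.
Lemma dot_sumr I (r : seq I) (P : pred I) (F : I -> 'rV[rat]_k) a :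
  dot a (\sum_(i <- r | P i) F i) = \sum_(i <- r | P i) dot a (F i).
Proof. by elim/big_rec2: _ => [|i y z _ <-]; rewrite ?dot0r ?dotDr. Qed.
Lemma dot_ge0 a : 0 <= dot a a.
Proof. by apply: sumr_ge0 => i _; rewrite -expr2 sqr_ge0. Qed.
Lemma dot_eq0 a : (dot a a == 0) = (a == 0).
Proof.
apply/idP/eqP => [|->]; last by rewrite dot0l.
rewrite psumr_eq0; last by move=> i _; rewrite -expr2 sqr_ge0.
move/allP => h; apply/rowP => i; rewrite mxE; apply/eqP.
by have := h i (mem_index_enum _); rewrite /= mulf_eq0 orbb.
Qed.
Lemma dot_gt0 a : a != 0 -> 0 < dot a a.
Proof. by move=> a0; rewrite lt_def dot_eq0 a0 dot_ge0. Qed.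
Lemma eps_coef i j : @eps k i 0 j = (i == j)%:R.
Proof. by rewrite mxE eqxx eq_sym. Qed.

Lemma mulmx_reflection b a :
  b *m reflection_mx a = b - (2 * dot b a / dot a a) *: a.
Proof.
have dE u v : (u *m v^T) 0 0 = dot u v.
  by rewrite mxE; apply: eq_bigr => i _; rewrite mxE.
rewrite /reflection_mx mulmxBr mulmx1 -scalemxAr mulmxA dE.
rewrite [b *m a^T]mx11_scalar dE mul_scalar_mx scalerA; congr (_ - _ *: _); ring.
Qed.

(** The reflection is 1 - c a^T a with c = 2 / (a, a). Two triangular factorisations of one bordered
    matrix identify its determinant with the scalar 1 - c (a, a) = -1. *)
Lemma det_reflection a : a != 0 -> \det (reflection_mx a) = -1.
Proof.
move=> a0; have d0 : dot a a != 0 by rewrite dot_eq0.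
have dE : (a *m a^T) = (dot a a)%:M.
  rewrite [LHS]mx11_scalar; congr (_%:M); rewrite mxE.
  by apply: eq_bigr => i _; rewrite mxE.
pose c : rat := 2 / dot a a.
have E : reflection_mx a = 1%:M - (c *: a^T) *m a.
  by rewrite /reflection_mx dE mxE eqxx -scalemxAl.
have H1 : block_mx (1%:M : 'M_1) 0 (- (c *: a^T)) (1%:M : 'M_k) *m
          block_mx 1%:M a (c *: a^T) 1%:M =
          block_mx 1%:M a 0 (reflection_mx a).
  rewrite mulmx_block !mul1mx !mulmx1 !mul0mx ?addr0 ?mulmx1.
  by rewrite addNr E mulNmx addrC.
have H2 : block_mx 1%:M a (c *: a^T) 1%:M *m
          block_mx (1%:M : 'M_1) 0 (- (c *: a^T)) (1%:M : 'M_k) =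
          block_mx (-1)%:M a 0 1%:M.
  rewrite mulmx_block !mul1mx !mulmx1 ?mulmx0 ?add0r subrr.
  congr block_mx; rewrite mulmxN -scalemxAr dE scale_scalar_mx.
  by rewrite /c mulfVK// -raddfN -raddfD /=; congr (_%:M); ring.
have := congr1 determinant H1; have := congr1 determinant H2.
rewrite !det_mulmx !det_ublock !det_lblock !det1 !mul1r !mulr1 => -> <-.
by rewrite det_scalar expr1.
Qed.
End Dot.

Section WeylGroup.
Variable k : nat.
Implicit Types (w v : signed_perm k) (b : 'rV[rat]_k).

(** The parity carried by the determinant; on the Weyl group it is that of the length, see
    [odd_weyl_length]. *)
Definition wodd w : bool := odd_perm w.1 (+) \big[addb/false]_i w.2 i.

Lemma odd_card_set (T : finType) (e : {ffun T -> bool}) :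
  odd #|[set i | e i]| = \big[addb/false]_i e i.
Proof.
rewrite -sum1_card big_mkcond /= (big_morph odd oddD (erefl _)).
by apply: eq_bigr => i _; rewrite finset.inE; case: (e i).
Qed.

Lemma in_weyl X w :
  (w \in weyl X k) = (if X is TypeD then ~~ \big[addb/false]_i w.2 i else true).
Proof. by case: X; rewrite /weyl finset.inE// odd_card_set. Qed.

Lemma sign_bigaddb (R : pzRingType) (T : finType) (e : T -> bool) :
  (-1) ^+ (\big[addb/false]_i e i) = \prod_i (-1) ^+ (e i) :> R.
Proof. exact: (big_morph (fun b : bool => (-1) ^+ b) (@signr_addb R) (erefl _)). Qed.

Lemma det_weyl_mx w : \det (weyl_mx w) = (-1) ^+ wodd w.
Proof.
have -> : weyl_mx w = perm_mx (w.1^-1)%g *m diag_mx (\row_j (-1) ^+ (w.2 j)).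
  apply/matrixP => i j; rewrite mul_mx_diag !mxE mulrC.
  by rewrite (canF_eq (permKV _)).
rewrite det_mulmx det_perm det_diag odd_permV /wodd signr_addb sign_bigaddb.
by congr (_ * _); apply: eq_bigr => i _; rewrite mxE.
Qed.

Definition wmul v w : signed_perm k :=
  ((v.1 * w.1)%g, [ffun i => v.2 i (+) w.2 (v.1 i)]).
Definition wone : signed_perm k := (1%g, [ffun=> false]).

Lemma weyl_act_mul v w b : weyl_act (wmul v w) b = weyl_act v (weyl_act w b).
Proof.
apply/rowP => i; rewrite !weyl_actE /= ffunE permM signr_addb; ring.
Qed.
Lemma weyl_act1 b : weyl_act wone b = b.
Proof. by apply/rowP => i; rewrite weyl_actE ffunE perm1 mul1r. Qed.

Lemma weyl_mx_inj_act (A : 'M[rat]_k) w :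
  (forall b, b *m A = weyl_act w b) -> A = weyl_mx w.
Proof. by move=> h; apply/row_matrixP => i; rewrite !rowE h. Qed.

(** The order is reversed because matrices act on row vectors from the right. *)
Lemma weyl_mx_mul v w : weyl_mx (wmul v w) = weyl_mx w *m weyl_mx v.
Proof.
apply/esym/weyl_mx_inj_act => b; rewrite mulmxA.
by rewrite -/(weyl_act w b) -/(weyl_act v _) weyl_act_mul.
Qed.
Lemma weyl_mx1 : weyl_mx wone = 1%:M.
Proof. by apply/esym/weyl_mx_inj_act => b; rewrite mulmx1 weyl_act1. Qed.

Lemma bigaddb_mul v w : \big[addb/false]_i (wmul v w).2 i =
  (\big[addb/false]_i v.2 i) (+) (\big[addb/false]_i w.2 i).
Proof.
rewrite [X in _ (+) X](reindex_inj (@perm_inj _ v.1)) -big_split /=.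
by apply: eq_bigr => i _; rewrite ffunE.
Qed.

Lemma wodd_mul v w : wodd (wmul v w) = wodd v (+) wodd w.
Proof. by rewrite /wodd bigaddb_mul odd_permM /= addbACA. Qed.

Lemma weyl_mul X v w : v \in weyl X k -> w \in weyl X k -> wmul v w \in weyl X k.
Proof. by rewrite !in_weyl; case: X => //; rewrite bigaddb_mul; do 2!case: (\big[_/_]_i _). Qed.
Lemma weyl_one X : wone \in weyl X k.
Proof. by rewrite in_weyl; case: X => //; rewrite big1// => i _; rewrite ffunE. Qed.

Lemma wmul_inj v : injective (wmul v).
Proof.
move=> [s e] [s' e'] [/mulgI ss /ffunP ee]; congr pair => //.
apply/ffunP => i; have := ee (v.1^-1 i)%g.
by rewrite !ffunE permKV => /addbI.
Qed.

Lemma weyl_mulr X v w : v \in weyl X k -> (wmul v w \in weyl X k) = (w \in weyl X k).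
Proof.
by rewrite !in_weyl; case: X => //; rewrite bigaddb_mul => /negPf->.
Qed.

Definition winv w : signed_perm k := ((w.1^-1)%g, [ffun i => w.2 ((w.1^-1)%g i)]).
Lemma wmulVw w : wmul (winv w) w = wone.
Proof.
congr pair; first by rewrite /= mulVg.
by apply/ffunP => i; rewrite !ffunE addbb.
Qed.
Lemma weyl_actK w : cancel (weyl_act w) (weyl_act (winv w)).
Proof. by move=> b; rewrite -weyl_act_mul wmulVw weyl_act1. Qed.
Lemma wmulwV w : wmul w (winv w) = wone.
Proof.
congr pair; first by rewrite /= mulgV.
by apply/ffunP => i; rewrite !ffunE permK addbb.
Qed.
Lemma weyl_actVK w : cancel (weyl_act (winv w)) (weyl_act w).
Proof. by move=> b; rewrite -weyl_act_mul wmulwV weyl_act1. Qed.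

Lemma weyl_actD w b c : weyl_act w (b + c) = weyl_act w b + weyl_act w c.
Proof. exact: mulmxDl. Qed.
Lemma weyl_actN w b : weyl_act w (- b) = - weyl_act w b.
Proof. exact: mulNmx. Qed.
Lemma weyl_act0 w : weyl_act w 0 = 0.
Proof. exact: mul0mx. Qed.

Lemma dot_weyl_act w b c : dot (weyl_act w b) (weyl_act w c) = dot b c.
Proof.
rewrite /dot [RHS](reindex_inj (@perm_inj _ w.1)) /=; apply: eq_bigr => i _.
by rewrite !weyl_actE mulrACA -expr2 sqrr_sign mul1r.
Qed.

End WeylGroup.

(** * Simple roots and the parity of the length *)

Section SimpleRoots.
Variables (X : lie_type) (k : nat).
Implicit Types (w v : signed_perm k) (a b : 'rV[rat]_k).

(** The usual simple system, listed explicitly, whereas [simple_roots] is made of the positive roots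
    that are not sums of two positive roots. *)
Definition is_simple a : Prop :=
  (exists i j : 'I_k, j = i.+1 :> nat /\ a = eps j - eps i) \/
  match X with
  | TypeB => exists i : 'I_k, i = 0%N :> nat /\ a = eps i
  | TypeC => exists i : 'I_k, i = 0%N :> nat /\ a = 2 *: eps i
  | TypeD => exists i j : 'I_k, [/\ i = 0%N :> nat, j = 1%N :> nat & a = eps j + eps i]
  end.

(** The closed Weyl chamber, and next the open one. Integrality is kept apart, in [wclass]. *)
Definition wdom b := forall a, is_simple a -> 0 <= dot b a.
Definition sdom b := forall a, is_simple a -> 0 < dot b a.

Lemma pos_rootsP a : reflect
  ((exists i j : 'I_k, (j < i)%N /\ (a = eps i + eps j \/ a = eps i - eps j)) \/
   match X with
   | TypeB => exists i : 'I_k, a = eps i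
   | TypeC => exists i : 'I_k, a = 2 *: eps i
   | TypeD => False
   end) (a \in pos_roots X k).
Proof.
apply: (iffP idP).
  rewrite /pos_roots !mem_cat => /or3P[h|h|].
  - by have [[i j] /= ij ->] := fintype.imageP h; left; exists i, j; split => //; left.
  - by have [[i j] /= ij ->] := fintype.imageP h; left; exists i, j; split => //; right.
  by case: X => // h; have [i _ ->] := fintype.imageP h; right; exists i.
rewrite /pos_roots !mem_cat => -[[i [j [ij [->|->]]]]|H].
- by apply/orP; left; apply/fintype.imageP; exists (i, j).
- by apply/orP; right; apply/orP; left; apply/fintype.imageP; exists (i, j).
apply/orP; right; apply/orP; right.
by case: X H => // -[i ->]; apply/fintype.imageP; exists i.
Qed.

Lemma is_simple_pos a : is_simple a -> a \in pos_roots X k.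
Proof.
move=> [[i [j [ij ->]]]|H]; apply/pos_rootsP.
  by left; exists j, i; split; [rewrite ij|right].
case: X H => [[i [_ ->]]|[i [_ ->]]|[i [j [i0 j1 ->]]]].
- by right; exists i.
- by right; exists i.
- by left; exists j, i; split; [rewrite i0 j1|left].
Qed.

(** Pairing with half the sum of the positive coroots. It is at least 1 on positive roots and equal
    to 1 on simple ones, which are therefore indecomposable. *)
Definition coheight b : rat := \sum_(i < k) b 0 i *
  match X with TypeB => i.+1%:R | TypeC => i%:R + 2^-1 | TypeD => i%:R end.

Lemma coheightE b : coheight b = dot b (\row_i match X with
  TypeB => i.+1%:R | TypeC => i%:R + 2^-1 | TypeD => i%:R end).
Proof. by apply: eq_bigr => i _; rewrite mxE. Qed.

Lemma coheight_ge1 a : a \in pos_roots X k -> 1 <= coheight a.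
Proof.
have ltR (i j : 'I_k) : (j < i)%N -> j%:R + 1 <= i%:R :> rat.
  by move=> ij; rewrite natr1 ler_nat.
move=> /pos_rootsP[[i [j [/ltR ij]]]|].
  have j0 : 0 <= j%:R :> rat by [].
  by case=> ->; rewrite coheightE ?dotDl ?dotNl !dot_epsl !mxE; case: X; rewrite -?[i.+1%:R]natr1 -?[j.+1%:R]natr1; lra.
rewrite coheightE; case: X => // -[i ->]; rewrite ?dotZl dot_epsl mxE ?ler1n//.
by rewrite mulrDr mulfV// lerDr mulr_ge0.
Qed.

Lemma coheight_simple a : is_simple a -> coheight a = 1.
Proof.
move=> [[i [j [ij ->]]]|].
  by rewrite coheightE dotBl !dot_epsl !mxE ij; case: X; rewrite -![_.+1%:R]natr1; ring.
rewrite coheightE; case: X => [[i [i0 ->]]|[i [i0 ->]]|[i [j [i0 j1 ->]]]].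
- by rewrite dot_epsl mxE i0.
- by rewrite dotZl dot_epsl mxE i0 add0r mulfV.
- by rewrite dotDl !dot_epsl !mxE i0 j1 addr0.
Qed.

Lemma is_simple_simple_roots a : is_simple a -> a \in simple_roots X k.
Proof.
move=> sa; rewrite mem_filter is_simple_pos// andbT; apply/hasPn => b hb.
apply/negP => hab; have := coheight_ge1 hab; have := coheight_ge1 hb.
by rewrite !coheightE dotBl -!coheightE (coheight_simple sa); lra.
Qed.

Lemma pos_root_neq0 a : a \in pos_roots X k -> a != 0.
Proof.
move=> /root_height_ge1; apply: contraTneq => ->; by rewrite raddf0 -ltNge.
Qed.

Definition wswap (i j : 'I_k) : signed_perm k := (tperm i j, [ffun=> false]).
Definition wflip (i : 'I_k) : signed_perm k := (1%g, [ffun l => l == i]).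
Definition wflipswap (i j : 'I_k) : signed_perm k :=
  (tperm i j, [ffun l => (l == i) || (l == j)]).

Lemma dot_eps2 i : dot (@eps k i) (eps i) = 1.
Proof. by rewrite dot_epsl eps_coef eqxx. Qed.

Lemma simple_reflection a : is_simple a ->
  exists w, [/\ w \in weyl X k, wodd w & weyl_mx w = reflection_mx a].
Proof.
move=> [[i [j [ij ->]]]|].
  have nij : i != j by rewrite -val_eqE /= ij; lia.
  exists (wswap i j); split.
  - by rewrite in_weyl; case: X => //; rewrite big1// => l _; rewrite ffunE.
  - by rewrite /wodd odd_tperm nij big1// => l _; rewrite ffunE.
  apply/esym/weyl_mx_inj_act => b; rewrite mulmx_reflection.
  have -> : dot (eps j - eps i) (eps j - eps i) = 2.
    by rewrite dotBl !dotBr !dot_epsl !eps_coef !eqxx (negPf nij) eq_sym (negPf nij).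
  apply/rowP => l; rewrite weyl_actE ffunE mul1r !mxE dotBr !dot_epsr !eqxx /=.
  case: tpermP => [->|->|/eqP/negPf hi /eqP/negPf hj].
  - by rewrite eqxx (negPf nij) /=; field.
  - by rewrite eqxx eq_sym (negPf nij) /=; field.
  - by rewrite hi hj /=; field.
have flip i : X <> TypeD -> [/\ wflip i \in weyl X k, wodd (wflip i) &
    weyl_mx (wflip i) = reflection_mx (eps i)].
  move=> nD; split.
  - by rewrite in_weyl; case: X nD.
  - rewrite /wodd odd_perm1 (bigD1 i)//= ffunE eqxx big1// => l /negPf h.
    by rewrite ffunE h.
  apply/esym/weyl_mx_inj_act => b; rewrite mulmx_reflection dot_eps2 dot_epsr.
  apply/rowP => l; rewrite weyl_actE ffunE perm1 !mxE eqxx.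
  by case: eqP => [->|_] /=; rewrite ?expr1 ?expr0; field.
case: X flip => [flip [i [i0 ->]]|flip [i [i0 ->]]|flip [i [j [i0 j1 ->]]]].
- by exists (wflip i); apply: flip.
- exists (wflip i); have [//|-> -> ->] := flip i; split=> //.
  apply/esym/row_matrixP => l; rewrite !rowE !mulmx_reflection.
  rewrite dotZl !dotZr scalerA dot_eps2; congr (_ - _ *: _).
  by move: (dot _ _) => x; field.
have nij : i != j by rewrite -val_eqE /= i0 j1.
exists (wflipswap i j); split.
- rewrite in_weyl (bigD1 i)//= (bigD1 j) 1?eq_sym//= !ffunE !eqxx orbT big1//.
  by move=> l /andP[/negPf h1 /negPf h2]; rewrite ffunE h1 h2.
- rewrite /wodd odd_tperm nij (bigD1 i)//= (bigD1 j) 1?eq_sym//= !ffunE !eqxx orbT big1//.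
  by move=> l /andP[/negPf h1 /negPf h2]; rewrite ffunE h1 h2.
apply/esym/weyl_mx_inj_act => b; rewrite mulmx_reflection.
have -> : dot (eps j + eps i) (eps j + eps i) = 2.
  by rewrite dotDl !dotDr !dot_epsl !eps_coef !eqxx (negPf nij) eq_sym (negPf nij).
apply/rowP => l; rewrite weyl_actE ffunE !mxE dotDr !dot_epsr !eqxx /=.
case: tpermP => [->|->|/eqP/negPf hi /eqP/negPf hj].
- by rewrite eqxx (negPf nij) /=; field.
- by rewrite eqxx eq_sym (negPf nij) /=; field.
- by rewrite hi hj /=; field.
Qed.

Lemma root_height_dot b : root_height b = dot b (\row_i i.+1%:R).
Proof. by apply: eq_bigr => i _; rewrite mxE. Qed.

(** The reflection adds a positive multiple of [a]. The height is the measure that makes [conj_wdom]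
    and [weyl_word] terminate. *)
Lemma reflection_height b a : is_simple a -> dot b a < 0 ->
  root_height b < root_height (b *m reflection_mx a).
Proof.
move=> sa ba; rewrite mulmx_reflection raddfB /= ltrBDr gtrDl.
rewrite root_height_dot dotZl -root_height_dot.
have := root_height_ge1 (is_simple_pos sa).
have := dot_gt0 (pos_root_neq0 (is_simple_pos sa)).
set d := dot a a => d0 h1; rewrite pmulr_llt0; last by apply: lt_le_trans h1.
by rewrite pmulr_llt0 ?invr_gt0// pmulr_rlt0.
Qed.

Lemma conj_wdom b : exists2 w, w \in weyl X k & wdom (weyl_act w b).
Proof.
have := @arg_maxP _ rat _ (wone k) (mem (weyl X k)) (fun w => root_height (weyl_act w b)).
case=> [|w wW wmax]; first exact: weyl_one.
exists w => // a sa; rewrite leNgt; apply/negP => lt0.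
have [v [vW _ vE]] := simple_reflection sa.
have := wmax (wmul v w) (weyl_mul vW wW).
rewrite /= weyl_act_mul [weyl_act v _]/weyl_act vE leNgt.
by rewrite reflection_height.
Qed.

Lemma mono_ord (f : 'I_k -> rat) : (forall i j : 'I_k, j = i.+1 :> nat -> f i < f j) ->
  forall i j : 'I_k, (i < j)%N -> f i < f j.
Proof.
move=> h i j; move: {2}(j - i)%N (leqnn (j - i)%N) => n.
elim: n j => [|n ih] j; first by rewrite leqn0 subn_eq0 => /leq_ltn_trans/[apply]; rewrite ltnn.
move=> jn ij; have hj : (j.-1 < k)%N by have := ltn_ord j; lia.
have E : j = (Ordinal hj).+1 :> nat by move=> /=; lia.
have [e|ne] := eqVneq i (Ordinal hj); first by rewrite e; apply: h.
apply: lt_trans (h _ _ E); apply: ih => /=; first by lia.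
have := ne; rewrite -val_eqE /=; lia.
Qed.

Lemma sdom_lt b : sdom b -> forall i j : 'I_k, (j < i)%N -> `|b 0 j| < b 0 i.
Proof.
move=> sb.
have inc (i j : 'I_k) : (i < j)%N -> b 0 i < b 0 j.
  move: i j; apply: mono_ord => i j ij; rewrite -subr_gt0.
  by have := sb (eps j - eps i); rewrite dotBr !dot_epsr; apply; left; exists i, j.
move=> i j ji; have k0 : (0 < k)%N by have := ltn_ord i; lia.
pose o := Ordinal k0.
rewrite ltr_norml inc// andbT ltrNl -subr_gt0 opprK.
(* The coordinate of index 0 is the smallest one, hence the worst case; there the simple root that
   is not a difference gives the inequality. *)
have H0 : 0 < b 0 i + b 0 o.
  have [i1|i1] := leqP i 0; first by lia.
  have o_i : b 0 o < b 0 i by apply: inc.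
  have : 0 < b 0 o \/ (exists2 j1 : 'I_k, j1 = 1%N :> nat & 0 < b 0 j1 + b 0 o).
    move: sb; rewrite /sdom /is_simple; case: X => sb.
    - by left; rewrite -dot_epsr; apply: sb; right; exists o.
    - left; have := sb (2 *: eps o); rewrite dotZr dot_epsr pmulr_rgt0//; apply.
      by right; exists o.
    - right; have k1 : (1 < k)%N by have := ltn_ord i; lia.
      exists (Ordinal k1) => //; rewrite -!dot_epsr -dotDr; apply: sb.
      by right; exists o, (Ordinal k1).
  case=> [b0|[j1 j1E bj]]; first by rewrite addr_gt0// (lt_trans b0).
  apply: lt_le_trans bj _; rewrite lerD2r; have [->//|ne] := eqVneq i j1.
  by rewrite ltW// inc// j1E; move: ne; rewrite -val_eqE /= j1E; lia.
have [->//|ne] := eqVneq j o.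
by rewrite (lt_trans H0)// ltrD2l inc//; move: ne; rewrite -val_eqE /=; lia.
Qed.

Lemma sdom_gt0 b : sdom b -> X <> TypeD -> forall i : 'I_k, 0 < b 0 i.
Proof.
move=> sb nD i.
have k0 : (0 < k)%N by have := ltn_ord i; lia.
pose o := Ordinal k0.
have b0 : 0 < b 0 o.
  move: sb; rewrite /sdom /is_simple; case: X nD => // _ sb.
  - by rewrite -dot_epsr; apply: sb; right; exists o.
  - have := sb (2 *: eps o); rewrite dotZr dot_epsr pmulr_rgt0//; apply.
    by right; exists o.
have [->//|ne] := eqVneq i o.
apply: le_lt_trans (sdom_lt sb (_ : (o < i)%N)) => //.
by move: ne; rewrite -val_eqE /=; lia.
Qed.

Lemma sdom_norm_inj b : sdom b -> injective (fun i : 'I_k => `|b 0 i|).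
Proof.
move=> sb i j /= E.
have aux (i' j' : 'I_k) : (j' < i')%N -> `|b 0 j'| <> `|b 0 i'|.
  move=> ij; have h := sdom_lt sb ij; rewrite [`|b 0 i'|]gtr0_norm; last exact: le_lt_trans h.
  by move=> E'; rewrite E' ltxx in h.
by case: (ltngtP i j) => [/aux|/aux|/val_inj//]; rewrite E.
Qed.

(** The coordinates of [b] have distinct absolute values, nonzero outside type D, and this persists
    along the orbit, so that no simple root is orthogonal to a point of it. *)
Lemma wdom_reg_sdom b w : sdom b -> w \in weyl X k -> wdom (weyl_act w b) ->
  sdom (weyl_act w b).
Proof.
move=> sb wW wb a sa; rewrite lt_def wb// andbT; apply/eqP => E.
have inj := sdom_norm_inj sb.
have nE x i : `|(-1) ^+ x * b 0 i| = `|b 0 i| by rewrite normrM normr_sign mul1r.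
case: (sa) => [[i [j [ij aE]]]|].
  move: E; rewrite aE dotBr !dot_epsr !weyl_actE => /eqP; rewrite subr_eq0 => /eqP.
  move/(congr1 Num.norm); rewrite !nE => /inj/perm_inj ji.
  by move: ij; rewrite ji; lia.
have nz i : X <> TypeD -> b 0 i != 0 by move=> nD; rewrite gt_eqF// sdom_gt0.
case: X nz => [nz [i [_ aE]]|nz [i [_ aE]]|nz [i [j [i0 j1 aE]]]]; move: E; rewrite aE.
- by move/eqP; rewrite dot_epsr weyl_actE mulf_eq0 signr_eq0 (negPf (nz _ _)).
- by move/eqP; rewrite dotZr dot_epsr weyl_actE !mulf_eq0 signr_eq0 (negPf (nz _ _)).
rewrite dotDr !dot_epsr !weyl_actE => /eqP; rewrite addr_eq0 => /eqP.
by move/(congr1 Num.norm); rewrite normrN !nE => /inj/perm_inj ji; move: i0; rewrite -ji j1.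
Qed.

(** In the open chamber the absolute values increase strictly, which forces the permutation to be
    increasing, hence trivial. The coordinates of known sign then leave no flip, except possibly at
    index 0 in type D. *)
Lemma sdom_stab b w : w \in weyl X k -> sdom b -> sdom (weyl_act w b) -> w = wone k.
Proof.
move=> wW sb sw.
have nE x i : `|(-1) ^+ x * b 0 i| = `|b 0 i| by rewrite normrM normr_sign mul1r.
have lt_norm c (i j : 'I_k) : sdom c -> (i < j)%N -> `|c 0 i| < `|c 0 j|.
  by move=> sc ij; apply: lt_le_trans (sdom_lt sc ij) (ler_norm _).
have mon (i j : 'I_k) : (i < j)%N -> (w.1 i < w.1 j)%N.
  move=> ij; have := lt_norm _ _ _ sw ij; rewrite !weyl_actE !nE.
  apply: contraTT; rewrite -leqNgt leq_eqVlt => /orP[/eqP/val_inj->|h].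
    by rewrite ltxx.
  by rewrite -leNgt ltW// lt_norm.
have id1 : w.1 = 1%g.
  apply/permP => i; rewrite perm1; apply/val_inj.
  have ge (l : 'I_k) : (l <= w.1 l)%N.
    case: l => m; elim: m => // m ih hm.
    have hm' : (m < k)%N by lia.
    have := mon (Ordinal hm') (Ordinal hm); rewrite /= => /(_ (ltnSn _)).
    have := ih hm'; move=> /=; lia.
  (* An increasing map is at least the identity, and a permutation has the same sum of values as the
     identity. *)
  apply/eqP; rewrite eqn_leq ge andbT leqNgt; apply/negP => lt_i.
  have : (\sum_(l < k) l = \sum_(l < k) w.1 l)%N.
    by rewrite [LHS](reindex_inj (@perm_inj _ w.1)).
  rewrite (bigD1 i)//= [RHS](bigD1 i)//=.
  have : (\sum_(l < k | l != i) l <= \sum_(l < k | l != i) w.1 l)%N.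
    by apply: leq_sum => l _; exact: ge.
  set S1 := (\sum_(l < k | l != i) l)%N; set S2 := (\sum_(l < k | _) _)%N.
  by move=> h1 h2; rewrite /= -(ltn_add2r S1) h2 ltn_add2l ltnNge h1 in lt_i.
have signpos (i : 'I_k) : 0 < b 0 i -> 0 < weyl_act w b 0 i -> w.2 i = false.
  by move=> b0; rewrite weyl_actE id1 perm1; case: (w.2 i) => //; rewrite mulN1r oppr_gt0 ltNge ltW.
have sg (i : 'I_k) : X <> TypeD \/ (0 < i)%N -> w.2 i = false.
  move=> [nD|i0]; first by apply: signpos; rewrite sdom_gt0.
  have k0 : (0 < k)%N by have := ltn_ord i; lia.
  have pos c : sdom c -> 0 < c 0 i.
    by move=> sc; apply: le_lt_trans (sdom_lt sc (_ : (Ordinal k0 < i)%N)).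
  by apply: signpos; apply: pos.
case: (w) id1 sg wW => s e /= -> sg wW; congr pair; apply/ffunP => i; rewrite ffunE.
case: (pselect (X = TypeD)) => [XD|nD]; last by apply: sg; left.
have [i0|i0] := posnP i; last by apply: sg; right.
(* In type D a single flip, at index 0, would contradict the even number of flips. *)
move: wW; rewrite in_weyl XD /= (bigD1 i)//= big1 ?addbF => [/negPf//|j].
by rewrite -val_eqE /= i0 => j0; apply: sg; right; lia.
Qed.

Lemma sdom_rho : sdom (rho X k).
Proof.
move=> a [[i [j [ij ->]]]|].
  rewrite dotBr !dot_epsr !mxE ij; case: X; rewrite -!natr1 ; lra.
rewrite /rho; case: X => [[i [i0 ->]]|[i [i0 ->]]|[i [j [i0 j1 ->]]]].
- by rewrite dot_epsr mxE i0.
- by rewrite dotZr dot_epsr mxE i0.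
- by rewrite dotDr !dot_epsr !mxE i0 j1.
Qed.

Lemma wdom_sdomD a b : wdom a -> sdom b -> sdom (a + b).
Proof. by move=> wa sb c sc; rewrite dotDl ltr_wpDl ?wa ?sb. Qed.

Definition height_rho w := root_height (weyl_act w (rho X k)).

(** Reflecting [w rho] as long as it leaves the closed chamber raises its height. The bound on the
    length of the word is what places it in the range searched by [weyl_length]. *)
Lemma weyl_word w : w \in weyl X k -> exists s : seq 'rV[rat]_k,
  [/\ forall a, a \in s -> is_simple a,
      (size s <= #|[set v | (height_rho w < height_rho v)%R]|)%N &
      weyl_mx w = \big[mulmx/1%:M]_(a <- s) reflection_mx a].
Proof.
move: {2}#|_| (leqnn #|[set v | (height_rho w < height_rho v)%R]|) => n.
elim/ltn_ind: n w => n ih w hn wW.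
case: (pselect (wdom (weyl_act w (rho X k)))) => [wd|nwd].
  have := wdom_reg_sdom sdom_rho wW wd; move/(sdom_stab wW sdom_rho) ->.
  by exists [::]; split => //; rewrite big_nil weyl_mx1.
have [a sa lt0] : exists2 a, is_simple a & dot (weyl_act w (rho X k)) a < 0.
  apply: contrapT => H; apply: nwd => a sa; rewrite leNgt; apply/negP => lt0.
  by apply: H; exists a.
have [v [vW _ vE]] := simple_reflection sa.
have lt_h : height_rho w < height_rho (wmul v w).
  by rewrite /height_rho weyl_act_mul [weyl_act v _]/weyl_act vE reflection_height.
have lt_c : (#|[set u | (height_rho (wmul v w) < height_rho u)%R]| <
             #|[set u | (height_rho w < height_rho u)%R]|)%N.
  apply: proper_card; apply/properP; split.
    by apply/fintype.subsetP => u; rewrite !finset.inE; apply: lt_trans.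
  by exists (wmul v w); rewrite !finset.inE ?ltxx.
have [s [s1 s2 s3]] := ih _ (leq_trans lt_c hn) (wmul v w) (leqnn _) (weyl_mul vW wW).
exists (rcons s a); split.
- by move=> b; rewrite mem_rcons inE => /orP[/eqP->//|/s1].
- by rewrite size_rcons (leq_ltn_trans s2 lt_c).
have -> : \big[mulmx/1%:M]_(c <- rcons s a) reflection_mx c =
    (\big[mulmx/1%:M]_(c <- s) reflection_mx c) *m reflection_mx a.
  elim: (s) => [|c t IH]; first by rewrite big_cons !big_nil mul1mx mulmx1.
  by rewrite rcons_cons !big_cons IH mulmxA.
rewrite -s3 weyl_mx_mul -vE -mulmxA.
have -> : weyl_mx v *m weyl_mx v = 1%:M; last by rewrite mulmx1.
rewrite vE; apply/row_matrixP => i; rewrite !rowE mulmxA mulmx1 !mulmx_reflection.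
have d0 : dot a a != 0 by rewrite gt_eqF// dot_gt0// (pos_root_neq0 (is_simple_pos sa)).
by rewrite dotBl dotZl; apply/rowP => j; rewrite !mxE; field.
Qed.

Lemma odd_weyl_length w : w \in weyl X k -> odd (weyl_length X w) = wodd w.
Proof.
move=> wW; have [s [s1 s2 s3]] := weyl_word wW.
have hs : all (mem (simple_roots X k)) s.
  by apply/allP => a /s1/is_simple_simple_roots.
rewrite /weyl_length; set P := (fun l : nat => _).
(* Strict, because [w] itself is not among the elements of greater height. *)
have sz : (size s < #|signed_perm k|)%N.
  apply: leq_ltn_trans s2 _; rewrite -cardsT; apply: proper_card; rewrite properT.
  by apply/negP => /eqP/setP/(_ w); rewrite !finset.inE ltxx.
have hasP : has P (iota 0 #|signed_perm k|).
  apply/hasP; exists (size s); first by rewrite mem_iota.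
  apply/existsP.
  have hz : size (pmap (insub : _ -> option (seq_sub (simple_roots X k))) s) == size s.
    by rewrite size_pmap_sub; move: hs; rewrite all_count => /eqP->.
  exists (Tuple hz); rewrite s3; apply/eqP => /=.
  elim: (s) hs => [|a t ih] /=; first by rewrite !big_nil.
  by case/andP => ha ht; rewrite insubT /= !big_cons ih.
have := nth_find 0%N hasP; set l := find _ _.
have lN : (l < #|signed_perm k|)%N by rewrite -[X in (_ < X)%N](size_iota 0) -has_find.
rewrite nth_iota// add0n => /existsP[t /eqP tE].
(* Each simple reflection has determinant -1, so the determinant of a word remembers the parity of
   its length. *)
have := congr1 determinant tE; rewrite det_weyl_mx.
have -> : \det (\big[mulmx/1%:M]_(a <- t) reflection_mx (val a)) = (-1) ^+ l.
  rewrite -{2}(size_tuple t); elim: (tval t) => [|a r ih]; first by rewrite big_nil det1.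
  rewrite big_cons det_mulmx ih det_reflection ?exprS//.
  by have := ssvalP a; rewrite mem_filter => /andP[_ /pos_root_neq0].
rewrite -signr_odd => /eqP; rewrite -subr_eq0.
by case: (odd l); case: (wodd w); rewrite ?subrr. 
Qed.

Lemma sign_weyl_length (R : pzRingType) w : w \in weyl X k ->
  (-1) ^+ weyl_length X w = (-1) ^+ wodd w :> R.
Proof. by move=> wW; rewrite -signr_odd odd_weyl_length. Qed.

End SimpleRoots.

(** * Alternating sums *)

Section Cone.
Variables (X : lie_type) (k : nat).
Implicit Types (a b x : 'rV[rat]_k).

(** The nonnegative integral combinations of positive roots; [qcone (t - x)] is the usual order x <=
    t on weights. *)
Definition qcone b : Prop :=
  exists2 s : seq 'rV[rat]_k, {subset s <= pos_roots X k} & b = \sum_(a <- s) a.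

Lemma qcone0 : qcone 0.
Proof. by exists [::]; rewrite ?big_nil. Qed.
Lemma qconeD a b : qcone a -> qcone b -> qcone (a + b).
Proof.
move=> [s hs ->] [t ht ->]; exists (s ++ t); last by rewrite big_cat.
by move=> x; rewrite mem_cat => /orP[/hs|/ht].
Qed.
Lemma qcone_root a : a \in pos_roots X k -> qcone a.
Proof. by exists [:: a]; rewrite ?big_seq1// => x; rewrite inE => /eqP->. Qed.

Lemma sdom_pos_root b a : sdom X b -> a \in pos_roots X k -> 0 < dot b a.
Proof.
move=> sb /pos_rootsP[[i [j [ij H]]]|].
  have := sdom_lt sb ij; rewrite ltr_norml => /andP[h1 h2].
  by case: H => ->; rewrite ?dotDr ?dotNr !dot_epsr; lra.
case: X sb => sb // [i ->]; rewrite ?dotZr dot_epsr.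
  exact: sdom_gt0 sb _ i.
by rewrite mulr_gt0//; exact: sdom_gt0 sb _ i.
Qed.

Lemma qcone_dot b a : sdom X b -> qcone a -> a != 0 -> 0 < dot b a.
Proof.
move=> sb [s hs ->]; elim: s hs => [|c s ih] hs; first by rewrite big_nil eqxx.
rewrite big_cons dotDr => _.
have hc : 0 < dot b c by apply: sdom_pos_root => //; apply: hs; rewrite mem_head.
have [->|s0] := eqVneq (\sum_(a <- s) a) 0; first by rewrite dot0r addr0.
by rewrite addr_gt0// ih// => x xs; apply: hs; rewrite inE xs orbT.
Qed.

Lemma qcone_height a : qcone a -> a != 0 -> 0 < root_height a.
Proof.
move=> [s hs ->]; elim: s hs => [|c s ih] hs; first by rewrite big_nil eqxx.
rewrite big_cons raddfD /= => _.
have hc : 0 < root_height c.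
  by apply: lt_le_trans (root_height_ge1 (hs _ (mem_head _ _))).
have [->|s0] := eqVneq (\sum_(a <- s) a) 0; first by rewrite raddf0 addr0.
by rewrite addr_gt0// ih// => x xs; apply: hs; rewrite inE xs orbT.
Qed.

Lemma qcone_antisym a : qcone a -> qcone (- a) -> a = 0.
Proof.
move=> h1 h2; apply: contrapT => /eqP a0; have := qcone_height h1 a0.
by have := qcone_height h2; rewrite oppr_eq0 raddfN /= => /(_ a0); lra.
Qed.

Lemma qcone_int a i : qcone a -> a 0 i \is a Num.int.
Proof.
move=> [s hs ->]; rewrite summxE big_seq; apply: rpred_sum => c /hs.
have e_int j : @eps k j 0 i \is a Num.int by rewrite eps_coef natr_int.
move=> /pos_rootsP[[j [l [_ [->|->]]]]|].
- by rewrite mxE rpredD.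
- by rewrite mxE [X in _ + X]mxE rpredB.
by case: X => // -[j ->] //; rewrite mxE rpredM// natr_int.
Qed.

Lemma wdom_pos_root b a : wdom X b -> a \in pos_roots X k -> 0 <= dot b a.
Proof.
move=> wb ha; rewrite leNgt; apply/negP => lt0.
have h0 := sdom_pos_root (sdom_rho (k := k) (X := X)) ha.
(* The multiple of [rho] is chosen so that its sum with [b], which is strictly dominant, would be
   orthogonal to [a], against [sdom_pos_root]. *)
have s1 : sdom X (- (dot b a / dot (rho X k) a) *: rho X k).
  move=> c sc; rewrite dotZl mulr_gt0// ?sdom_rho// oppr_gt0.
  by rewrite pmulr_llt0// invr_gt0.
have := sdom_pos_root (wdom_sdomD wb s1) ha.
by rewrite dotDl dotZl mulNr divfK ?gt_eqF// subrr ltxx.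
Qed.

Lemma wdom_qcone b a : wdom X b -> qcone a -> 0 <= dot b a.
Proof.
move=> wb [s hs ->]; rewrite dot_sumr big_seq; apply: sumr_ge0 => c /hs.
exact: wdom_pos_root.
Qed.

(** Up to halving the long root of type C, [rho] pairs with a simple root to at most 1 and [b] pairs
    to an integer; an integer greater than -1 is nonnegative. *)
Lemma sdom_wdom_rho b : (forall i, b 0 i \is a Num.int) -> sdom X (b + rho X k) ->
  wdom X b.
Proof.
move=> bi sb a sa; have := sb _ sa; rewrite dotDl.
have key (y c : rat) : y \is a Num.int -> c <= 1 -> 0 < y + c -> 0 <= y.
  move=> /intrP[z ->] hc h; rewrite ler0z.
  have : -1 < z%:~R :> rat by lra.
  by rewrite -[-1]/((-1)%:~R) ltr_int; lia.
case: sa => [[i [j [ij ->]]]|].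
  rewrite !dotBr !dot_epsr; apply: key; first by rewrite rpredB.
  by rewrite !mxE ij; case: X; rewrite -!natr1; lra.
move: sb; rewrite /rho; case: X => [_ [i [i0 ->]]|_ [i [i0 ->]]|_ [i [j [i0 j1 ->]]]].
- by rewrite !dot_epsr mxE i0; apply: key => //; lra.
- rewrite !dotZr !dot_epsr mxE i0 -mulrDr !pmulr_rgt0// pmulr_rge0//.
  by apply: key => //; lra.
- by rewrite !dotDr !dot_epsr !mxE i0 j1; apply: key; rewrite ?rpredD.
Qed.

(** The difference b - rho is weakly dominant and its opposite is a sum of positive roots, so that
    minus its squared norm is nonnegative. *)
Lemma sdom_rho_max b : sdom X b -> qcone (rho X k - b) -> b = rho X k.
Proof.
move=> sb qb; have wb : wdom X (b - rho X k).
  apply: sdom_wdom_rho; last by rewrite subrK.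
  by move=> i; rewrite -opprB mxE rpredN; apply: qcone_int.
have := wdom_qcone wb qb; rewrite -opprB dotNl oppr_ge0 => h.
apply/eqP; rewrite eq_sym -subr_eq0 -dot_eq0; apply/eqP/le_anti.
by rewrite h dot_ge0.
Qed.
End Cone.

(** * Leading exponents *)

Section Below.
Variables (X : lie_type) (k : nat) (R : comNzRingType).
Implicit Types (f g : galg 'rV[rat]_k R).

Definition below (t : 'rV[rat]_k) f := forall x, f x != 0 -> qcone X (t - x).

Lemma gcoefM_neq0 f g x : (f * g) x != 0 -> exists2 y, f y != 0 & g (x - y) != 0.
Proof.
move=> h; apply: contrapT => H; move/eqP: h; apply; rewrite gcoefM big1// => y _.
have [f0|f0] := eqVneq (f y) 0; first by rewrite f0 mul0r.
have [g0|g0] := eqVneq (g (x - y)) 0; first by rewrite g0 mulr0.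
by case: H; exists y.
Qed.

(** Only the pair of leading exponents contributes at [s + t]: any other contribution would give a
    vector in the cone together with its opposite. *)
Lemma belowM s t f g : below s f -> below t g ->
  below (s + t) (f * g) /\ (f * g) (s + t) = f s * g t.
Proof.
move=> bf bg; split=> [x /gcoefM_neq0[y /bf hy /bg hx]|].
  have -> : s + t - x = (s - y) + (t - (x - y)) by apply/rowP => i; rewrite !mxE; ring.
  exact: qconeD.
have E y : f y != 0 -> g (s + t - y) != 0 -> y = s.
  move=> /bf h1 /bg h2; apply/eqP; rewrite eq_sym -subr_eq0; apply/eqP/(qcone_antisym h1).
  by rewrite (_ : - (s - y) = t - (s + t - y))//; apply/rowP => i; rewrite !mxE; ring.
pose r := undup (s :: gsupp f).
rewrite (@gcoefM_seq _ _ _ _ _ r) ?undup_uniq//; last first.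
  by move=> y /gsupp_in fy; rewrite mem_undup in_cons fy orbT.
rewrite (bigD1_seq s) ?undup_uniq ?mem_undup ?mem_head//=.
have -> : s + t - s = t by rewrite addrC addKr.
rewrite big1 ?addr0// => y ys.
have [f0|f0] := eqVneq (f y) 0; first by rewrite f0 mul0r.
have [g0|g0] := eqVneq (g (s + t - y)) 0; first by rewrite g0 mulr0.
by rewrite (E y) ?eqxx in ys.
Qed.

Lemma below_ge t : below t (ge R t) /\ ge R t t = 1.
Proof.
split=> [x|]; last by rewrite gcoef_ge eqxx.
by rewrite gcoef_ge; case: (x =P t) => [-> _|_]; rewrite ?eqxx// subrr; exact: qcone0.
Qed.
End Below.

Lemma wmulA k (u v w : signed_perm k) : wmul u (wmul v w) = wmul (wmul u v) w.
Proof.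
congr pair; first by rewrite /= mulgA.
by apply/ffunP => i; rewrite !ffunE /= permM addbA.
Qed.
Lemma wmulw1 k (w : signed_perm k) : wmul w (wone k) = w.
Proof.
case: w => s e; congr pair; first by rewrite /= mulg1.
by apply/ffunP => i; rewrite !ffunE addbF.
Qed.
Lemma weyl_mull X k (v w : signed_perm k) : w \in weyl X k ->
  (wmul v w \in weyl X k) = (v \in weyl X k).
Proof.
by rewrite !in_weyl; case: X => //; rewrite bigaddb_mul => /negPf->; rewrite addbF.
Qed.

(** * Antisymmetric elements of the group algebra *)

Section Alternating.
Variables (X : lie_type) (k : nat) (R : comNzRingType).
Implicit Types (w : signed_perm k) (b : 'rV[rat]_k) (f g : galg 'rV[rat]_k R).
Local Notation gE := (ge R).

Definition alt b : galg 'rV[rat]_k R :=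
  \sum_(w in weyl X k) (-1) ^+ wodd w * gE (weyl_act w b).

Definition antisym f := forall w b, w \in weyl X k ->
  f (weyl_act w b) = (-1) ^+ wodd w * f b.
Definition winvariant f := forall w b, w \in weyl X k -> f (weyl_act w b) = f b.

Lemma gcoef_signM (s : bool) f b : ((-1) ^+ s * f) b = (-1) ^+ s * f b.
Proof. by case: s; rewrite ?expr1 ?expr0 ?mulN1r ?mul1r. Qed.

Lemma gcoef_alt b c :
  alt b c = \sum_(w in weyl X k) (-1) ^+ wodd w * (c == weyl_act w b)%:R.
Proof. by rewrite gcoef_sum; apply: eq_bigr => w _; rewrite gcoef_signM gcoef_ge. Qed.

Lemma alt_antisym b : antisym (alt b).
Proof.
move=> v c vW; rewrite !gcoef_alt (reindex_inj (@wmul_inj _ v)) /= mulr_sumr.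
apply: eq_big => [w|w _]; first exact: weyl_mulr.
rewrite wodd_mul signr_addb mulrA weyl_act_mul.
by rewrite (inj_eq (can_inj (weyl_actK v))).
Qed.

Lemma alt_weyl w b : w \in weyl X k -> alt (weyl_act w b) = (-1) ^+ wodd w * alt b.
Proof.
move=> wW; apply: galgP => c; rewrite gcoef_signM.
have bij : bijective (fun v => wmul v w).
  by exists (fun v => wmul v (winv w)) => v; rewrite -wmulA ?wmulwV ?wmulVw wmulw1.
rewrite !gcoef_alt mulr_sumr [RHS](reindex _ (onW_bij _ bij)) /=.
apply: eq_big => [v|v _]; first by rewrite weyl_mull.
by rewrite wodd_mul addbC signr_addb mulrA mulrA -signr_addb addbb mul1r weyl_act_mul.
Qed.

Lemma alt_fixed w b : w \in weyl X k -> wodd w -> weyl_act w b = b ->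
  alt b = - alt b.
Proof. by move=> wW ow bE; rewrite -{1}bE alt_weyl// ow mulN1r. Qed.

Lemma antisymM f g : antisym f -> winvariant g -> antisym (f * g).
Proof.
move=> af wg w b wW; rewrite (@gcoefM_seq _ _ _ _ _ [seq weyl_act w y | y <- gsupp f]).
- rewrite big_map gcoefM mulr_sumr; apply: eq_bigr => y _.
  by rewrite af// -weyl_actN -weyl_actD wg// mulrA.
- by rewrite map_inj_uniq ?gsupp_uniq//; apply: can_inj (weyl_actK w).
move=> y fy; apply/mapP; exists (weyl_act (winv w) y); last by rewrite weyl_actVK.
apply: gsupp_in; apply: contraNneq fy => f0.
by rewrite -(weyl_actVK w y) af// f0 mulr0.
Qed.
End Alternating.

Section AlternatingNum.
Variables (X : lie_type) (k : nat) (R : numDomainType).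
Implicit Types (w : signed_perm k) (b : 'rV[rat]_k) (f g : galg 'rV[rat]_k R).

Lemma gcoef_alt_sdom b c : sdom X b -> sdom X c -> alt X R b c = (c == b)%:R.
Proof.
move=> sb sc; rewrite gcoef_alt (bigD1 (wone k)) ?weyl_one//= weyl_act1.
have -> : wodd (wone k) = false.
  by rewrite /wodd odd_perm1 big1// => i _; rewrite ffunE.
rewrite mul1r big1 ?addr0// => w /andP[wW w1]; case: eqP => [cE|_]; last by rewrite mulr0.
by move: sc; rewrite cE => /(sdom_stab wW sb) w1'; rewrite w1' eqxx in w1.
Qed.

(** Every exponent is conjugate into the closed chamber, and on a wall an antisymmetric coefficient
    is equal to its opposite, hence zero. *)
Lemma antisym_eq f g : antisym X f -> antisym X g ->
  (forall b, sdom X b -> f b = g b) -> f = g.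
Proof.
move=> af ag fg; apply: galgP => b; have [w wW wb] := conj_wdom X b.
have key (h : galg 'rV[rat]_k R) : antisym X h -> h b = (-1) ^+ wodd w * h (weyl_act w b).
  by move=> ah; rewrite ah// mulrA -signr_addb addbb mul1r.
rewrite (key f)// (key g)//; congr (_ * _).
have [sw|nsw] := pselect (sdom X (weyl_act w b)); first exact: fg.
have [a sa a0] : exists2 a, is_simple X a & dot (weyl_act w b) a = 0.
  apply: contrapT => H; apply: nsw => a sa; rewrite lt_def wb// andbT.
  by apply/eqP => a0; apply: H; exists a.
have [v [vW ov vE]] := simple_reflection sa.
have fixv : weyl_act v (weyl_act w b) = weyl_act w b.
  by rewrite [LHS]/weyl_act vE mulmx_reflection a0 mulr0 mul0r scale0r subr0.
have z (h : galg 'rV[rat]_k R) : antisym X h -> h (weyl_act w b) = 0.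
  move=> ah; have := ah v (weyl_act w b) vW; rewrite fixv ov mulN1r => /eqP.
  by rewrite eq_sym eqNr => /eqP.
by rewrite !z.
Qed.

(* Among the strictly dominant points below [t], the top [t] is the only one
   on its sphere, because [(t - b, t + b) > 0] for the others. *)
Lemma antisym_sphere f t : antisym X f -> below X t f -> f t = 1 -> sdom X t ->
  (forall b, f b != 0 -> dot b b = dot t t) -> f = alt X R t.
Proof.
move=> af bf ft st sph; refine (antisym_eq af (@alt_antisym X _ R t) _) => b sb.
rewrite gcoef_alt_sdom//; have [->//|bt] := eqVneq b t.
apply/eqP; apply: contraT => fb; have tb := bf _ fb.
have := qcone_dot sb tb; have := qcone_dot st tb.
rewrite subr_eq0 eq_sym bt => /(_ isT) h1 /(_ isT) h2.
have := sph _ fb; move: h1 h2; rewrite !dotBr (dotC b t); lra.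
Qed.
End AlternatingNum.

(** * The Weyl denominator *)

Section Const.
Variables (G : zmodType) (R : comNzRingType).
Definition gC (c : R) : galg G R := gmonom c 0.
Fact gC_zmod : zmod_morphism gC.
Proof.
by move=> c d; apply: galgP => x; rewrite gcoefB !gcoef_monom; case: eqP; rewrite ?subr0.
Qed.
Fact gC_monoid : monoid_morphism gC.
Proof. by split=> // c d; rewrite /gC gmonomM addr0. Qed.
HB.instance Definition _ := GRing.isZmodMorphism.Build R (galg G R) gC gC_zmod.
HB.instance Definition _ := GRing.isMonoidMorphism.Build R (galg G R) gC gC_monoid.
Lemma gcoef_CM c (f : galg G R) x : (gC c * f) x = c * f x.
Proof. by rewrite gcoef_monomM subr0. Qed.
Lemma gmonomE c k : gmonom c k = gC c * ge R k.
Proof. by rewrite gmonomM mulr1 add0r. Qed.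
End Const.

Section WeylAction.
Variables (k : nat) (R : comNzRingType) (w : signed_perm k).
Implicit Types (f : galg 'rV[rat]_k R).
Definition gact f : galg 'rV[rat]_k R :=
  geval (@gC _ R) (fun b => ge R (weyl_act w b)) f.
Fact gact_zmod : zmod_morphism gact.
Proof. exact: geval_is_zmod_morphism. Qed.
HB.instance Definition _ := GRing.isZmodMorphism.Build _ _ gact gact_zmod.
Fact gact_monoid : monoid_morphism gact.
Proof.
split; first by rewrite /gact -ge0 geval_ge weyl_act0.
by apply: gevalM => a b; rewrite weyl_actD geD.
Qed.
HB.instance Definition _ := GRing.isMonoidMorphism.Build _ _ gact gact_monoid.
Lemma gact_ge b : gact (ge R b) = ge R (weyl_act w b).
Proof. exact: geval_ge. Qed.
Lemma gcoef_act f b : gact f (weyl_act w b) = f b.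
Proof.
rewrite (gsum_monom f) raddf_sum !gcoef_sum; apply: eq_bigr => c _.
rewrite /= /gact geval_monom -gmonomE !gcoef_monom.
by rewrite (inj_eq (can_inj (weyl_actK w))).
Qed.
Lemma weyl_act_eps i : weyl_act w (eps i) =
  (-1) ^+ (w.2 ((w.1^-1)%g i)) *: eps ((w.1^-1)%g i).
Proof.
apply/rowP => j; rewrite weyl_actE [RHS]mxE !eps_coef [i == _]eq_sym (canF_eq (permK w.1)).
by rewrite eq_sym; case: (_ =P j) => [->|_]; rewrite ?mulr0.
Qed.
End WeylAction.

Lemma prod_ord_lt (R : comPzRingType) k (F : 'I_k -> 'I_k -> R) :
  \prod_(i < k) \prod_(j < k | (i < j)%N) F i j =
  \prod_(j < k) \prod_(i < k | (i < j)%N) F i j.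
Proof. by rewrite (exchange_big_dep xpredT). Qed.

Section Nabla.
Variables (X : lie_type) (k : nat) (R : comNzRingType).
Implicit Types (w : signed_perm k).
Local Notation E := (ge R).

Definition nabla_y (i : 'I_k) : galg 'rV[rat]_k R := E (eps i) + E (- eps i).
Definition nabla_z (i : 'I_k) : galg 'rV[rat]_k R :=
  match X with
  | TypeB => E (2^-1 *: eps i) - E (- (2^-1 *: eps i))
  | TypeC => E (eps i) - E (- eps i)
  | TypeD => 1
  end.
(** The Weyl denominator in Vandermonde form: for j < i, the difference of [nabla_y i] and
    [nabla_y j] is e^(eps i) times the factors of the roots eps i + eps j and eps i - eps j. Its
    antisymmetry becomes that of a Vandermonde determinant. *)
Definition nabla : galg 'rV[rat]_k R :=
  (\prod_(i < k) \prod_(j < k | (i < j)%N) (nabla_y j - nabla_y i)) *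
  \prod_(i < k) nabla_z i.

Lemma gact_y w i : gact w (nabla_y i) = nabla_y ((w.1^-1)%g i).
Proof.
rewrite rmorphD /= !gact_ge weyl_actN weyl_act_eps.
by case: (w.2 _); rewrite ?expr1 ?expr0 ?scaleN1r ?scale1r ?opprK// addrC.
Qed.

Lemma gact_z w i : w \in weyl X k ->
  gact w (nabla_z i) = (-1) ^+ (if X is TypeD then false else w.2 ((w.1^-1)%g i)) *
    nabla_z ((w.1^-1)%g i).
Proof.
move=> _; rewrite /nabla_z; case: X; last by rewrite rmorph1 mul1r.
all: rewrite rmorphB /= !gact_ge weyl_actN ?[weyl_act w (_ *: _)]linearZ /=.
  have -> : weyl_act w (2^-1 *: eps i) = 2^-1 *: weyl_act w (eps i).
    by rewrite /weyl_act scalemxAl.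
all: rewrite weyl_act_eps.
all: by case: (w.2 _);
  rewrite ?expr1 ?expr0 ?scaleN1r ?scalerN ?scale1r ?opprK ?mul1r// mulN1r opprB.
Qed.

Lemma gact_nabla w : w \in weyl X k -> gact w nabla = (-1) ^+ wodd w * nabla.
Proof.
move=> wW; rewrite /nabla rmorphM !rmorph_prod /=.
set s := (w.1^-1)%g.
have -> : \prod_(i < k) gact w (nabla_z i) =
   (-1) ^+ (\big[addb/false]_i w.2 i) * \prod_i nabla_z i.
  rewrite (eq_bigr _ (fun i _ => gact_z i wW)).
  rewrite big_split /=; congr (_ * _); last first.
    by rewrite [RHS](reindex_inj (@perm_inj _ s)).
  rewrite sign_bigaddb [RHS](reindex_inj (@perm_inj _ s)) /=.
  move: wW; rewrite in_weyl; case: X => //= /negPf H.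
  rewrite big1// -(reindex_inj (@perm_inj _ s) (P := xpredT) (F := fun i => (-1) ^+ w.2 i)) /=.
  by rewrite -sign_bigaddb H.
rewrite mulrCA mulrA /wodd addbC signr_addb -!mulrA; congr (_ * _).
rewrite mulrA; congr (_ * _).
have vE (t : 'I_k -> 'I_k) : \prod_(i < k) \prod_(j < k | (i < j)%N) (nabla_y (t j) - nabla_y (t i)) =
   \det (Vandermonde k (\row_i nabla_y (t i))).
  rewrite det_Vandermonde; apply: eq_bigr => i _; apply: eq_bigr => j _.
  by rewrite !mxE.
under eq_bigr => i _ do rewrite rmorph_prod /=.
under eq_bigr => i _ do under eq_bigr => j _ do rewrite rmorphB /= !gact_y.
rewrite (vE s) (vE id).
have -> : Vandermonde k (\row_i nabla_y (s i)) =
    Vandermonde k (\row_i nabla_y i) *m perm_mx s^-1.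
  rewrite -col_permE; apply/matrixP => i j; rewrite !mxE.
  by congr (nabla_y _ ^+ _).
by rewrite det_mulmx det_perm mulrC odd_permV /s odd_permV.
Qed.

Lemma nabla_antisym : antisym X nabla.
Proof.
move=> w b wW; rewrite -(gcoef_act w nabla b) gact_nabla// gcoef_signM.
by rewrite mulrA -signr_addb addbb mul1r.
Qed.

Lemma rho_sum : rho X k = \sum_i rho X k 0 i *: eps i.
Proof. exact: row_sum_delta. Qed.

Lemma nablaE : nabla = E (rho X k) * \prod_(a <- pos_roots X k) (1 - E (- a)).
Proof.
rewrite /pos_roots !big_cat !big_image /= rho_sum ge_sum.
rewrite (eq_bigl (fun p : 'I_k * 'I_k => xpredT p.1 && (p.2 < p.1)%N)) //.
rewrite [X in _ * (X * _)](eq_bigl (fun p : 'I_k * 'I_k => xpredT p.1 && (p.2 < p.1)%N)) //.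
rewrite [X in _ * (_ * (X * _))](eq_bigl (fun p : 'I_k * 'I_k => xpredT p.1 && (p.2 < p.1)%N)) //.
rewrite -(pair_big_dep xpredT (fun i j : 'I_k => (j < i)%N) (fun i j => 1 - E (- (eps i + eps j)))) /=.
rewrite -(pair_big_dep xpredT (fun i j : 'I_k => (j < i)%N) (fun i j => 1 - E (- (eps i - eps j)))) /=.
have last_prod : \prod_(a <- match X with
     | TypeB => [seq eps i | i : 'I_k]
     | TypeC => [seq 2 *: eps i | i : 'I_k]
     | TypeD => [::]
     end) (1 - E (- a)) = \prod_(i < k) match X with
     | TypeB => 1 - E (- eps i)
     | TypeC => 1 - E (- (2 *: eps i))
     | TypeD => 1 end.
  by case: X; rewrite ?big_image// big_nil big1.
rewrite last_prod -!big_split /nabla prod_ord_lt -big_split /=; apply: eq_bigr => i _.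
have -> : \prod_(j < k | (j < i)%N) (nabla_y i - nabla_y j) =
  E (i%:R *: eps i) * (\prod_(j < k | (j < i)%N) (1 - E (- (eps i + eps j)))
    * \prod_(j < k | (j < i)%N) (1 - E (- (eps i - eps j)))).
  rewrite scaler_nat geMn.
  have -> : E (eps i) ^+ i = \prod_(j < k | (j < i)%N) E (eps i).
    by rewrite (big_ord_narrow (ltnW (ltn_ord i))) prodr_const card_ord.
  rewrite -!big_split /=; apply: eq_bigr => j _; rewrite /nabla_y.
  have -> : E (- (eps i + eps j)) = E (- eps i) * E (- eps j) by rewrite opprD geD.
  have -> : E (- (eps i - eps j)) = E (- eps i) * E (eps j) by rewrite opprB addrC geD.
  have := geN R (eps i); have := geN R (eps j).
  move: (E (eps i)) (E (- eps i)) (E (eps j)) (E (- eps j)) => a a' b b' hb ha.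
  transitivity (a - (a * a') * (b + b') + (a * a') * (b * b') * a').
    by rewrite ha hb; ring.
  by ring.
(* The part [i%:R] of the coordinate of [rho] has been spent on the differences indexed by j < i;
   what remains, 1/2, 1 or 0, belongs to [nabla_z]. *)
suff H : E (rho X k 0 i *: eps i) * match X with
     | TypeB => 1 - E (- eps i)
     | TypeC => 1 - E (- (2 *: eps i))
     | TypeD => 1 end = E (i%:R *: eps i) * nabla_z i.
  by rewrite [LHS]mulrAC -H -[LHS]mulrA; congr (_ * _); rewrite [LHS]mulrC -mulrA.
rewrite /nabla_z mxE; case: X; last by [].
- rewrite scalerDl geD -mulrA mulrBr mulr1 -geD; congr (_ * (_ - E _)).
  by apply/rowP => j; rewrite !mxE; field.
- rewrite -natr1 scalerDl geD -mulrA mulrBr mulr1 -geD scale1r; congr (_ * (_ - E _)).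
  by apply/rowP => j; rewrite !mxE; field.
Qed.

Lemma nabla_below : below X (rho X k) nabla /\ nabla (rho X k) = 1.
Proof.
suff H (s : seq 'rV[rat]_k) : {subset s <= pos_roots X k} ->
   let f := \prod_(a <- s) (1 - E (- a)) in below X 0 f /\ f 0 = 1.
  have [b0 n0] := H _ (fun _ => id); have [b1 n1] := below_ge X R (rho X k).
  have [b2 n2] := belowM b1 b0; rewrite nablaE; move: b2 n2; rewrite addr0 => b2 ->.
  by split=> //; rewrite n0 n1 mulr1.
elim: s => [|a s ih] hs; first by rewrite /= big_nil; have := below_ge X R 0.
have ha : a \in pos_roots X k by apply: hs; rewrite mem_head.
have a0 := pos_root_neq0 ha.
have [b1 n1] := ih (fun x h => hs x (mem_behead (s := a :: s) h)).
have [b2 n2] : below X 0 (1 - E (- a)) /\ (1 - E (- a)) 0 = 1.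
  split=> [x|].
    rewrite gcoefB gcoef1 gcoef_ge; case: (x =P 0) => [->|_].
      by move=> _; rewrite subr0; exact: qcone0.
    case: (x =P - a) => [->|_]; last by rewrite subrr eqxx.
    by move=> _; rewrite sub0r opprK; apply: qcone_root.
  by rewrite gcoefB gcoef1 gcoef_ge eqxx eq_sym oppr_eq0 (negPf a0) subr0.
have := belowM b2 b1; rewrite /= big_cons addr0 => -[h1 ->]; split=> //.
by rewrite n1 n2 mulr1.
Qed.
End Nabla.

(** The denominator formula: both sides are antisymmetric, and [rho] is the only strictly dominant
    exponent below [rho]. *)
Lemma nabla_alt X k (R : numDomainType) : nabla X k R = alt X R (rho X k).
Proof.
have [b1 n1] := nabla_below X k R.
apply: (antisym_eq (@nabla_antisym X k R) (@alt_antisym X k R _)) => b sb.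
rewrite gcoef_alt_sdom//; last exact: sdom_rho.
case: eqP => [->//|bn]; apply/eqP; apply: contraT => /b1/(sdom_rho_max sb)//.
Qed.

(** * The Laplacian *)

Lemma eps_inj k : injective (@eps k).
Proof.
move=> i j /(congr1 (fun m : 'rV_k => m 0 i)); rewrite !eps_coef eqxx.
by case: eqP => // _ /eqP; rewrite oner_eq0.
Qed.

(** The sum of the coordinates separates the parts of the list, except the long roots of type C from
    the sums of two basis vectors; a coordinate equal to 1 separates these. *)
Lemma pos_roots_uniq X k : uniq (pos_roots X k).
Proof.
have coefE i (l : 'I_k) : @eps k i 0 l = (i == l)%:R by rewrite eps_coef.
have img_uniq (J : finType) (A : pred J) (h : J -> 'rV[rat]_k) :
    {in A &, injective h} -> uniq [seq h j | j in A].
  by move=> hi; rewrite map_inj_in_uniq ?enum_uniq// => x y; rewrite !mem_enum; apply: hi.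
have ne (i j : 'I_k) : (j < i)%N -> (i == j) = false by move=> ij; rewrite -val_eqE /=; lia.
rewrite /pos_roots !cat_uniq; apply/and5P; split.
- apply: img_uniq => -[i j] [i' j']; rewrite !unfold_in /= => ij ij' E.
  have h l := congr1 (fun m : 'rV_k => m 0 l) E.
  have := h i; have := h j; rewrite !mxE !eqxx /= => {h E}.
  rewrite [j == i]eq_sym (ne _ _ ij) /= => H1 H2; move: H2 H1.
  case: (i =P i') => [e1|_]; case: (i =P j') => [e2|_] => H2 H1;
    move: H1 H2; last by move=> _ /eqP; rewrite /= !(mulr0n, mulr1n, addr0) oner_eq0.
  - by move: ij'; rewrite -e1 -e2 ltnn.
  - case: (j =P i') => [e3|_]; first by move: ij; rewrite e1 e3 ltnn.
    case: (j =P j') => [e4|_]; first by rewrite e1 e4.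
    by move/eqP; rewrite /= !(mulr0n, mulr1n, addr0, add0r) oner_eq0.
  case: (j =P j') => [e4|_]; first by move: ij; rewrite e2 e4 ltnn.
  case: (j =P i') => [e3|_]; last first.
    by move/eqP; rewrite /= !(mulr0n, mulr1n, addr0, add0r) oner_eq0.
  by move: ij; rewrite e2 e3 ltnNge (ltnW ij').
- apply/hasPn => x /= Hx; apply/negP => Hx'.
  have [[i' j'] /= ij' E'] := fintype.imageP Hx'.
  have sumE (i j : 'I_k) : dot (eps i + eps j) (const_mx 1) = 2.
    by rewrite dotDl !dot_epsl !mxE.
  move: Hx; rewrite mem_cat => /orP[Hx|].
    have [[i j] /= ij E] := fintype.imageP Hx.
    have := sumE i' j'; rewrite -E' E dotBl !dot_epsl !mxE; lra.
  case: X => // Hx; have [i _ E] := fintype.imageP Hx; have := sumE i' j'; rewrite -E' E.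
    by rewrite dot_epsl mxE; lra.
  move=> _; move: E; rewrite E' => /(congr1 (fun m : 'rV_k => m 0 i')).
  rewrite !mxE !eqxx /= [i' == j'](ne _ _ ij'); by case: (_ == _) => /=; lra.
- apply: img_uniq => -[i j] [i' j']; rewrite !unfold_in /= => ij ij' E.
  have h l := congr1 (fun m : 'rV_k => m 0 l) E.
  have := h i; have := h j; rewrite !mxE !eqxx /= => {h E}.
  rewrite [j == i]eq_sym (ne _ _ ij) /=.
  case: (j =P j') => [->|_]; case: (i =P i') => [->//|_].
  - by move=> _; case: (i == j') => /= *; exfalso; lra.
  - by case: (j == i') => /= *; exfalso; lra.
  - by case: (j == i') => /= *; exfalso; lra.
- apply/hasPn => x /= Hx; apply/negP => Hx'.
  have [[i' j'] /= ij' E'] := fintype.imageP Hx'.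
  have : dot x (const_mx 1) = 0 by rewrite E' dotBl !dot_epsl !mxE subrr.
  case: X Hx => // Hx; have [i _ ->] := fintype.imageP Hx.
    by rewrite dot_epsl mxE; lra.
  by rewrite dotZl dot_epsl mxE; lra.
case: X => //; apply: img_uniq => i j _ _.
  exact: eps_inj.
by move/(scalerI (_ : 2 != 0 :> rat)) => h; apply: eps_inj; apply: h.
Qed.

(** * Derivatives of the denominator and of its product with a character *)

Section LogDerivative.
Variables (X : lie_type) (k : nat) (R : numFieldType).
Local Notation E := (ge R).
Local Notation galgk := (galg 'rV[rat]_k R).
Implicit Types (f g : galgk) (a b : 'rV[rat]_k).

(** If e^x is read as the function exp (x, .), this is the derivative in the direction [b], and
    [glap] is the Laplacian. *)
Definition gder b f : galgk := gweight (fun x => ratr (dot x b)) f.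
Definition glap f : galgk := gweight (fun x => ratr (dot x x)) f.

Lemma gderM b f g : gder b (f * g) = gder b f * g + f * gder b g.
Proof. by apply: gweight_derivation => x y; rewrite dotDl rmorphD. Qed.

Lemma gder_ge b a : gder b (E a) = gC _ (ratr (dot a b)) * E a.
Proof. by rewrite /gder gweight_ge gmonomE. Qed.

Lemma gder1 b : gder b 1 = 0.
Proof. by rewrite -ge0 gder_ge dot0l rmorph0 raddf0 mul0r. Qed.
Lemma gderB b f g : gder b (f - g) = gder b f - gder b g.
Proof. exact: raddfB. Qed.

Lemma gder_lin b f : gder b f = \sum_i gC _ (ratr (b 0 i)) * gder (eps i) f.
Proof.
apply: galgP => x; rewrite gcoef_sum gcoef_weight /dot rmorph_sum mulr_suml.
apply: eq_bigr => i _; rewrite gcoef_CM gcoef_weight dot_epsr rmorphM /=; ring.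
Qed.

Lemma glapM f g : glap (f * g) = glap f * g + f * glap g +
  (\sum_i gder (eps i) f * gder (eps i) g) *+ 2.
Proof.
apply: galgP => x; rewrite gcoefD gcoefMn gcoefD gcoef_sum gcoef_weight.
have wM Q u : (gweight Q f * u) x = \sum_(y <- gsupp f) gweight Q f y * u (x - y).
  apply: gcoefM_seq => [|y]; first exact: gsupp_uniq.
  rewrite gcoef_weight => h; apply: gsupp_in.
  by apply: contraNneq h => ->; rewrite mulr0.
rewrite (eq_bigr _ (fun i _ => wM _ _)) (wM _ g) !gcoefM.
rewrite exchange_big mulr_sumr -sumrMnl -!big_split /=; apply: eq_bigr => y _.
have {1 2}-> : x = y + (x - y) by rewrite addrC subrK.
move: (x - y) => z; rewrite !gcoef_weight.
have -> : \sum_i gder (eps i) f y * gder (eps i) g z = ratr (dot y z) * (f y * g z).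
  rewrite /dot rmorph_sum mulr_suml; apply: eq_bigr => i _.
  rewrite !gcoef_weight !dot_epsr rmorphM /=; ring.
rewrite dotDl !dotDr (dotC z y) !rmorphD /=; ring.
Qed.

Lemma gder_prod b (s : seq 'rV[rat]_k) (F : 'rV[rat]_k -> galgk) : uniq s ->
  gder b (\prod_(a <- s) F a) =
  \sum_(a <- s) gder b (F a) * \prod_(c <- rem a s) F c.
Proof.
elim: s => [|c s ih] /=; first by rewrite !big_nil gder1.
case/andP => cs us; rewrite !big_cons gderM ih// eqxx; congr (_ + _).
rewrite big_seq [RHS]big_seq mulr_sumr; apply: eq_bigr => a as_.
by rewrite eq_sym; case: eqP => [ac|_]; rewrite ?big_cons; [rewrite -ac as_ in cs|ring].
Qed.

(** The quotient of the denominator by e^a - 1, written without division. *)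
Definition nabla_root a : galgk :=
  E (rho X k - a) * \prod_(c <- rem a (pos_roots X k)) (1 - E (- c)).

Lemma nabla_rootE a : a \in pos_roots X k -> (E a - 1) * nabla_root a = nabla X k R.
Proof.
move=> ha; rewrite nablaE (perm_big _ (perm_to_rem ha)) big_cons /= /nabla_root geD.
have := geN R a; move: (E a) (E (- a)) => x y xy.
transitivity (E (rho X k) * (x * y - y) * \prod_(c <- rem a (pos_roots X k)) (1 - E (- c))).
  by ring.
by rewrite xy; ring.
Qed.

Lemma rho_half_sum : \sum_(a <- pos_roots X k) a = rho X k *+ 2.
Proof.
rewrite /pos_roots !big_cat !big_image /= addrA -big_split /=.
rewrite (eq_bigr (fun p : 'I_k * 'I_k => eps p.1 *+ 2)); last first.
  by move=> p _; rewrite addrACA subrr addr0 mulr2n.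
rewrite -(pair_big_dep xpredT (fun i j : 'I_k => (j < i)%N) (fun i j => eps i *+ 2)) /=.
rewrite (eq_bigr (fun i : 'I_k => (eps i *+ 2) *+ i)); last first.
  by move=> i _; rewrite (big_ord_narrow (ltnW (ltn_ord i))) sumr_const card_ord.
rewrite rho_sum -sumrMnl.
have E1 (i : 'I_k) : eps i *+ 2 *+ i = (2 * i%:R) *: eps i.
  by rewrite -mulrnA -scaler_nat natrM.
case: X => /=; rewrite ?big_image ?big_nil ?addr0 -?big_split /=; apply: eq_bigr => i _.
all: rewrite E1 -[RHS]scaler_nat scalerA mxE.
- by rewrite -[X in _ + X]scale1r -scalerDl; congr (_ *: _); field.
- by rewrite -scalerDl; congr (_ *: _); rewrite -natr1; ring.
- by [].
Qed.

(** Logarithmic derivative of the denominator. Writing [rho] as half the sum of the positive roots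
    turns its double into the sum of (a, b) (e^a + 1) / (e^a - 1), symmetric under a -> -a. *)
Lemma gder_nabla b : gder b (nabla X k R) *+ 2 =
  \sum_(a <- pos_roots X k) gC _ (ratr (dot a b)) * (E a + 1) * nabla_root a.
Proof.
rewrite nablaE gderM gder_ge gder_prod ?pos_roots_uniq// mulrnDl.
have -> : gC _ (ratr (dot (rho X k) b)) * E (rho X k) *
   \prod_(a <- pos_roots X k) (1 - E (- a)) *+ 2 =
   \sum_(a <- pos_roots X k) gC _ (ratr (dot a b)) * nabla X k R.
  rewrite -mulr_suml -(raddf_sum (@gC 'rV[rat]_k R)) -(raddf_sum (@ratr R)) /=.
  rewrite (_ : \sum_(a <- pos_roots X k) dot a b = dot (rho X k) b *+ 2); last first.
    rewrite dotC -mulr_natl -dotZr scaler_nat -rho_half_sum dot_sumr.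
    by apply: eq_bigr => a _; rewrite dotC.
  by rewrite nablaE !raddfMn /=; ring.
rewrite mulr_sumr -sumrMnl -big_split /= big_seq [RHS]big_seq; apply: eq_bigr => a ha.
rewrite -(nabla_rootE ha) /nabla_root gderB gder1 gder_ge dotNl rmorphN /= raddfN /= geD.
ring.
Qed.

Lemma alt_support (t x : 'rV[rat]_k) : alt X R t x != 0 -> dot x x = dot t t.
Proof.
rewrite gcoef_alt => h; apply: contrapT => H; move/eqP: h; apply.
rewrite big1// => w wW; case: eqP => [xE|_]; last by rewrite mulr0.
by case: H; rewrite xE dot_weyl_act.
Qed.

Lemma glap_nabla : glap (nabla X k R) =
  gC _ (ratr (dot (rho X k) (rho X k))) * nabla X k R.
Proof.
apply: galgP => x; rewrite gcoef_CM gcoef_weight nabla_alt.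
have [->|/alt_support->//] := eqVneq (alt X R (rho X k) x) 0.
by rewrite !mulr0.
Qed.

(** Multiplied by the denominator, the traces [T i] lose their own denominators e^(al i) - 1 and add
    up to four times the cross term of [glapM]. The relation of the last hypothesis then says that
    the product is an eigenvector. *)
Lemma nabla_casimir (I : finType) (al : I -> 'rV[rat]_k) (c : I -> nat)
  (T : I -> galgk) (ch : galgk) (t : R) :
  (forall i, c i != 0%N -> al i \in pos_roots X k \/ - al i \in pos_roots X k) ->
  (forall i, c i = 0%N -> T i = 0) ->
  (forall i, (E (al i) - 1) * T i = gder (al i) ch *+ c i) ->
  (forall G : 'rV[rat]_k -> galgk, G 0 = 0 ->
     \sum_i G (al i) *+ c i = (\sum_(a <- pos_roots X k) (G a + G (- a))) *+ 2) ->
  glap ch *+ 2 + \sum_i T i = gC _ t * ch *+ 2 ->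
  glap (nabla X k R * ch) =
    gC _ (t + ratr (dot (rho X k) (rho X k))) * (nabla X k R * ch).
Proof.
move=> al_root T0 TE GE casE.
(* This is the denominator divided by e^a - 1, times the derivative of [ch] along [a], for roots of
   both signs. The terms of [a] and -a add up to (e^a + 1) [nabla_root a] times that derivative, as
   in [gder_nabla]. *)
pose G a : galgk := if a \in pos_roots X k then nabla_root a * gder a ch
  else if - a \in pos_roots X k then E (- a) * nabla_root (- a) * gder (- a) ch else 0.
have nroot0 : (0 : 'rV[rat]_k) \notin pos_roots X k.
  by apply/negP => /pos_root_neq0; rewrite eqxx.
have notboth a : a \in pos_roots X k -> - a \notin pos_roots X k.
  move=> ha; apply/negP => hNa; have := root_height_ge1 ha; have := root_height_ge1 hNa.
  by rewrite raddfN /=; lra.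
have G0 : G 0 = 0 by rewrite /G oppr0 (negPf nroot0).
have TG i : nabla X k R * T i = G (al i) *+ c i.
  have [ci0|ci] := eqVneq (c i) 0%N; first by rewrite T0// ci0 mulr0.
  case: (al_root i ci) => hr; rewrite /G.
    by rewrite hr -(nabla_rootE hr) mulrAC TE; ring.
  have := notboth _ hr; rewrite opprK => /negPf ->; rewrite hr.
  rewrite -(nabla_rootE hr).
  set a := - al i; have H : (E (- a) - 1) * T i = - gder a ch *+ c i.
    rewrite /a opprK TE; congr (_ *+ _).
    by apply: galgP => x; rewrite gcoefN !gcoef_weight dotNr rmorphN mulNr opprK.
  move: H.
  have := geN R a; move: (E a) (E (- a)) => x y xy H.
  transitivity (nabla_root a * (x * y - x) * - T i).
    by rewrite xy; ring.
  by rewrite -mulrnAr -[gder a ch *+ _]opprK -mulNrn -H; ring.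
have sumT : nabla X k R * \sum_i T i =
    (\sum_i gder (eps i) (nabla X k R) * gder (eps i) ch) *+ 4.
  rewrite mulr_sumr (eq_bigr _ (fun i _ => TG i)) GE// -[4%N]/(2 * 2)%N mulrnA; congr (_ *+ 2).
  rewrite -sumrMnl.
  under [RHS]eq_bigr => i _ do rewrite -mulrnAl gder_nabla mulr_suml.
  rewrite exchange_big /= big_seq [RHS]big_seq; apply: eq_bigr => a ha.
  rewrite /G ha (negPf (notboth _ ha)) opprK ha.
  rewrite (gder_lin a ch) !mulr_sumr -big_split /=; apply: eq_bigr => i _.
  rewrite dot_epsr; ring.
have two0 : (2 : R) != 0 by rewrite pnatr_eq0.
have H2 : glap (nabla X k R * ch) *+ 2 =
    gC _ (t + ratr (dot (rho X k) (rho X k))) * (nabla X k R * ch) *+ 2.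
  rewrite glapM glap_nabla raddfD /=; set S := \sum_i _.
  have := congr1 (fun f => nabla X k R * f) casE; rewrite mulrDr sumT -/S => H.
  transitivity (gC _ (ratr (dot (rho X k) (rho X k))) * nabla X k R * ch *+ 2 +
    (nabla X k R * (glap ch *+ 2) + S *+ 4)); first by ring.
  by rewrite H; ring.
apply: galgP => x; have := congr1 (fun f : galgk => f x) H2; rewrite !gcoefMn.
by rewrite -[LHS]mulr_natl -[RHS]mulr_natl => /(mulfI two0).
Qed.
End LogDerivative.

(** * Weights of the natural module *)

Lemma sum_caseC (X : lie_type) (I : finType) (A : zmodType) (f : I -> A) :
  \sum_i (if X is TypeC then f i else - f i) =
  if X is TypeC then \sum_i f i else - \sum_i f i.
Proof. by case: X; rewrite ?sumrN. Qed.

Section Positions.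
Variables (X : lie_type) (k : nat).
Local Notation N := (natural_dim X k).
Local Notation pos := (@cartan_pos X k).
Implicit Types (a b : 'I_N) (i j : 'I_k).

(** The weight of the basis vector of index [a] of the natural representation; it is 0 for the
    middle vector of type B. *)
Definition pw a : 'rV[rat]_k :=
  \row_i ((a == pos i)%:R - (a == rev_ord (pos i))%:R).

Lemma pos_val i : pos i = (k - i.+1)%N :> nat. Proof. by []. Qed.
Lemma natural_dimE : N = (k.*2 + (if X is TypeB then 1 else 0))%N.
Proof. by case: X; rewrite /natural_dim ?addn0 ?addn1. Qed.
Lemma natural_dimP : exists2 e, N = (k.*2 + e)%N & (e = 1%N /\ X = TypeB) \/ e = 0%N.
Proof.
by rewrite natural_dimE; exists (if X is TypeB then 1 else 0)%N => //; case: X; [left|right|right].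
Qed.
Lemma rev_pos_val i : rev_ord (pos i) = (k + i + (if X is TypeB then 1 else 0))%N :> nat.
Proof. by rewrite /= natural_dimE; have := ltn_ord i; lia. Qed.

Lemma pos_inj : injective pos.
Proof.
move=> i j /(congr1 val); rewrite /= => h; apply: val_inj => /=.
by have := ltn_ord i; have := ltn_ord j; lia.
Qed.
Lemma pos_neq_rev i j : (pos i == rev_ord (pos j)) = false.
Proof.
apply/negP => /eqP/(congr1 val) /=; rewrite natural_dimE.
by have := ltn_ord i; have := ltn_ord j; lia.
Qed.

Lemma posP a : [\/ exists i, a = pos i, exists i, a = rev_ord (pos i) |
  X = TypeB /\ a = k :> nat].
Proof.
have aN := ltn_ord a.
have [ak|ka] := ltnP a k.
  have h : (k - a.+1 < k)%N by lia.
  by constructor 1; exists (Ordinal h); apply: val_inj; rewrite /= ; lia.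
have [h|h] := ltnP (N - a.+1) k.
  have h' : (k - (N - a.+1).+1 < k)%N by lia.
  constructor 2; exists (Ordinal h'); apply: val_inj; rewrite /=.
  by have [e NE _] := natural_dimP; lia.
constructor 3; have [e NE [[e1 XB]|e0]] := natural_dimP; first by split=> //; lia.
by exfalso; lia.
Qed.

Lemma pw_pos i : pw (pos i) = eps i.
Proof.
apply/rowP => j; rewrite mxE eps_coef pos_neq_rev subr0.
by rewrite (inj_eq pos_inj).
Qed.
Lemma pw_rev a : pw (rev_ord a) = - pw a.
Proof.
apply/rowP => j; rewrite !mxE opprB.
have -> : (rev_ord a == pos j) = (a == rev_ord (pos j)).
  by rewrite -(inj_eq rev_ord_inj) rev_ordK.
by rewrite (inj_eq rev_ord_inj).
Qed.
Lemma pw_mid a : X = TypeB -> a = k :> nat -> pw a = 0.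
Proof.
move=> XB ak; apply/rowP => j; rewrite !mxE; have jk := ltn_ord j.
have -> : (a == pos j) = false.
  by apply/negP => /eqP/(congr1 (@nat_of_ord N)); rewrite pos_val ak; lia.
have -> : (a == rev_ord (pos j)) = false.
  apply/negP => /eqP/(congr1 (@nat_of_ord N)); rewrite rev_pos_val ak XB; lia.
by rewrite subrr.
Qed.
Lemma rev_mid a : X = TypeB -> a = k :> nat -> rev_ord a = a.
Proof. by move=> XB ak; apply: val_inj; rewrite /= ak natural_dimE XB; lia. Qed.

Lemma pw_sum (A : zmodType) (K : 'rV[rat]_k -> A) :
  \sum_(a < N) K (pw a) =
  \sum_i (K (eps i) + K (- eps i)) + (if X is TypeB then K 0 else 0).
Proof.
pose isB := if X is TypeB then true else false.
pose mid : seq 'I_N := [seq a : 'I_N <- enum 'I_N | isB && (nat_of_ord a == k)].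
have midP a : (a \in mid) = (isB && (a == k :> nat)).
  by rewrite mem_filter mem_enum andbT.
have midu : uniq mid by rewrite filter_uniq ?enum_uniq.
have -> : \sum_(a < N) K (pw a) =
   \sum_(a <- [seq pos i | i : 'I_k] ++ [seq rev_ord (pos i) | i : 'I_k] ++ mid) K (pw a).
  apply: perm_big; apply: uniq_perm; first exact: index_enum_uniq.
    have u1 : uniq [seq pos i | i : 'I_k] by rewrite map_inj_uniq ?enum_uniq//; exact: pos_inj.
    have u2 : uniq [seq rev_ord (pos i) | i : 'I_k].
      by rewrite map_inj_uniq ?enum_uniq// => i j /rev_ord_inj/pos_inj.
    rewrite cat_uniq u1 cat_uniq u2 midu !andTb andbT; apply/andP; split.
        apply/hasPn => a; rewrite mem_cat => /orP[/fintype.imageP[i _ ->]|].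
          by apply/fintype.imageP => -[j _ /esym/eqP]; rewrite pos_neq_rev.
        rewrite midP => /andP[XB /eqP ak]; apply/fintype.imageP => -[j _ /(congr1 (@nat_of_ord N))].
        by rewrite ak pos_val; have := ltn_ord j; lia.
      apply/hasPn => a; rewrite midP => /andP[XB /eqP ak]; apply/fintype.imageP => -[j _].
      move/(congr1 (@nat_of_ord N)); rewrite rev_pos_val ak.
      by move: XB; rewrite /isB; case: (X) => // _; lia.
  move=> a; rewrite mem_index_enum !mem_cat; apply/esym.
  case: (posP a) => [[i ->]|[i ->]|[XB ak]].
  - by rewrite fintype.image_f.
  - by rewrite (fintype.image_f (fun i => rev_ord (pos i))) ?orbT.
  - have iB : isB by rewrite /isB XB.
    by rewrite midP iB ak eqxx !orbT.
rewrite !big_cat /= !big_image /= addrA -big_split /=; congr (_ + _).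
  by apply: eq_bigr => i _; rewrite pw_rev pw_pos.
have midE : \sum_(a <- mid) K (pw a) = if isB then K 0 else 0.
  rewrite /mid big_filter; case E: isB; last by rewrite big_pred0.
  have XB : X = TypeB by move: E; rewrite /isB; case: (X).
  have kN : (k < N)%N by rewrite natural_dimE XB; lia.
  rewrite big_enum_cond /= (big_pred1 (Ordinal kN)) ?pw_mid//.
by rewrite midE /isB; case: (X).
Qed.

(** The factor in the bracket of opposite root vectors, see [lie_bracket_XX]: 0 on the diagonal and
    where the root vector vanishes, 2 for the long roots of type C. *)
Definition cc a b : nat :=
  if a == b then 0%N else if b == rev_ord a then (if X is TypeC then 2 else 0)%N else 1%N.

Lemma pw_root_lt a b : (a < b)%N -> cc a b != 0%N -> pw a - pw b \in pos_roots X k.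
Proof.
rewrite /cc; case: (a =P b) => [->|_]; first by rewrite ltnn.
move=> ab cab; apply/pos_rootsP.
case: (posP a) ab cab => [[i ->]|[i ->]|[XB ak]]; case: (posP b) => [[j ->]|[j ->]|[XB' bk]].
- rewrite !pw_pos /= => ij _; left; exists i, j; split; last by right.
  by have := ltn_ord i; have := ltn_ord j; lia.
- rewrite pw_rev !pw_pos opprK => _; rewrite (inj_eq rev_ord_inj) (inj_eq pos_inj).
  have [->|ij] := eqVneq j i.
    by case: (X) => // _; right; exists i; rewrite scaler_nat mulr2n.
  move=> _; left; case: (ltngtP i j) => [h|h|/val_inj h]; last by rewrite h eqxx in ij.
    by exists j, i; split=> //; left; rewrite addrC.
  by exists i, j; split=> //; left.
- by rewrite (pw_mid XB' bk) pw_pos subr0 => _ _; right; rewrite XB'; exists i.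
- rewrite rev_pos_val pos_val => h.
  by have := ltn_ord i; have := ltn_ord j; lia.
- rewrite !rev_pos_val !pw_rev !pw_pos => h _; left; exists j, i; split.
    by have := ltn_ord i; have := ltn_ord j; lia.
  by right; rewrite opprK addrC.
- by rewrite rev_pos_val bk => h; lia.
- by rewrite ak pos_val; have := ltn_ord j; lia.
- by rewrite (pw_mid XB ak) pw_rev pw_pos sub0r opprK => _ _; right; rewrite XB; exists j.
- by rewrite ak bk ltnn.
Qed.

Lemma ccC a b : cc a b = cc b a.
Proof.
rewrite /cc [b == a]eq_sym; case: eqP => // _.
by rewrite -(inj_eq rev_ord_inj) rev_ordK eq_sym.
Qed.

Lemma pw_root a b : cc a b != 0%N ->
  pw a - pw b \in pos_roots X k \/ - (pw a - pw b) \in pos_roots X k.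
Proof.
move=> cab; case: (ltngtP a b) => [h|h|/val_inj h].
- by left; apply: pw_root_lt.
- by right; rewrite opprB; apply: pw_root_lt; rewrite // ccC.
- by move: cab; rewrite /cc h eqxx.
Qed.

Lemma sum_sym_pairs (A : zmodType) (F : 'I_k -> 'I_k -> A) :
  (forall i j, F i j = F j i) ->
  \sum_i \sum_j F i j = (\sum_(p : 'I_k * 'I_k | (p.2 < p.1)%N) F p.1 p.2) *+ 2 + \sum_i F i i.
Proof.
move=> FC.
have -> : \sum_i \sum_j F i j = \sum_(i < k) \sum_(j < k | (j < i)%N) F i j +
    \sum_(i < k) \sum_(j < k | (i < j)%N) F i j + \sum_i F i i.
  rewrite -!big_split; apply: eq_bigr => i _ /=.
  rewrite (bigD1 i)//= addrC; congr (_ + _).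
  rewrite (bigID (fun j : 'I_k => (j < i)%N)) /=; congr (_ + _); apply: eq_bigl => j.
    by case: ltnP; rewrite ?andbF// andbT -val_eqE /=; lia.
  by rewrite -val_eqE /=; lia.
have -> : \sum_(i < k) \sum_(j < k | (i < j)%N) F i j =
    \sum_(i < k) \sum_(j < k | (j < i)%N) F i j.
  by rewrite (exchange_big_dep xpredT)//=; apply: eq_bigr => i _; apply: eq_bigr.
by rewrite pair_big_dep mulr2n.
Qed.

(** Each root is the difference of weights of the two pairs (a, b) and (rev b, rev a). For the long
    roots of type C these pairs coincide, and [cc] counts them twice. *)
Lemma sum_roots_pairs (A : zmodType) (G : 'rV[rat]_k -> A) : G 0 = 0 ->
  \sum_(p : 'I_N * 'I_N) G (pw p.1 - pw p.2) *+ cc p.1 p.2 =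
  (\sum_(a <- pos_roots X k) (G a + G (- a))) *+ 2.
Proof.
move=> G0.
pose S1 := \sum_(i < k) (G (2 *: eps i) + G (- (2 *: eps i))).
pose S2 := \sum_(i < k) (G (eps i) + G (- eps i)).
pose F (i j : 'I_k) := G (eps i + eps j) + G (- (eps i + eps j)) +
  (G (eps i - eps j) + G (- (eps i - eps j))).
have two i : @eps k i + eps i = 2 *: eps i by rewrite scaler_nat mulr2n.
(* Compared with counting all pairs once, opposite positions are counted once more in type C and
   removed in types B and D. *)
have ccE a b : G (pw a - pw b) *+ cc a b = G (pw a - pw b) +
    (if b == rev_ord a then (if X is TypeC then G (pw a + pw a) else - G (pw a + pw a)) else 0).
  rewrite /cc; case: eqP => [->|_].
    rewrite subrr G0 mulr0n add0r; case: eqP => // e.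
    have := pw_rev b; rewrite -e => /eqP; rewrite eq_sym -subr_eq0 -opprD oppr_eq0 => /eqP->.
    by rewrite G0 oppr0; case: (X).
  case: eqP => [->|_]; last by rewrite mulr1n addr0.
  by rewrite pw_rev opprK; case: (X); rewrite ?mulr0n ?subrr// mulr2n.
have E1 : \sum_(p : 'I_N * 'I_N) G (pw p.1 - pw p.2) *+ cc p.1 p.2 =
   \sum_a \sum_b G (pw a - pw b) +
   (if X is TypeC then S1 else - S1).
  rewrite -(pair_bigA _ (fun a b => G (pw a - pw b) *+ cc a b)) /=.
  under eq_bigr => a _ do under eq_bigr => b _ do rewrite ccE.
  under eq_bigr => a _ do rewrite big_split /= -big_mkcond /= big_pred1_eq.
  rewrite big_split /=; congr (_ + _).
  have S1E : \sum_(a < N) G (pw a + pw a) = S1.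
    rewrite (pw_sum (fun v => G (v + v))) addr0 G0.
    have -> : (if X is TypeB then 0 else 0) = 0 :> A by case: (X).
    by rewrite addr0; apply: eq_bigr => i _; rewrite -opprD two.
  by rewrite sum_caseC S1E.
rewrite E1.
have E2 : \sum_a \sum_b G (pw a - pw b) = \sum_i \sum_j F i j +
    (if X is TypeB then S2 *+ 2 else 0).
  rewrite (pw_sum (fun v => \sum_b G (v - pw b))).
  have E3 v : \sum_b G (v - pw b) = \sum_j (G (v - eps j) + G (v + eps j)) +
      (if X is TypeB then G v else 0).
    rewrite (pw_sum (fun u => G (v - u))) subr0.
    by congr (_ + _); apply: eq_bigr => j _; rewrite opprK.
  under eq_bigr => i _ do rewrite !E3.
  rewrite E3 /S2.
  transitivity (\sum_(i < k) (\sum_(j < k) F i j +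
    (if X is TypeB then G (eps i) + G (- eps i) else 0)) +
    (if X is TypeB then \sum_(j < k) (G (eps j) + G (- eps j)) else 0)).
    congr (_ + _).
      apply: eq_bigr => i _; rewrite addrACA -big_split /=; congr (_ + _).
        apply: eq_bigr => j _; rewrite /F.
        have -> : - (eps i - eps j) = - eps i + eps j by rewrite opprB addrC.
        have -> : - (eps i + eps j) = - eps i - eps j by rewrite opprD.
        by rewrite [G (eps i - eps j) + G (eps i + eps j)]addrC addrACA.
      by case: (X); rewrite ?addr0.
    case: (X) => //; rewrite G0 addr0; apply: eq_bigr => j _.
    by rewrite !add0r addrC.
  rewrite big_split /= -addrA; congr (_ + _).
  by case: (X); rewrite ?addr0; [rewrite -/S2 mulr2n|rewrite big1|rewrite big1].
rewrite E2 sum_sym_pairs; last first.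
  move=> i j; rewrite /F [eps j + eps i]addrC; congr (_ + _).
  by rewrite !opprB addrC.
have -> : \sum_i F i i = S1.
  by apply: eq_bigr => i _; rewrite /F subrr oppr0 G0 !addr0 two.
have -> : \sum_(a <- pos_roots X k) (G a + G (- a)) =
   \sum_(p : 'I_k * 'I_k | (p.2 < p.1)%N) F p.1 p.2 +
   match X with TypeB => S2 | TypeC => S1 | TypeD => 0 end.
  rewrite /pos_roots !big_cat !big_image /= addrA -big_split /=; congr (_ + _).
  by case: (X); rewrite ?big_image// big_nil.
rewrite mulrnDl -!addrA; congr (_ + _).
case: (X).
- by congr (_ + _); rewrite addrC subrK.
- by congr (_ + _); rewrite add0r mulr2n.
- by congr (_ + _); rewrite add0r subrr mul0rn.
Qed.
End Positions.

(** * Root vectors *)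

Definition signC (C : pzRingType) (X : lie_type) (b : bool) : C :=
  if X is TypeC then (-1) ^+ b else 1.
Lemma signC_sq (C : pzRingType) X b : signC C X b * signC C X b = 1.
Proof. by rewrite /signC; case: X; rewrite ?mulr1// -expr2 sqrr_sign. Qed.

Lemma signC_rev (C : pzRingType) X n k c : (c < n)%N ->
  n = (k.*2 + (if X is TypeB then 1 else 0))%N ->
  signC C X (k <= n - c.+1)%N = signC C X true * signC C X (k <= c)%N.
Proof.
rewrite /signC; case: X => cn nE; rewrite ?mulr1//.
have -> : (k <= n - c.+1)%N = ~~ (k <= c)%N by lia.
by rewrite signrN mulN1r.
Qed.

Lemma signC_scale (C : pzRingType) X (V : lmodType C) (u v : V) :
  u - (if X is TypeC then -1 else 1 : C) *: u -
    (v - (if X is TypeC then -1 else 1 : C) *: v) =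
  (u - v) *+ (if X is TypeC then 2 else 0).
Proof.
case: X; rewrite ?scale1r ?scaleN1r ?subrr ?mulr0n//.
by rewrite !opprK mulr2n opprD addrACA.
Qed.

Section LieElements.
Variables (C : numClosedFieldType) (X : lie_type) (k : nat).
Local Notation N := (natural_dim X k).
Local Notation pos := (@cartan_pos X k).
Local Notation g := (@lie_alg C X k).
Implicit Types (a b c d : 'I_N) (A B Z : 'M[C]_N).

Definition fsign a : C := signC C X (k <= a)%N.

Lemma fsign_sq a : fsign a * fsign a = 1.
Proof. exact: signC_sq. Qed.

Lemma fsign_rev a b : fsign (rev_ord a) * fsign (rev_ord b) = fsign a * fsign b.
Proof.
pose t : C := signC C X true.
have tt : t * t = 1 by exact: signC_sq.
have rE c : fsign (rev_ord c) = t * fsign c.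
  exact: signC_rev (ltn_ord c) (natural_dimE X k).
by rewrite !rE mulrACA tt mul1r.
Qed.

(* [lie_sigma] is the anti-automorphism whose fixed space for the sign -1 is the
   Lie algebra; [lie_pi] is twice the projection onto it. *)
Definition lie_sigma A : 'M[C]_N :=
  \matrix_(a, b) (fsign a * fsign b * A (rev_ord b) (rev_ord a)).
Definition lie_pi A : 'M[C]_N := A - lie_sigma A.
(** A root vector of weight [pw a - pw b], or a Cartan element when a = b. These span the Lie
    algebra, each occurring up to sign at (a, b) and at (rev b, rev a). *)
Definition lieX a b : 'M[C]_N := lie_pi (delta_mx a b).

Lemma lie_sigmaZ (x : C) A B : lie_sigma (x *: A + B) = x *: lie_sigma A + lie_sigma B.
Proof. by apply/matrixP => a b; rewrite !mxE; ring. Qed.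
Fact lie_sigma_is_linear : linear lie_sigma. Proof. exact: lie_sigmaZ. Qed.
HB.instance Definition _ := GRing.isLinear.Build C 'M[C]_N 'M[C]_N *:%R lie_sigma
  lie_sigma_is_linear.
Fact lie_pi_is_linear : linear lie_pi.
Proof. by move=> x A B; rewrite /lie_pi linearP scalerBr opprD addrACA. Qed.
HB.instance Definition _ := GRing.isLinear.Build C 'M[C]_N 'M[C]_N *:%R lie_pi
  lie_pi_is_linear.

Lemma lie_sigma_mul A B : lie_sigma (A *m B) = lie_sigma B *m lie_sigma A.
Proof.
apply/matrixP => a b; rewrite !mxE (reindex_inj rev_ord_inj) mulr_sumr /=.
apply: eq_bigr => l _; rewrite !mxE; have := fsign_sq l; move: (fsign l) => s hs.
have -> : fsign a * s * B (rev_ord l) (rev_ord a) * (s * fsign b * A (rev_ord b) (rev_ord l)) =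
  (s * s) * (fsign a * fsign b * A (rev_ord b) (rev_ord l) * B (rev_ord l) (rev_ord a)) by ring.
by rewrite hs; ring.
Qed.

Lemma lie_sigmaK A : lie_sigma (lie_sigma A) = A.
Proof.
apply/matrixP => a b; rewrite !mxE !rev_ordK fsign_rev mulrC.
have := fsign_sq a; have := fsign_sq b; move: (fsign a) (fsign b) => s t ht hs.
transitivity ((s * s) * (t * t) * A a b); first by ring.
by rewrite hs ht; ring.
Qed.

Lemma lie_algE A : (A \in g) = (lie_sigma A == - A).
Proof.
have E a b : (A^T *m form_mx C X k + form_mx C X k *m A) a b =
   fsign (rev_ord b) * A (rev_ord b) a + fsign a * A (rev_ord a) b.
  rewrite !mxE (bigD1 (rev_ord b))//= big1 => [|l lb]; last first.
    rewrite !mxE; case: eqP => [e|_]; last by rewrite mulr0.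
    by move: lb; rewrite e rev_ordK eqxx.
  rewrite addr0 (bigD1 (rev_ord a))//= big1 => [|l /negPf la]; last first.
    by rewrite !mxE la mul0r.
  by rewrite addr0 !mxE rev_ordK !eqxx mulrC.
have S a b : fsign a * (A^T *m form_mx C X k + form_mx C X k *m A) a b =
    (lie_sigma A + A) (rev_ord a) b.
  rewrite E [RHS]mxE [lie_sigma A _ _]mxE rev_ordK mulrDr !mulrA fsign_sq mul1r.
  by rewrite -[b in fsign (rev_ord a) * fsign b](rev_ordK) fsign_rev.
rewrite -addr_eq0 [LHS]unfold_in /=; apply/eqP/eqP => H; apply/matrixP => a b.
  by rewrite -[a]rev_ordK -S H !mxE mulr0.
rewrite -[LHS]mul1r -(fsign_sq a) -mulrA S H !mxE; exact: mulr0.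
Qed.

Lemma lie_pi_in A : lie_pi A \in g.
Proof. by rewrite lie_algE /lie_pi linearB /= lie_sigmaK opprB. Qed.
Lemma lieX_in a b : lieX a b \in g. Proof. exact: lie_pi_in. Qed.

Lemma lie_pi_lie A : A \in g -> lie_pi A = A *+ 2.
Proof. by rewrite lie_algE /lie_pi => /eqP ->; rewrite opprK. Qed.

Lemma lie_span A : A \in g -> A = 2^-1 *: \sum_a \sum_b A a b *: lieX a b.
Proof.
move=> gA; have -> : \sum_a \sum_b A a b *: lieX a b = lie_pi A.
  rewrite [in RHS](matrix_sum_delta A) linear_sum; apply: eq_bigr => a _.
  by rewrite linear_sum; apply: eq_bigr => b _; rewrite linearZ.
by rewrite lie_pi_lie// -scaler_nat scalerA mulVf ?scale1r// pnatr_eq0.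
Qed.

Lemma lie_bracket_pi Z A : Z \in g ->
  Z *m lie_pi A - lie_pi A *m Z = lie_pi (Z *m A - A *m Z).
Proof.
rewrite lie_algE => /eqP sZ; rewrite /lie_pi [lie_sigma (_ - _)]linearB /= !lie_sigma_mul sZ.
rewrite mulmxBr mulmxBl mulmxN mulNmx.
by apply/matrixP => a b; rewrite !mxE; ring.
Qed.

Lemma lie_bracket_delta Z a b :
  Z *m delta_mx a b - delta_mx a b *m Z =
  \sum_c Z c a *: delta_mx c b - \sum_c Z b c *: delta_mx a c.
Proof.
congr (_ - _).
  apply/matrixP => i j; rewrite !mxE summxE (bigD1 a)//= big1 => [|l /negPf la]; last first.
    by rewrite mxE la mulr0.
  rewrite (bigD1 i)//= big1 => [|l /negPf li]; last by rewrite !mxE eq_sym li mulr0.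
  by rewrite !mxE !eqxx.
apply/matrixP => i j; rewrite !mxE summxE (bigD1 b)//= big1 => [|l /negPf la]; last first.
  by rewrite mxE la andbF mul0r.
rewrite (bigD1 j)//= big1 => [|l /negPf li]; last first.
  by rewrite !mxE [j == l]eq_sym li andbF mulr0.
by rewrite !mxE !eqxx !andbT !addr0 mulrC.
Qed.

Lemma lie_bracket_X Z a b : Z \in g ->
  Z *m lieX a b - lieX a b *m Z =
  \sum_c Z c a *: lieX c b - \sum_c Z b c *: lieX a c.
Proof.
move=> gZ; rewrite lie_bracket_pi// lie_bracket_delta.
have lin (F : 'I_N -> 'M[C]_N) : lie_pi (\sum_c F c) = \sum_c lie_pi (F c) by exact: linear_sum.
rewrite [lie_pi (_ - _)]linearB /= !lin.
by congr (_ - _); apply: eq_bigr => c _; rewrite linearZ.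
Qed.

Lemma lieXE a b c d : lieX a b c d =
  ((c == a) && (d == b))%:R - fsign a * fsign b * ((c == rev_ord b) && (d == rev_ord a))%:R.
Proof.
rewrite !mxE; have rE (x y : 'I_N) : (rev_ord x == y) = (x == rev_ord y).
  by rewrite -(inj_eq rev_ord_inj) rev_ordK.
rewrite !rE [(d == _) && _]andbC.
case: (c =P rev_ord b) => [->|_]; case: (d =P rev_ord a) => [->|_]; rewrite ?mulr0//.
by rewrite fsign_rev [fsign b * _]mulrC.
Qed.

Lemma lieX_rev a b : lieX (rev_ord b) (rev_ord a) = - (fsign a * fsign b) *: lieX a b.
Proof.
apply/matrixP => c d; rewrite [RHS]mxE !lieXE !rev_ordK fsign_rev.
have := fsign_sq a; have := fsign_sq b; move: (fsign a) (fsign b) => s t ht hs.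
have st : s * t * (s * t) = 1 by rewrite mulrACA hs ht mulr1.
move: ((c == rev_ord b) && (d == rev_ord a)) ((c == a) && (d == b)) => P Q.
by transitivity ((s * t * (s * t)) * P%:R - t * s * Q%:R); [rewrite st mul1r|ring].
Qed.

Definition lieH (i : 'I_k) : 'M[C]_N := lieX (pos i) (pos i).

Lemma lieHE i a b : lieH i a b = (a == b)%:R * ratr (pw a 0 i).
Proof.
rewrite lieXE fsign_sq mul1r !mxE rmorphB /= !ratr_nat.
case: (eqVneq a b) => [->|nab]; first by rewrite !andbb mul1r.
rewrite mul0r; apply/eqP; rewrite subr_eq0; apply/eqP; congr _%:R; congr nat_of_bool.
by apply/andP/andP => -[/eqP e1 /eqP e2]; rewrite e1 e2 eqxx in nab.
Qed.

Lemma lieX_diag a : lieX a a = \sum_i ratr (pw a 0 i) *: lieH i.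
Proof.
have epsE i : lieH i = \sum_j ratr (eps i 0 j) *: lieH j.
  rewrite (bigD1 i)//= big1 => [|j /negPf ji]; last first.
    by rewrite eps_coef eq_sym ji ratr_nat scale0r.
  by rewrite eps_coef eqxx ratr_nat scale1r addr0.
case: (posP a) => [[i ->]|[i ->]|[XB ak]].
- by rewrite pw_pos -epsE.
- rewrite pw_rev pw_pos lieX_rev fsign_sq scaleN1r -/(lieH i) {1}epsE -sumrN.
  by apply: eq_bigr => j _; rewrite [(- eps i) 0 j]mxE rmorphN scaleNr.
rewrite pw_mid// big1 => [|i _]; last by rewrite mxE rmorph0 scale0r.
apply/matrixP => c d; rewrite lieXE fsign_sq (rev_mid XB ak) mul1r subrr mxE//.
Qed.

Lemma lie_bracket_H i a b :
  lieH i *m lieX a b - lieX a b *m lieH i = ratr ((pw a - pw b) 0 i) *: lieX a b.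
Proof.
rewrite lie_bracket_X ?lieX_in// (bigD1 a)//= big1 => [|c /negPf ca]; last first.
  by rewrite lieHE ca mul0r scale0r.
rewrite [X in _ - X](bigD1 b)//= [X in _ - (_ + X)]big1 => [|c cb]; last first.
  by rewrite lieHE eq_sym (negPf cb) mul0r scale0r.
by rewrite !lieHE !eqxx !mul1r !addr0 -scalerBl !mxE -rmorphB.
Qed.

Lemma lie_bracket_XX a b :
  lieX a b *m lieX b a - lieX b a *m lieX a b = (lieX a a - lieX b b) *+ cc a b.
Proof.
rewrite /cc; have [->|nab] := eqVneq a b; first by rewrite !subrr mulr0n.
rewrite lie_bracket_X ?lieX_in//.
have E1 : \sum_c lieX a b c b *: lieX c a = lieX a a -
    (fsign a * fsign b * (b == rev_ord a)%:R) *: lieX (rev_ord b) a.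
  under eq_bigr => c _ do rewrite lieXE eqxx andbT scalerBl -scalerA.
  rewrite sumrB; congr (_ - _).
    rewrite (bigD1 a)//= eqxx scale1r big1 ?addr0// => c /negPf->; exact: scale0r.
  rewrite (bigD1 (rev_ord b))//= eqxx andTb scalerA big1 ?addr0// => c /negPf->.
  by rewrite andFb scale0r scaler0.
have E2 : \sum_c lieX a b a c *: lieX b c = lieX b b -
    (fsign a * fsign b * (b == rev_ord a)%:R) *: lieX b (rev_ord a).
  under eq_bigr => c _ do rewrite lieXE eqxx andTb scalerBl -scalerA.
  rewrite sumrB; congr (_ - _).
    rewrite (bigD1 b)//= eqxx scale1r big1 ?addr0// => c /negPf->; exact: scale0r.
  rewrite (bigD1 (rev_ord a))//= eqxx andbT scalerA big1 ?addr0//; last first.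
    by move=> c /negPf->; rewrite andbF scale0r scaler0.
  by rewrite -(inj_eq rev_ord_inj) rev_ordK eq_sym.
(* For opposite positions the correction terms are multiples of the diagonal elements themselves:
   they double the bracket in type C and cancel it otherwise. *)
rewrite E1 E2; case: eqP => [ba|_]; last by rewrite !mulr0 !scale0r !subr0 mulr1n.
rewrite ba rev_ordK !mulr1; set s := _ * _.
have -> : s = if X is TypeC then -1 else 1.
  have := signC_rev C (ltn_ord a) (natural_dimE X k); rewrite /s /fsign => ->.
  by rewrite mulrCA signC_sq mulr1 /signC.
exact: signC_scale.
Qed.

End LieElements.

(** * The Casimir element and highest weight vectors *)

Section Modules.
Variables (C : numClosedFieldType) (X : lie_type) (k : nat).
Local Notation N := (natural_dim X k).
Local Notation pos := (@cartan_pos X k).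
Local Notation g := (@lie_alg C X k).
Implicit Types (M : lie_module C X k) (a b c d : 'I_N) (A B Z : 'M[C]_N).

Lemma lieX0 a b : a != b -> cc a b = 0%N -> lieX C a b = 0.
Proof.
move=> nab; rewrite /cc (negPf nab); case: eqP => // ba X0.
apply/matrixP => i j; rewrite lieXE mxE ba rev_ordK.
suff -> : fsign C a * fsign C (rev_ord a) = 1 by rewrite mul1r subrr.
rewrite /fsign (signC_rev C (ltn_ord a) (natural_dimE X k)) mulrCA signC_sq mulr1.
by move: X0; clear; case: X.
Qed.

Definition mX M a b := mact M (lieX C a b).
Definition mH M i := mact M (lieH C X i).

Lemma mact_comm M Z a b : Z \in g ->
  mX M a b *m mact M Z - mact M Z *m mX M a b =
  \sum_c Z c a *: mX M c b - \sum_c Z b c *: mX M a c.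
Proof.
move=> gZ; rewrite -mact_bracket ?lieX_in// lie_bracket_X// (linearB (mact M)).
by rewrite !(linear_sum (mact M)); congr (_ - _); apply: eq_bigr => c _; rewrite linearZ.
Qed.

Lemma mX_mH M i a b :
  mX M a b *m mH M i = mH M i *m mX M a b + ratr ((pw a - pw b) 0 i) *: mX M a b.
Proof.
apply/eqP; rewrite addrC -subr_eq -mact_bracket ?lieX_in// lie_bracket_H linearZ //.
Qed.

Lemma mX_comm M a b :
  mX M b a *m mX M a b - mX M a b *m mX M b a = (mX M a a - mX M b b) *+ cc a b.
Proof. by rewrite -mact_bracket ?lieX_in// lie_bracket_XX (raddfMn (mact M)) /= (raddfB (mact M)). Qed.

Lemma mX_diag M a : mX M a a = \sum_i ratr (pw a 0 i) *: mH M i.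
Proof.
by rewrite /mX lieX_diag (linear_sum (mact M)); apply: eq_bigr => i _; rewrite linearZ.
Qed.

Definition casimir M := \sum_a \sum_b mX M a b *m mX M b a.

(** Leibniz' rule gives four triple sums, which cancel in pairs after renaming the indices. *)
Lemma casimir_comm M Z : Z \in g -> comm_mx (casimir M) (mact M Z).
Proof.
move=> gZ; apply/eqP; rewrite -subr_eq0; set z := mact M Z; apply/eqP.
pose x := mX M.
pose S (t : 'I_N -> 'I_N -> 'I_N -> 'M[C]_(mdim M)) := \sum_a \sum_b \sum_c t a b c.
have E a b : x a b *m x b a *m z - z *m (x a b *m x b a) =
   (\sum_c Z c b *: (x a b *m x c a) - \sum_c Z a c *: (x a b *m x b c)) +
   (\sum_c Z c a *: (x c b *m x b a) - \sum_c Z b c *: (x a c *m x b a)).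
  transitivity (x a b *m (x b a *m z - z *m x b a) + (x a b *m z - z *m x a b) *m x b a).
    by rewrite mulmxBr mulmxBl !mulmxA addrA subrK.
  rewrite !mact_comm// mulmxBr mulmxBl !mulmx_sumr !mulmx_suml.
  by congr (_ - _ + (_ - _)); apply: eq_bigr => c _; rewrite -?scalemxAr -?scalemxAl.
rewrite /casimir mulmx_suml mulmx_sumr -sumrB.
under eq_bigr => a _.
  rewrite mulmx_suml mulmx_sumr -sumrB.
  under eq_bigr => b _ do rewrite E.
  rewrite big_split /= !sumrB.
  over.
rewrite big_split /= !sumrB.
have -> : \sum_a \sum_b \sum_c Z b c *: (x a c *m x b a) =
          \sum_a \sum_b \sum_c Z c b *: (x a b *m x c a).
  by apply: eq_bigr => a _; rewrite exchange_big.
have -> : \sum_a \sum_b \sum_c Z c a *: (x c b *m x b a) =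
          \sum_a \sum_b \sum_c Z a c *: (x a b *m x b c).
  under eq_bigr => a _ do rewrite exchange_big /=.
  rewrite exchange_big /=; apply: eq_bigr => a _.
  by rewrite exchange_big.
by rewrite addrC addrA subrK subrr.
Qed.

Definition hwv M (l : 'rV[rat]_k) (v : 'rV[C]_(mdim M)) : Prop :=
  [/\ v != 0, forall a b, (a < b)%N -> v *m mX M a b = 0 &
      forall i, v *m mH M i = ratr (l 0 i) *: v].

Lemma hwvP M l : has_highest_weight M l <-> exists v, hwv (M := M) l v.
Proof.
split=> -[v].
  move=> [v0 H]; exists v; split=> // [a b ab|i].
    rewrite H ?lieX_in//.
      rewrite big1 ?scale0r// => i _; rewrite lieXE.
      have -> : (pos i == a) && (pos i == b) = false.
        by apply/negP => /andP[/eqP e1 /eqP e2]; move: ab; rewrite -e1 -e2 ltnn.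
      have -> : (pos i == rev_ord b) && (pos i == rev_ord a) = false.
        apply/negP => /andP[/eqP -> /eqP/rev_ord_inj e]; by rewrite e ltnn in ab.
      by rewrite mulr0 subrr mulr0.
    move=> c d dc; rewrite lieXE.
    have -> : (c == a) && (d == b) = false.
      by apply/negP => /andP[/eqP e1 /eqP e2]; move: ab dc; rewrite e1 e2; lia.
    have -> : (c == rev_ord b) && (d == rev_ord a) = false.
      apply/negP => /andP[/eqP e1 /eqP e2]; move: dc; rewrite e1 e2 /=.
      by have := ltn_ord a; have := ltn_ord b; lia.
    by rewrite mulr0 subrr.
  rewrite H ?lieX_in//; last first.
    by move=> c d dc; rewrite lieHE -val_eqE /= (gtn_eqF dc) mul0r.
  congr (_ *: _); rewrite (bigD1 i)//= big1 => [|j /negPf ji]; last first.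
    by rewrite lieHE eqxx pw_pos eps_coef ji ratr_nat /= mulr0n !mulr0.
  by rewrite lieHE !eqxx pw_pos eps_coef eqxx ratr_nat mul1r mulr1 addr0.
move=> [v0 Hn HH]; exists v; split=> // A gA Aup.
have xaa a : v *m mX M a a = (\sum_i ratr (pw a 0 i) * ratr (l 0 i)) *: v.
  rewrite mX_diag mulmx_sumr scaler_suml; apply: eq_bigr => i _.
  by rewrite -scalemxAr HH scalerA.
rewrite {1}(lie_span gA) linearZ (linear_sum (mact M)) -scalemxAr mulmx_sumr.
have -> : \sum_a v *m mact M (\sum_b A a b *: lieX C a b) =
   \sum_a (A a a * \sum_i ratr (pw a 0 i) * ratr (l 0 i)) *: v.
  apply: eq_bigr => a _; rewrite (linear_sum (mact M)) mulmx_sumr (bigD1 a)//= big1 => [|b ba].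
    by rewrite linearZ -scalemxAr -/(mX M a a) xaa scalerA addr0.
  rewrite linearZ -scalemxAr -/(mX M a b); case: (ltngtP a b) => [h|h|/val_inj h].
  - by rewrite Hn// scaler0.
  - by rewrite Aup// scale0r.
  - by rewrite h eqxx in ba.
rewrite -scaler_suml scalerA; congr (_ *: _).
under eq_bigr => a _ do rewrite mulr_sumr.
rewrite exchange_big /= mulr_sumr; apply: eq_bigr => i _.
under eq_bigr => a _ do rewrite mulrA.
rewrite -mulr_suml.
(* Elements of the Lie algebra have opposite entries at opposite diagonal positions; the resulting 2
   compensates the 1/2 of [lie_span]. *)
have -> : \sum_a A a a * ratr (pw a 0 i) = 2 * A (pos i) (pos i).
  under eq_bigr => a _ do rewrite mxE rmorphB /= !ratr_nat mulrBr.
  rewrite sumrB (bigD1 (pos i))//= big1 => [|a /negPf->]; last by rewrite mulr0.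
  rewrite [X in _ - X](bigD1 (rev_ord (pos i)))//= [X in _ - (_ + X)]big1 => [|a /negPf->]; last by rewrite mulr0.
  have := gA; rewrite lie_algE => /eqP/matrixP/(_ (pos i) (pos i)).
  rewrite !mxE fsign_sq mul1r => ->; rewrite !eqxx; rewrite /=; ring.
by rewrite mulrA mulKf ?pnatr_eq0// mulrC.
Qed.

Definition nstable M (U : 'M[C]_(mdim M)) :=
  forall a b, (b < a)%N -> stablemx U (mX M a b).
Definition gstable M (U : 'M[C]_(mdim M)) := forall a b, stablemx U (mX M a b).

Lemma gstableP M U : gstable (M := M) U <-> (forall A, A \in g -> stablemx U (mact M A)).
Proof.
split=> H => [A gA|a b]; last by apply: H; apply: lieX_in.
rewrite (lie_span gA) linearZ (linear_sum (mact M)) -scalemxAr mulmx_sumr scalemx_sub//.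
apply: summx_sub => a _; rewrite (linear_sum (mact M)) mulmx_sumr; apply: summx_sub => b _.
by rewrite linearZ -scalemxAr scalemx_sub//; apply: H.
Qed.

(* A minimal subspace stable under the lower triangular part and containing a
   highest weight vector is a submodule: its elements sent into it by all upper
   triangular elements form a subspace with the same two properties. *)
Lemma hwv_submodule M l v U : hwv (M := M) l v -> (v <= U)%MS -> nstable U ->
  exists U0 : 'M[C]_(mdim M), [/\ (v <= U0)%MS, (U0 <= U)%MS & gstable U0].
Proof.
move=> [v0 vn vH] vU nU.
pose P (U0 : 'M[C]_(mdim M)) := [/\ (v <= U0)%MS, (U0 <= U)%MS & nstable U0].
have ex : exists n, `[< exists U0, P U0 /\ \rank U0 = n >].
  by exists (\rank U); apply/asboolP; exists U; split=> //; split.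
case: (ex_minnP ex) => n /asboolP[U0 [[vU0 U0U nU0] rU0]] min.
exists U0; split=> //.
pose U1 := (U0 :&: \bigcap_(p : 'I_N * 'I_N | (p.1 <= p.2)%N)
   kermx (mX M p.1 p.2 *m cokermx U0))%MS.
have U1P m (A : 'M_(m, mdim M)) : (A <= U1)%MS <->
    (A <= U0)%MS /\ forall a b, (a <= b)%N -> (A *m mX M a b <= U0)%MS.
  rewrite sub_capmx; split=> [/andP[AU0 /sub_bigcapmxP H]|[-> H]].
    split=> // a b ab; have := H (a, b) ab.
    by rewrite sub_kermx mulmxA -submxE.
  apply/sub_bigcapmxP => -[a b] /= ab; rewrite sub_kermx mulmxA -submxE.
  exact: H.
have [U1U0 U1X] := (U1P _ U1).1 (submx_refl _).
have U1all a b : (U1 *m mX M a b <= U0)%MS.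
  case: (leqP a b) => [|ba]; first exact: U1X.
  exact: submx_trans (submxMr _ U1U0) (nU0 _ _ ba).
have nU1 : nstable U1.
  move=> a b ba; apply/U1P; split=> [|c d cd]; first exact: U1all.
  (* The lower triangular element is moved past the upper triangular one; the commutator is a
     combination of root vectors, all of which send [U1] into [U0]. *)
  have := mact_comm M c d (lieX_in C a b); rewrite -/(mX M a b) => E.
  have -> : U1 *m mX M a b *m mX M c d = U1 *m mX M c d *m mX M a b -
     (\sum_e lieX C a b e c *: (U1 *m mX M e d) - \sum_e lieX C a b d e *: (U1 *m mX M c e)).
    have -> : \sum_e lieX C a b e c *: (U1 *m mX M e d) -
        \sum_e lieX C a b d e *: (U1 *m mX M c e) =
        U1 *m (mX M c d *m mX M a b - mX M a b *m mX M c d).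
      rewrite E mulmxBr !mulmx_sumr; congr (_ - _); apply: eq_bigr => e _;
      by rewrite scalemxAr.
    by rewrite mulmxBr !mulmxA opprB addrC subrK.
  rewrite addmx_sub ?eqmx_opp//; first exact: submx_trans (submxMr _ (U1X _ _ cd)) (nU0 _ _ ba).
  by rewrite addmx_sub ?eqmx_opp//; apply: summx_sub => e _; rewrite scalemx_sub.
have vU1 : (v <= U1)%MS.
  apply/U1P; split=> // a b; rewrite leq_eqVlt => /orP[/eqP/val_inj <-|ab].
    rewrite mX_diag mulmx_sumr; apply: summx_sub => i _.
    by rewrite -scalemxAr vH !scalemx_sub.
  by rewrite vn// sub0mx.
have U01 : (U0 <= U1)%MS.
  have := min (\rank U1); rewrite -rU0 => /(_ _) H.
  have [_ <-] := mxrank_leqif_sup U1U0.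
  rewrite eqn_leq mxrankS//= H//; apply/asboolP; exists U1; split=> //; split=> //.
  exact: submx_trans U1U0 U0U.
by move=> a b; apply: submx_trans (submxMr _ U01) (U1all a b).
Qed.

Lemma irr_full M l v U : irreducible_module M -> hwv (M := M) l v -> (v <= U)%MS ->
  nstable U -> row_full U.
Proof.
move=> [_ irr] hv vU nU; have [U0 [vU0 U0U gU0]] := hwv_submodule hv vU nU.
rewrite -sub1mx; apply: submx_trans U0U; rewrite sub1mx; apply: irr.
  by apply/gstableP.
by apply: contraTneq vU0 => ->; case: hv => v0 _ _; rewrite submx0.
Qed.
End Modules.

(** * Weight bases *)

(** Used to extract bases made of weight vectors from spanning families of such vectors. *)
Lemma max_free_rows (F : fieldType) d (P : 'rV[F]_d -> Prop) :
  exists m (B : 'M[F]_(m, d)), [/\ row_free B, forall r, P (row r B) &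
    forall u, P u -> (u <= B)%MS].
Proof.
pose Q m := `[< exists B : 'M[F]_(m, d), row_free B /\ forall r, P (row r B) >].
have exQ : exists m, Q m.
  by exists 0%N; apply/asboolP; exists 0; split; [rewrite /row_free mxrank0|case].
have bound m : Q m -> (m <= d)%N.
  by move=> /asboolP[B [fB _]]; rewrite -(eqP fB) rank_leq_col.
case: (ex_maxnP exQ bound) => m /asboolP[B [fB PB]] max.
exists m, B; split=> // u Pu; apply: contraT => nuB.
suff /max : Q (m + 1)%N by rewrite addn1 ltnn.
apply/asboolP; exists (col_mx B u); split.
  rewrite -row_leq_rank -addsmxE.
  have : (\rank B < \rank (B + u)%MS)%N.
    rewrite ltn_neqAle mxrankS ?addsmxSl// andbT; apply/negP => /eqP e.
    move/negP: nuB; apply; have [_ h] := mxrank_leqif_sup (addsmxSl B u).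
    move: h; rewrite e eqxx => /esym h; apply: submx_trans h; exact: addsmxSr.
  by rewrite (eqP fB) addn1.
move=> r; case: (split_ordP r) => i ->; rewrite ?rowKu ?rowKd//.
by rewrite row_id.
Qed.

Lemma pinvmx_intertwine (F : fieldType) m n (f : 'M[F]_(m, n)) (A : 'M_m) (B : 'M_n) :
  row_free f -> row_full f -> A *m f = f *m B -> B *m pinvmx f = pinvmx f *m A.
Proof.
move=> ff fF H.
rewrite -[RHS]mulmx1 -(mulmxVp ff) mulmxA -(mulmxA _ A) H !mulmxA.
by rewrite mulVpmx// mul1mx.
Qed.

Section WeightBases.
Variables (C : numClosedFieldType) (X : lie_type) (k : nat).
Local Notation N := (natural_dim X k).
Local Notation pos := (@cartan_pos X k).
Local Notation g := (@lie_alg C X k).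
Implicit Types (M S : lie_module C X k) (a b : 'I_N) (A : 'M[C]_N).

Definition has_weights M (wt : 'I_(mdim M) -> 'rV[rat]_k) :=
  forall i, mH M i = diag_mx (\row_c ratr (wt c 0 i)).

Definition intertwines M S (f : 'M[C]_(mdim M, mdim S)) :=
  forall A, A \in g -> mact M A *m f = f *m mact S A.

Section Conj.
Variables (M : lie_module C X k) (B : 'M[C]_(mdim M)).
Hypothesis uB : B \in unitmx.
Definition conj_act A : 'M[C]_(mdim M) := B *m mact M A *m invmx B.
Fact conj_act_is_linear : linear conj_act.
Proof.
by move=> c A A'; rewrite /conj_act linearP mulmxDr mulmxDl -scalemxAr -scalemxAl.
Qed.
HB.instance Definition _ := GRing.isLinear.Build C 'M[C]_N 'M[C]_(mdim M) *:%R
  conj_act conj_act_is_linear.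
Fact conj_act_bracket A A' : A \in g -> A' \in g ->
  conj_act (A *m A' - A' *m A) = conj_act A' *m conj_act A - conj_act A *m conj_act A'.
Proof.
move=> gA gA'; rewrite /conj_act mact_bracket// mulmxBr mulmxBl.
by rewrite !mulmxA !(mulmxKV uB).
Qed.
Definition conj_module : lie_module C X k := LieModule conj_act_bracket.
Lemma conj_module_iso : module_iso conj_module M.
Proof.
exists B; split; rewrite ?row_free_unit ?row_full_unit// => A gA.
by rewrite /= /conj_act mulmxKV.
Qed.
End Conj.

Lemma module_iso_sym M S : module_iso M S -> module_iso S M.
Proof.
move=> [f [ff fF fi]]; exists (pinvmx f); split.
- by apply/row_freeP; exists f; rewrite mulVpmx.
- by apply/row_fullP; exists f; rewrite mulmxVp.
by move=> A gA; apply: pinvmx_intertwine => //; apply: fi.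
Qed.

Lemma module_iso_trans M S T : module_iso M S -> module_iso S T -> module_iso M T.
Proof.
move=> [f [ff fF fi]] [h [hf hF hi]]; exists (f *m h); split.
- apply/row_freeP; exists (pinvmx h *m pinvmx f).
  by rewrite mulmxA -(mulmxA f) mulmxVp// mulmx1 mulmxVp.
- apply/row_fullP; exists (pinvmx h *m pinvmx f).
  by rewrite mulmxA -(mulmxA _ _ f) mulVpmx// mulmx1 mulVpmx.
by move=> A gA; rewrite mulmxA fi// -mulmxA hi// mulmxA.
Qed.

Lemma module_iso_dim M S : module_iso M S -> mdim M = mdim S.
Proof. by move=> [f [/eqP f1 /eqP f2 _]]; rewrite -f1 f2. Qed.

Lemma module_iso_irr M S : module_iso M S -> irreducible_module M -> irreducible_module S.
Proof.
move=> iso [d0 irr]; split; first by rewrite -(module_iso_dim iso).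
move: iso => [f [ff fF fi]] U sU U0.
pose V : 'M_(mdim M) := (<<U *m pinvmx f>>)%MS.
have VE : (V :=: U *m pinvmx f)%MS by exact: genmxE.
have fullV : row_full V.
  apply: irr.
    move=> A gA; rewrite (eqmxMr _ VE) VE -mulmxA.
    rewrite -(pinvmx_intertwine ff fF (fi A gA)).
    by rewrite mulmxA submxMr// sU.
  apply: contraNneq U0 => V0.
  have : (U *m pinvmx f *m f <= V *m f)%MS by rewrite (eqmxMr f VE).
  by rewrite V0 mul0mx => /submx0null; rewrite -mulmxA mulVpmx// mulmx1 => ->.
rewrite -sub1mx -(mulVpmx fF).
have := submxMr f (_ : (pinvmx f <= V)%MS); rewrite submx_full// => /(_ isT) h.
apply: submx_trans h _; rewrite (eqmxMr _ VE) -mulmxA mulVpmx// mulmx1.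
exact: submx_refl.
Qed.

Lemma module_iso_hwv M S l : module_iso M S -> has_highest_weight M l ->
  has_highest_weight S l.
Proof.
move=> [f [ff fF fi]] [v [v0 H]]; exists (v *m f); split.
  apply: contraNneq v0 => vf; rewrite -[v]mulmx1 -(mulmxVp ff) mulmxA vf mul0mx //.
by move=> A gA Au; rewrite -mulmxA -fi// mulmxA H// scalemxAl.
Qed.

Section Shift.
Variables (M : lie_module C X k) (wt : 'I_(mdim M) -> 'rV[rat]_k).
Hypothesis hw : has_weights wt.

Lemma weight_shift a b c d : mX M a b c d != 0 -> wt d = wt c + (pw a - pw b).
Proof.
move=> x0; apply/rowP => i; have := mX_mH M i a b; rewrite hw.
move=> /(congr1 (fun m : 'M_(mdim M) => m c d)); rewrite mul_mx_diag mul_diag_mx !mxE.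
rewrite -[ratr (wt d 0 i)]/(ratr (wt d 0 i)) => H; apply: (fmorph_inj (@ratr C)).
apply: (mulfI x0); rewrite H rmorphD /=; ring.
Qed.

Lemma mX_diag_weight a : mX M a a = diag_mx (\row_c ratr (dot (wt c) (pw a))).
Proof.
rewrite mX_diag; apply/matrixP => c d; rewrite summxE [RHS]mxE mxE /dot.
rewrite rmorph_sum -sumrMnl; apply: eq_bigr => i _.
by rewrite mxE hw !mxE rmorphM mulrnAr mulrC.
Qed.

Lemma delta_weight c i :
  (delta_mx 0 c : 'rV[C]_(mdim M)) *m mH M i = ratr (wt c 0 i) *: delta_mx 0 c.
Proof.
rewrite hw mul_mx_diag; apply/rowP => d; rewrite !mxE eqxx /= mulrC.
by case: (d =P c) => [->//|_]; rewrite !mulr0.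
Qed.

Lemma max_weight_hwv : (0 < mdim M)%N -> exists c, hwv (M := M) (wt c) (delta_mx 0 c).
Proof.
move=> d0; pose c0 : 'I_(mdim M) := Ordinal d0.
have := @arg_maxP _ rat _ c0 xpredT (fun c => root_height (wt c)) isT.
case=> c _ cmax; exists c; split.
- by apply/eqP => /rowP/(_ c)/eqP; rewrite !mxE !eqxx oner_eq0.
- move=> a b ab; rewrite -rowE; apply/rowP => d; rewrite !mxE.
  apply/eqP; apply: contraT => x0; have wE := weight_shift x0.
  have [c00|cab] := eqVneq (cc a b) 0%N.
    by move: x0; rewrite /mX lieX0 ?linear0 ?mxE ?eqxx// -val_eqE /= ltn_eqF.
  have := root_height_ge1 (pw_root_lt ab cab); have := cmax d isT.
  by rewrite wE /= raddfD /=; lra.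
by move=> i; apply: delta_weight.
Qed.
End Shift.

Lemma weight_rows_basis M m (B : 'M[C]_(m, mdim M)) (wt : 'I_m -> 'rV[rat]_k) :
  row_free B -> row_full B ->
  (forall r i, row r B *m mH M i = ratr (wt r 0 i) *: row r B) ->
  exists M' (wt' : 'I_(mdim M') -> 'rV[rat]_k) (s : 'I_(mdim M') -> 'I_m),
    [/\ module_iso M' M, has_weights wt', forall c, wt' c = wt (s c) & bijective s].
Proof.
move=> fB FB; have md : m = mdim M by rewrite -(eqP fB) (eqP FB).
subst m => H; have uB : B \in unitmx by rewrite -row_free_unit.
exists (conj_module uB), wt, id; split=> //; last by exists id.
  exact: conj_module_iso.
move=> i; rewrite /mH /= /conj_act.
suff -> : B *m mact M (lieH C X i) = diag_mx (\row_c ratr (wt c 0 i)) *m B.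
  by rewrite mulmxK.
apply/row_matrixP => r; rewrite row_mul H.
by apply/rowP => c; rewrite mul_diag_mx !mxE.
Qed.

Lemma quotient_weights M (wt : 'I_(mdim M) -> 'rV[rat]_k) S
    (p : 'M[C]_(mdim M, mdim S)) :
  has_weights wt -> row_full p -> intertwines p ->
  exists S' (wt' : 'I_(mdim S') -> 'rV[rat]_k),
    [/\ module_iso S' S, has_weights wt' & forall c, exists d, wt' c = wt d].
Proof.
move=> hw fp ip.
have [m [B [fB PB max]]] := max_free_rows (fun u : 'rV[C]_(mdim S) => exists a0 : 'I_(mdim M), u = row a0 p).
have [al alE] := choice PB.
have FB : row_full B.
  rewrite -sub1mx; apply: submx_trans (_ : (p <= B)%MS); first by rewrite sub1mx.
  by apply/row_subP => a; apply: max; exists a.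
have [|S' [wt' [s [iso hw' wE _]]]] := @weight_rows_basis S m B (fun r => wt (al r)) fB FB.
  move=> r i; rewrite alE -row_mul -ip ?lieX_in// -/(mH M i) hw.
  by apply/rowP => c; rewrite mul_diag_mx !mxE.
by exists S', wt'; split=> // c; exists (al (s c)); rewrite wE.
Qed.

(** The weight vectors of weight below [l] span a space that contains the highest weight vector and
    is stable under lowering, hence everything by [irr_full]. *)
Lemma hw_basis M l : irreducible_module M -> has_highest_weight M l ->
  exists M' (wt : 'I_(mdim M') -> 'rV[rat]_k),
    [/\ module_iso M' M, has_weights wt, forall c, qcone X (l - wt c) &
        exists c0, forall c, (wt c == l) = (c == c0)].
Proof.
move=> irr /hwvP[v hv]; have [v0 vn vH] := hv.
(* The last condition keeps only the multiples of [v] in weight [l]. Lowered vectors never have this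
   weight, and the condition gives multiplicity one. *)
pose good (kap : 'rV[rat]_k) (u : 'rV[C]_(mdim M)) :=
  [/\ forall i, u *m mH M i = ratr (kap 0 i) *: u, qcone X (l - kap) &
      kap = l -> (u <= v)%MS].
have [m [B [fB PB max]]] := max_free_rows (fun u => exists kap, good kap u).
have vB : (v <= B)%MS.
  by apply: max; exists l; split=> //; rewrite subrr; exact: qcone0.
have nB a b : (b < a)%N -> (B *m mX M a b <= B)%MS.
  move=> ba; apply/row_subP => r; rewrite row_mul; have [kap [uH uq ul]] := PB r.
  move: (row r B) uH uq ul => u uH uq ul.
  have [c0|cab] := eqVneq (cc a b) 0%N.
    by rewrite /mX lieX0 ?linear0 ?mulmx0 ?sub0mx// -val_eqE /= gtn_eqF.
  have rt : pw b - pw a \in pos_roots X k by apply: pw_root_lt; rewrite // ccC.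
  apply: max; exists (kap + (pw a - pw b)); split.
  - move=> i; rewrite -mulmxA mX_mH mulmxDr -scalemxAr mulmxA uH -scalemxAl -scalerDl.
    by rewrite [(kap + _) 0 i]mxE rmorphD.
  - rewrite opprD opprB addrA addrAC -addrA.
    rewrite [l + _](_ : _ = (l - kap) + (pw b - pw a)); last first.
      by apply/rowP => i; rewrite !mxE; ring.
    by apply: qconeD => //; apply: qcone_root.
  - move=> kl; exfalso; have : qcone X (- (pw b - pw a)).
      by rewrite (_ : - _ = l - kap)//; rewrite -kl opprB addrAC subrr add0r.
    by move/(qcone_antisym (qcone_root rt)) => r0; have := pos_root_neq0 rt; rewrite r0 eqxx.
have FB : row_full B.
  have e : (<<B>> :=: B)%MS by exact: genmxE.
  rewrite -sub1mx -e sub1mx; apply: (irr_full irr hv); first by rewrite e.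
  by move=> a b ba; rewrite (eqmxMr _ e) e nB.
have [wt wtE] := choice PB.
have [|M' [wt' [s [iso hw' wE bs]]]] := @weight_rows_basis M m B wt fB FB.
  by move=> r i; case: (wtE r).
exists M', wt'; split=> //; first by move=> c; rewrite wE; case: (wtE (s c)).
have uniq_l r r' : wt r = l -> wt r' = l -> r = r'.
  move=> e e'; have [_ _ /(_ e) h] := wtE r; have [_ _ /(_ e') h'] := wtE r'.
  apply: contrapT => /eqP ne.
  have [x rE] := sub_rVP h; have [x' r'E] := sub_rVP h'.
  have /row_freeP[D BD] := fB.
  have ED (t : 'I_m) : row t B *m D = delta_mx 0 t by rewrite -row_mul BD rowE mulmx1.
  have := ED r; have := ED r'; rewrite rE r'E -!scalemxAl => h1 h2.
  have := congr1 (fun u => x *: u) h1; rewrite scalerA mulrC -scalerA h2.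
  move=> /rowP/(_ r); rewrite !mxE !eqxx (negPf ne) /= mulr0 mulr1 => x0.
  by move/rowP/(_ r'): h1; rewrite x0 scale0r !mxE !eqxx => /eqP; rewrite eq_sym oner_eq0.
have /submxP[u vE] := vB.
have [r0 ur0] : exists r, u 0 r != 0.
  apply/existsP; apply: contraNT v0; rewrite negb_exists => /forallP h.
  rewrite vE (_ : u = 0) ?mul0mx//; apply/rowP => r; rewrite mxE.
  by apply/eqP; have := h r; rewrite negbK.
have r0l : wt r0 = l.
  apply/rowP => i; have := vH i; rewrite vE -mulmxA.
  have -> : B *m mH M i = diag_mx (\row_r ratr (wt r 0 i)) *m B.
    apply/row_matrixP => r; rewrite row_mul; have [-> _ _] := wtE r.
    by apply/rowP => c; rewrite [RHS]mxE mul_diag_mx !mxE.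
  rewrite mulmxA scalemxAl => /(row_free_inj fB)/rowP/(_ r0).
  rewrite mul_mx_diag !mxE mulrC => /(mulIf ur0); exact: (fmorph_inj (@ratr C)).
have [s' ss' s's] := bs; exists (s' r0) => c; rewrite wE.
apply/eqP/eqP => [h|->]; last by rewrite s's.
by rewrite -[c]ss' (uniq_l _ _ h r0l).
Qed.
Lemma weight_raise M (wt : 'I_(mdim M) -> 'rV[rat]_k) l a b c d : has_weights wt ->
  (forall c, qcone X (l - wt c)) -> wt c = l -> (a < b)%N -> mX M a b c d = 0.
Proof.
move=> hw qc wc ab; apply/eqP; apply: contraT => x0; have wE := weight_shift hw x0.
have [c00|cab] := eqVneq (cc a b) 0%N.
  by move: x0; rewrite /mX lieX0 ?linear0 ?mxE ?eqxx// -val_eqE /= ltn_eqF.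
have rt := pw_root_lt ab cab; have := qc d; rewrite wE wc opprD addNKr => q.
by have := qcone_antisym (qcone_root rt) q; move/eqP; rewrite (negPf (pos_root_neq0 rt)).
Qed.

Lemma weight_lower M (wt : 'I_(mdim M) -> 'rV[rat]_k) l a b c d : has_weights wt ->
  (forall c, qcone X (l - wt c)) -> wt d = l -> (b < a)%N -> mX M a b c d = 0.
Proof.
move=> hw qc wd ba; apply/eqP; apply: contraT => x0; have wE := weight_shift hw x0.
have [c00|cab] := eqVneq (cc a b) 0%N.
  by move: x0; rewrite /mX lieX0 ?linear0 ?mxE ?eqxx// -val_eqE /= gtn_eqF.
rewrite ccC in cab; have rt := pw_root_lt ba cab; have := qc c.
have -> : l - wt c = - (pw b - pw a) by rewrite -wd wE addrAC subrr add0r opprB.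
by move/(qcone_antisym (qcone_root rt))/eqP; rewrite (negPf (pos_root_neq0 rt)).
Qed.

Lemma top_hwv M (wt : 'I_(mdim M) -> 'rV[rat]_k) l c0 : has_weights wt ->
  (forall c, qcone X (l - wt c)) -> wt c0 = l -> hwv (M := M) l (delta_mx 0 c0).
Proof.
move=> hw qc wc0; split.
- by apply/eqP => /rowP/(_ c0)/eqP; rewrite !mxE !eqxx oner_eq0.
- move=> a b ab; rewrite -rowE; apply/rowP => d; rewrite !mxE.
  exact: weight_raise qc wc0 ab.
- by move=> i; rewrite (delta_weight hw) wc0.
Qed.
End WeightBases.

(** * Representations of sl2 *)

Lemma stable_eigenvector (C : numClosedFieldType) m n (U : 'M[C]_(m, n)) (Q : 'M[C]_n) :
  (U *m Q <= U)%MS -> U != 0 ->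
  exists (v : 'rV[C]_n) (x : C), [/\ (v <= U)%MS, v != 0 & v *m Q = x *: v].
Proof.
move=> sU U0; pose B := row_base U.
have rk : (0 < \rank U)%N by rewrite lt0n mxrank_eq0.
have /submxP[D BD] : (B *m Q <= B)%MS.
  by rewrite (eqmxMr _ (eq_row_base U)) eq_row_base.
have [x /eigenvalueP[w wD w0]] := spectral.eigenvalue_closed D rk.
exists (w *m B), x; split.
- by apply: submx_trans (submxMl _ _) _; rewrite eq_row_base.
- apply: contraNneq w0 => wB0; apply/eqP; apply: (row_free_inj (row_base_free U)).
  by rewrite -/B wB0 mul0mx.
- by rewrite -mulmxA BD mulmxA wD scalemxAl.
Qed.

Lemma scale_rV_inj (F : fieldType) n (u : 'rV[F]_n) x y :
  u != 0 -> x *: u = y *: u -> x = y.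
Proof.
move=> u0 /eqP; rewrite -subr_eq0 -scalerBl scaler_eq0 (negPf u0) orbF subr_eq0.
by move/eqP.
Qed.

Section SL2.
Variables (C : numClosedFieldType) (k d : nat) (wt : 'I_d -> 'rV[rat]_k).
Implicit Types (E F : 'M[C]_d) (al kap : 'rV[rat]_k) (v : 'rV[C]_d).

Definition shifts E al := forall c e, E c e != 0 -> wt e = wt c + al.
Definition supp kap v := forall c, v 0 c != 0 -> wt c = kap.

Lemma supp_shift E al kap v : shifts E al -> supp kap v -> supp (kap + al) (v *m E).
Proof.
move=> sE sv c; rewrite mxE => h.
have [e he] : exists e, v 0 e * E e c != 0.
  apply/existsP; apply: contraNT h; rewrite negb_exists => /forallP h.
  by rewrite big1// => e _; apply/eqP; have := h e; rewrite negbK.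
move: he; rewrite mulf_eq0 negb_or => /andP[/sv <- /sE] //.
Qed.

Definition powmx E s : 'M[C]_d := iter s (mulmx E) 1%:M.
Lemma powmxSr E s : powmx E s.+1 = powmx E s *m E.
Proof.
elim: s => [|s ih]; first by rewrite /= mul1mx mulmx1.
by rewrite -[LHS]/(E *m powmx E s.+1) {1}ih mulmxA.
Qed.
Lemma supp_pow E al kap v s : shifts E al -> supp kap v ->
  supp (kap + al *+ s) (v *m powmx E s).
Proof.
move=> sE sv; elim: s => [|s ih]; first by rewrite mulr0n addr0 mulmx1.
by rewrite powmxSr mulmxA mulrSr addrA; apply: supp_shift.
Qed.

Lemma supp_diag kap v (h : 'rV[rat]_k -> C) : supp kap v ->
  v *m diag_mx (\row_c h (wt c)) = h kap *: v.
Proof.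
move=> sv; apply/rowP => c; rewrite mul_mx_diag !mxE mulrC.
by have [->|/sv->//] := eqVneq (v 0 c) 0; rewrite !mulr0.
Qed.

Lemma suppZ kap v (x : C) : supp kap v -> supp kap (x *: v).
Proof. by move=> sv c; rewrite mxE mulf_eq0 negb_or => /andP[_]; apply: sv. Qed.
Lemma suppD kap v u : supp kap v -> supp kap u -> supp kap (v + u).
Proof.
move=> sv su c; rewrite mxE; have [->|/sv//] := eqVneq (v 0 c) 0.
by rewrite add0r; apply: su.
Qed.

Lemma pow_comm E Q s : Q *m E = E *m Q -> Q *m powmx E s = powmx E s *m Q.
Proof.
move=> QE; elim: s => [|s ih]; first by rewrite mulmx1 mul1mx.
by rewrite powmxSr mulmxA ih -!mulmxA QE.
Qed.

Variables (E F : 'M[C]_d) (al : 'rV[rat]_k) (m : 'rV[rat]_k -> rat).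
Hypothesis mD : {morph m : x y / x + y}.
Hypothesis m_al : m al = 2.
Hypothesis sE : shifts E al.
Hypothesis sF : shifts F (- al).
Local Notation H := (diag_mx (\row_c ratr (m (wt c))) : 'M[C]_d).
Hypothesis EF : F *m E - E *m F = H.

Let mN x : m (- x) = - m x.
Proof.
have m0 : m 0 = 0 by apply: (addrI (m 0)); rewrite -mD !addr0.
by apply/eqP; rewrite -addr_eq0 -mD addNr m0.
Qed.
Let mMn x n : m (x *+ n) = m x *+ n.
Proof.
elim: n => [|n ih]; last by rewrite !mulrS mD ih.
by rewrite !mulr0n -(subrr x) mD mN subrr.
Qed.

(* Four times the Casimir element of sl2. *)
Let Q : 'M[C]_d := (E *m F) *+ 4 + (H *m H + H *+ 2).

Let Q' : Q = (F *m E) *+ 4 + (H *m H - H *+ 2).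
Proof.
have FE : F *m E = E *m F + H by rewrite -EF addrC subrK.
rewrite FE /Q; move: (E *m F) (H *m H) => x y; rewrite mulrnDl.
by apply/matrixP => a b; rewrite !(mxE, mulmxnE); ring.
Qed.

Let FH : F *m H = H *m F - F *+ 2.
Proof.
apply/matrixP => a b; rewrite [F *+ 2]mulr2n mul_mx_diag mul_diag_mx !mxE.
have [->|f0] := eqVneq (F a b) 0; first by rewrite !mulr0 mul0r addr0 subr0.
by rewrite (sF f0) mD mN m_al rmorphB /=  ; ring.
Qed.

Let mn (A B : 'M[C]_d) n : A *m (B *+ n) = (A *m B) *+ n.
Proof. exact: raddfMn. Qed.
Let nm (A B : 'M[C]_d) n : (A *+ n) *m B = (A *m B) *+ n.
Proof. by rewrite -!scaler_nat scalemxAl. Qed.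

Let QF : Q *m F = F *m Q.
Proof.
rewrite {1}Q' /Q mulmxDl mulmxBl [F *m (_ + _)]mulmxDr [F *m (_ + H *+ 2)]mulmxDr !nm !mn.
rewrite [F *m (H *m H)]mulmxA !FH mulmxBl -[H *m F *m H]mulmxA !FH mulmxBr nm mn FH.
rewrite [F *m (E *m F)]mulmxA -[H *m H *m F]mulmxA.
move: (F *m E *m F) (H *m (H *m F)) (H *m F) => x y z.
rewrite !mulrnBl -!mulrnA; apply/matrixP => a b; rewrite !mxE; ring.
Qed.

Let HE : E *m H = H *m E + E *+ 2.
Proof.
apply/matrixP => a b; rewrite [E *+ 2]mulr2n mul_mx_diag mul_diag_mx !mxE.
have [->|f0] := eqVneq (E a b) 0; first by rewrite !mulr0 mul0r !addr0.
by rewrite (sE f0) mD m_al rmorphD /= ; ring.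
Qed.

Let QE : Q *m E = E *m Q.
Proof.
rewrite [in RHS]Q' {1}/Q mulmxDl mulmxDl [E *m (_ + _)]mulmxDr [E *m (_ - H *+ 2)]mulmxBr !nm !mn.
rewrite [E *m (H *m H)]mulmxA !HE mulmxDl -[H *m E *m H]mulmxA !HE mulmxDr nm mn HE.
rewrite [E *m (F *m E)]mulmxA -[H *m H *m E]mulmxA.
move: (E *m F *m E) (H *m (H *m E)) (H *m E) => x y z.
rewrite ?mulrnDl -?mulrnA; apply/matrixP => a b; rewrite !mxE; ring.
Qed.

Let pow_first_zero (A : 'M[C]_d) v : v != 0 -> (exists s, v *m powmx A s = 0) ->
  exists s, v *m powmx A s != 0 /\ v *m powmx A s *m A = 0 /\
    forall t, v *m powmx A t = 0 -> (s < t)%N.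
Proof.
move=> v0 ex; have ex' : exists s, v *m powmx A s == 0 by have [s h] := ex; exists s; apply/eqP.
case: (ex_minnP ex') => -[|s] /eqP vs min; first by rewrite mulmx1 in vs; rewrite vs eqxx in v0.
exists s; split; [|split].
- by apply/negP => /min; rewrite ltnn.
- by rewrite -mulmxA -powmxSr.
- by move=> t /eqP/min.
Qed.

(** Let [u] and [w] be the last nonzero images of [v] under powers of F and of E. If F^j killed [v],
    the eigenvalue of [Q] would be both a^2 - 2a and b^2 + 2b, where a = j - 2i with i < j and b = j
    + 2s; but (b - a + 2) (b + a) is positive. *)
Lemma sl2_injective kap v j : m kap = j%:R -> supp kap v -> v *m powmx F j = 0 ->
  forall x, v *m Q = x *: v -> v = 0.
Proof.
move=> mk sv vF x vQ; apply: contrapT => /eqP v0.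
have [i [ui [uF lij]]] := pow_first_zero v0 (ex_intro _ j vF).
have {}lij := lij _ vF.
have [s [ws [wE _]]] : exists s, v *m powmx E s != 0 /\ v *m powmx E s *m E = 0 /\
    forall t, v *m powmx E t = 0 -> (s < t)%N.
  apply: pow_first_zero => //.
  (* A bound for all the values of [m] on weights; a large power of E leaves this range, so it kills
     [v]. *)
  pose S := \sum_c `|m (wt c)|.
  have S0 : 0 <= S by apply: sumr_ge0.
  exists (Num.truncn S).+1; apply/eqP; apply: contraT => /rV0Pn[c /(supp_pow sE sv) wc].
  have : `|m (wt c)| <= S by rewrite /S (bigD1 c)//= lerDl sumr_ge0.
  rewrite wc mD mMn m_al mk => h.
  have := truncnS_gt S; move: h; set t := (Num.truncn S).+1 => h.
  have : 2 *+ t = t%:R + t%:R :> rat by rewrite -mulr_natr; ring.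
  have t0 : 0 <= t%:R :> rat by []. have j0 : 0 <= j%:R :> rat by [].
  move=> E2; move: h; rewrite E2 ger0_norm; last by rewrite !addr_ge0.
  lra.
have su := supp_pow (s := i) sF sv; have sw := supp_pow (s := s) sE sv.
set u := v *m powmx F i in ui uF su; set w := v *m powmx E s in ws wE sw.
have uQ : u *m Q = x *: u by rewrite /u -mulmxA -pow_comm// mulmxA vQ scalemxAl.
have wQ : w *m Q = x *: w by rewrite /w -mulmxA -pow_comm// mulmxA vQ scalemxAl.
pose a : C := ratr (m (kap + - al *+ i)); pose b : C := ratr (m (kap + al *+ s)).
have uH : u *m H = a *: u by apply: (supp_diag (fun y => ratr (m y)) su).
have wH : w *m H = b *: w by apply: (supp_diag (fun y => ratr (m y)) sw).
have ux : x = a * a - a *+ 2.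
  apply: (scale_rV_inj ui); rewrite -uQ Q' mulmxDr mulmxBr !mulmxA uH.
  have -> : u *m (F *m E *+ 4) = 0.
    by rewrite -scaler_nat -scalemxAr mulmxA uF mul0mx scaler0.
  rewrite -scalemxAl uH -[H *+ 2]scaler_nat -scalemxAr uH add0r !scalerA -scalerBl.
  by congr (_ *: _); ring.
have wx : x = b * b + b *+ 2.
  apply: (scale_rV_inj ws); rewrite -wQ /Q mulmxDr mulmxDr !mulmxA wH.
  have -> : w *m (E *m F *+ 4) = 0.
    by rewrite -scaler_nat -scalemxAr mulmxA wE mul0mx scaler0.
  rewrite -scalemxAl wH -[H *+ 2]scaler_nat -scalemxAr wH add0r !scalerA -scalerDl.
  by congr (_ *: _); ring.
have aE : a = j%:R - 2 * i%:R.
  by rewrite /a mD mMn mN m_al mk rmorphD /= ratr_nat raddfMn /= rmorphN /= ratr_nat; ring.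
have bE : b = j%:R + 2 * s%:R.
  by rewrite /b mD mMn m_al mk rmorphD /= ratr_nat raddfMn /= ratr_nat; ring.
have : (b - a + 2) * (b + a) = 0.
  by transitivity ((b * b + b *+ 2) - (a * a - a *+ 2)); [ring|rewrite -ux -wx subrr].
have e1 : b - a + 2 = (2 * s + 2 * i + 2)%N%:R by rewrite aE bE natrD natrD !natrM; ring.
have e2 : b + a = (2 * s + 2 * (j - i))%N%:R.
  by rewrite aE bE natrD !natrM natrB ?(ltnW lij)//; ring.
rewrite e1 e2 => /eqP; rewrite mulf_eq0 !pnatr_eq0; lia.
Qed.

(** F^j maps one weight space into the other. A nonzero kernel would be stable under [Q] and contain
    an eigenvector, against [sl2_injective]. *)
Lemma sl2_le kap j : m kap = j%:R ->
  (#|[pred c | (wt c == kap)%R]| <= #|[pred c | (wt c == kap - al *+ j)%R]|)%N.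
Proof.
move=> mk; set p := [pred c | _]; set q := [pred c | _].
pose A : 'M[C]_(#|p|, d) := \matrix_(r, c) (c == enum_val r)%:R.
pose B : 'M[C]_(#|q|, d) := \matrix_(r, c) (c == enum_val r)%:R.
have suppA n (y : 'M[C]_(n, #|p|)) r : supp kap (row r (y *m A)).
  move=> c; rewrite !mxE => h; apply/eqP; apply: contraNT h => wc.
  rewrite big1// => e _; rewrite !mxE; case: eqP => [ce|_]; last by rewrite mulr0.
  by move: wc; have := enum_valP e; rewrite ce inE => ->.
have suppA1 (v : 'rV[C]_d) : supp kap v -> (v <= A)%MS.
  move=> sv; apply/submxP; exists (\row_r v 0 (enum_val r)); apply/rowP => c.
  rewrite mxE; have [v0|vc] := eqVneq (v 0 c) 0.
    rewrite v0 big1// => e _; rewrite !mxE; case: eqP => [<-|_]; rewrite ?v0 ?mul0r ?mulr0//.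
  have cp : c \in p by rewrite inE (sv _ vc).
  rewrite (bigD1 (enum_rank_in cp c))//= !mxE enum_rankK_in// eqxx mulr1 big1 ?addr0// => e ec.
  rewrite !mxE; case: eqP => [ce|_]; last by rewrite mulr0.
  by case/negP: ec; apply/eqP/enum_val_inj; rewrite enum_rankK_in.
have Afree : row_free A.
  apply/row_freeP; exists A^T; apply/matrixP => r s; rewrite !mxE.
  rewrite (bigD1 (enum_val r))//= !mxE eqxx mul1r big1 ?addr0 => [|c /negPf cr].
    by rewrite (inj_eq enum_val_inj).
  by rewrite !mxE cr mul0r.
rewrite leqNgt; apply/negP => lt_pq.
have rk : (\rank (A *m powmx F j) <= #|q|)%N.
  have -> : A *m powmx F j = A *m powmx F j *m B^T *m B.
    apply/row_matrixP => r; rewrite !row_mul.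
    have sr : supp (kap - al *+ j) (row r A *m powmx F j).
      rewrite -mulNrn; apply: supp_pow => //; rewrite -[A]mul1mx; exact: suppA.
    move: (row r A *m _) sr => v sv; apply/rowP => c; rewrite mxE.
    under eq_bigr => e _.
      rewrite mxE (bigD1 (enum_val e))//= !mxE eqxx mulr1 big1 => [|l /negPf le]; last first.
        by rewrite !mxE le mulr0.
      rewrite addr0; over.
    have [v0|vc] := eqVneq (v 0 c) 0.
      by rewrite v0 big1// => e _; case: eqP => [<-|_]; rewrite ?v0 ?mul0r ?mulr0.
    have cq : c \in q by rewrite inE (sv _ vc).
    rewrite (bigD1 (enum_rank_in cq c))//= enum_rankK_in// eqxx mulr1 big1 ?addr0// => e ec.
    case: eqP => [ce|_]; last by rewrite mulr0.
    by case/negP: ec; apply/eqP/enum_val_inj; rewrite enum_rankK_in.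
  exact: leq_trans (mxrankM_maxr _ _) (rank_leq_row _).
pose K := kermx (A *m powmx F j) *m A.
have K0 : K != 0.
  apply/negP => /eqP K0; have : kermx (A *m powmx F j) = 0.
    by apply: (row_free_inj Afree); rewrite mul0mx.
  move/eqP; rewrite -mxrank_eq0 mxrank_ker subn_eq0 => h.
  by have := leq_trans h rk; rewrite leqNgt lt_pq.
have KP (v : 'rV[C]_d) : (v <= K)%MS <-> supp kap v /\ v *m powmx F j = 0.
  split=> [/submxP[y ->]|[sv vF]].
    have kA : K *m powmx F j = 0 by rewrite /K -mulmxA; apply: mulmx_ker.
    split; last by rewrite -mulmxA kA mulmx0.
    rewrite /K mulmxA -[X in supp _ X](row_id ord0); exact: suppA.
  have /submxP[y yA] := suppA1 v sv.
  rewrite yA /K submxMr//; apply/sub_kermxP; by rewrite mulmxA -yA.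
have sK : (K *m Q <= K)%MS.
  apply/row_subP => r; rewrite row_mul.
  have /KP[sr rF] : (row r K <= K)%MS by exact: row_sub.
  apply/KP; split.
    move: (row r K) sr => v sv; rewrite /Q mulmxDr [v *m (_ + H *+ 2)]mulmxDr.
    have vH (u : 'rV[C]_d) : supp kap u -> supp kap (u *m H).
      by move=> su; rewrite (supp_diag (fun y => ratr (m y)) su); apply: suppZ.
    have EFv : supp kap (v *m (E *m F)).
      by rewrite mulmxA; have := supp_shift sF (supp_shift sE sv); rewrite addrK.
    apply: suppD; first by rewrite -scaler_nat -scalemxAr; apply: suppZ.
    apply: suppD; first by rewrite mulmxA; apply/vH/vH.
    by rewrite -scaler_nat -scalemxAr; apply/suppZ/vH.
  by rewrite -mulmxA pow_comm// mulmxA rF mul0mx.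
have [v [x [vK v0 vQ]]] := stable_eigenvector sK K0.
have /KP[sv vF] := vK.
by rewrite (sl2_injective mk sv vF vQ) eqxx in v0.
Qed.
End SL2.

(** * The Weyl character formula *)

Lemma root_positions X k (al : 'rV[rat]_k) : al \in pos_roots X k ->
  exists a b : 'I_(natural_dim X k), [/\ a != b, pw a - pw b = al & cc a b != 0%N].
Proof.
move=> /pos_rootsP[[i [j [ij [->|->]]]]|].
- exists (cartan_pos X i), (rev_ord (cartan_pos X j)); rewrite /cc pos_neq_rev.
  rewrite pw_rev !pw_pos opprK (inj_eq rev_ord_inj) (inj_eq (@pos_inj X k)).
  by split=> //; rewrite -val_eqE /= (ltn_eqF ij).
- exists (cartan_pos X i), (cartan_pos X j); rewrite /cc !pw_pos pos_neq_rev (inj_eq (@pos_inj X k)).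
  by rewrite -val_eqE /= gtn_eqF.
case EX: X => // -[i ->].
  have kN : (k < natural_dim TypeB k)%N by rewrite /=; lia.
  exists (cartan_pos TypeB i), (Ordinal kN).
  have ne : (cartan_pos TypeB i == Ordinal kN) = false.
    by rewrite -val_eqE /=; have := ltn_ord i; lia.
  have ne' : (Ordinal kN == rev_ord (cartan_pos TypeB i)) = false.
    by rewrite -val_eqE /=; have := ltn_ord i; lia.
  by rewrite pw_pos (@pw_mid TypeB k (Ordinal kN))// subr0 /cc ne ne'; split.
exists (cartan_pos TypeC i), (rev_ord (cartan_pos TypeC i)).
rewrite /cc pos_neq_rev eqxx pw_rev pw_pos opprK scaler_nat mulr2n.
by split.
Qed.

Section WeylInvariance.
Variables (X : lie_type) (k : nat) (R : comNzRingType).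
Lemma winvariant_simple (f : galg 'rV[rat]_k R) :
  (forall a b, is_simple X a -> f (b *m reflection_mx a) = f b) -> winvariant X f.
Proof.
move=> H w b wW; have [s [hs _ wE]] := weyl_word wW.
rewrite /weyl_act wE {wE}; elim: s hs b => [|a s ih] hs b.
  by rewrite big_nil mulmx1.
rewrite big_cons mulmxA ih; last by move=> c cs; apply: hs; rewrite in_cons cs orbT.
by apply: H; apply: hs; rewrite mem_head.
Qed.
End WeylInvariance.

(** * Integrality of the pairings with simple coroots *)

Section IntegralWeights.
Variables (X : lie_type) (k : nat).
Implicit Types (l a : 'rV[rat]_k).

Definition wclass l : bool :=
  match X with
  | TypeC => [forall i, l 0 i \is a Num.int]
  | _ => [forall i, l 0 i \is a Num.int] || [forall i, l 0 i - 2^-1 \is a Num.int]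
  end.

Lemma wclassD l a : wclass l -> (forall i, a 0 i \is a Num.int) -> wclass (l + a).
Proof.
move=> wl ai.
have h1 : [forall i, l 0 i \is a Num.int] -> [forall i, (l + a) 0 i \is a Num.int].
  by move/forallP => h; apply/forallP => i; rewrite mxE rpredD.
have h2 : [forall i, l 0 i - 2^-1 \is a Num.int] -> [forall i, (l + a) 0 i - 2^-1 \is a Num.int].
  by move/forallP => h; apply/forallP => i; rewrite mxE addrAC rpredD.
move: wl; rewrite /wclass; case: (X) => [/orP[/h1->//|/h2->]|/h1//|/orP[/h1->//|/h2->]].
all: by rewrite orbT.
Qed.

Lemma wclass_simple l a : wclass l -> is_simple X a ->
  2 * dot l a / dot a a \is a Num.int.
Proof.
move=> wl [[i [j [ij ->]]]|].
  have nij : (i == j) = false by rewrite -val_eqE /= ij; lia.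
  have -> : dot (eps j - eps i) (eps j - eps i) = 2.
    by rewrite dotBl !dotBr !dot_epsl !eps_coef !eqxx nij eq_sym nij.
  rewrite mulrC mulKf// dotBr !dot_epsr.
  have H1 : [forall i, l 0 i \is a Num.int] -> l 0 j - l 0 i \is a Num.int.
    by move/forallP => h; rewrite rpredB.
  have H2 : [forall i, l 0 i - 2^-1 \is a Num.int] -> l 0 j - l 0 i \is a Num.int.
    move/forallP => h; rewrite (_ : l 0 j - l 0 i = (l 0 j - 2^-1) - (l 0 i - 2^-1)); last by ring.
    by rewrite rpredB.
  by move: wl; rewrite /wclass; case: (X) => [/orP[/H1|/H2]|/H1|/orP[/H1|/H2]].
have two (x : rat) : x - 2^-1 \is a Num.int -> 2 * x \is a Num.int.
  move=> h; rewrite (_ : 2 * x = 2 * (x - 2^-1) + 1); last by field.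
  by rewrite rpredD// rpredM// natr_int.
move: wl; rewrite /wclass; case: (X) => wl.
- move=> [i [_ ->]]; rewrite dot_eps2 dot_epsr divr1.
  move: wl => /orP[/forallP h|/forallP h]; last exact: two.
  by rewrite rpredM// natr_int.
- move=> [i [_ ->]]; rewrite dotZl !dotZr dot_eps2 dot_epsr.
  rewrite (_ : _ / _ = l 0 i); last by field.
  by move/forallP: wl.
move=> [i [j [i0 j1 ->]]].
have nij : (i == j) = false by rewrite -val_eqE /= i0 j1.
have -> : dot (eps j + eps i) (eps j + eps i) = 2.
  by rewrite dotDl !dotDr !dot_epsl !eps_coef !eqxx nij eq_sym nij.
rewrite mulrC mulKf// dotDr !dot_epsr; move: wl => /orP[/forallP h|/forallP h].
  by rewrite rpredD.
rewrite (_ : l 0 j + l 0 i = (l 0 j - 2^-1) + (l 0 i - 2^-1) + 1); last by field.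
by apply: rpredD; [apply: rpredD|apply: rpred1].
Qed.
End IntegralWeights.

Lemma sum_diag (I : finType) (A : nmodType) (i : I) (x : A) :
  \sum_j (if i == j then x else 0) = x.
Proof.
rewrite (bigD1 i)//= eqxx big1 ?addr0// => j /negPf h.
by rewrite eq_sym h.
Qed.

(** * Characters and traces of the Casimir element *)

Section Character.
Variables (C : numClosedFieldType) (X : lie_type) (k : nat).
Local Notation N := (natural_dim X k).
Implicit Types (M : lie_module C X k) (a b : 'I_N).

Definition character (R : comNzRingType) d (wt : 'I_d -> 'rV[rat]_k) : galg 'rV[rat]_k R :=
  \sum_c ge R (wt c).

Lemma gcoef_character (R : comNzRingType) d (wt : 'I_d -> 'rV[rat]_k) x :
  character R wt x = #|[pred c | (wt c == x)%R]|%:R.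
Proof.
rewrite gcoef_sum -sum1_card natr_sum big_mkcond [RHS]big_mkcond /=.
by apply: eq_bigr => c _; rewrite gcoef_ge unfold_in eq_sym /=; case: eqP.
Qed.

Section Weighted.
Variables (M : lie_module C X k) (wt : 'I_(mdim M) -> 'rV[rat]_k).
Hypothesis hw : has_weights wt.
Local Notation ch := (character C wt).

Lemma character_reflection (a x : 'rV[rat]_k) : is_simple X a -> (forall c, wclass X (wt c)) ->
  ch (x *m reflection_mx a) = ch x.
Proof.
move=> sa cl; have pa := is_simple_pos sa.
have aa0 : dot a a != 0 by rewrite gt_eqF// dot_gt0// (pos_root_neq0 pa).
pose m (y : 'rV[rat]_k) := 2 * dot y a / dot a a.
have refE y : y *m reflection_mx a = y - m y *: a by exact: mulmx_reflection.
have mr y : m (y - m y *: a) = - m y.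
  by rewrite /m dotBl dotZl; field.
have mD : {morph m : y z / y + z} by move=> y z; rewrite /m dotDl; field.
have ma : m a = 2 by rewrite /m; field.
have rr y : (y - m y *: a) - m (y - m y *: a) *: a = y.
  by rewrite mr scaleNr opprK subrK.
(* An inequality suffices because the reflection is an involution. *)
suff le y : ch y != 0 -> (#|[pred c | (wt c == y)%R]| <= #|[pred c | (wt c == y - m y *: a)%R]|)%N.
  rewrite refE; have [y0|y1] := eqVneq (ch x) 0.
    have [->//|x1] := eqVneq (ch (x - m x *: a)) 0.
    have := le _ x1; rewrite rr => h; move: x1 y0; rewrite !gcoef_character.
    move=> x1 /eqP; rewrite pnatr_eq0 => /eqP y0; move: h; rewrite y0 leqn0 => /eqP h.
    by rewrite h eqxx in x1.
  have h1 := le _ y1; have x1 : ch (x - m x *: a) != 0.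
    by move: y1; rewrite !gcoef_character !pnatr_eq0 -!lt0n => /leq_trans; apply.
  have := le _ x1; rewrite rr => h2; rewrite !gcoef_character.
  by congr _%:R; apply/eqP; rewrite eqn_leq h2 h1.
move=> y0; have [i [j [nij alE cij]]] := root_positions pa.
have my : m y \is a Num.int.
  have [c wc] : exists c, wt c = y.
    apply: contrapT => H; move/negP: y0; apply; rewrite gcoef_character.
    by rewrite pnatr_eq0; apply/eqP/eq_card0 => c; rewrite unfold_in /=; apply/negP => /eqP e; apply: H; exists c.
  by rewrite -wc; apply: wclass_simple.
(* The scalar normalises the bracket to the coroot: [mX_comm] gives [cc i j] times the pairing with
   [a], while [m] is 2 (., a) / (a, a). *)
pose E := mX M i j; pose F := ratr (2 / ((cc i j)%:R * dot a a)) *: mX M j i.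
have sE : shifts wt E a by move=> c e h; rewrite (weight_shift hw h) alE.
have sF : shifts wt F (- a).
  move=> c e; rewrite mxE mulf_eq0 negb_or => /andP[_ h].
  by rewrite (weight_shift hw h) -alE opprB.
have cc0 : (cc i j)%:R != 0 :> rat by rewrite pnatr_eq0.
have EF : F *m E - E *m F = diag_mx (\row_c ratr (m (wt c))).
  rewrite /E /F -scalemxAl -scalemxAr -scalerBr mX_comm !(mX_diag_weight hw).
  rewrite -linearB /= -[diag_mx _ *+ _]scaler_nat scalerA -linearZ /=.
  congr diag_mx; apply/rowP => c; rewrite !mxE -rmorphB /= -dotBr alE.
  have -> : (cc i j)%:R = ratr (cc i j)%:R :> C by rewrite ratr_nat.
  rewrite -!rmorphM /=; congr ratr.
  by rewrite /m; field; rewrite ?cc0 ?aa0.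
have EF' : E *m F - F *m E = diag_mx (\row_c ratr (- m (wt c))).
  rewrite -opprB EF; apply/matrixP => c e; rewrite !mxE -mulNrn -rmorphN //.
have /intrP[z mz] := my.
case: z mz => n mz.
  have := sl2_le mD ma sE sF EF (_ : m y = n%:R) => /(_ mz).
  by rewrite mz scaler_nat.
(* For a negative pairing the roles of E and F are exchanged, with -a and -m. *)
have mD' : {morph (fun v => - m v) : u v / u + v} by move=> u v; rewrite mD opprD.
have sF' : shifts wt E (- - a) by rewrite opprK.
have := sl2_le (m := fun v => - m v) (al := - a) mD' _ sF sF' EF' (kap := y) (j := n.+1).
rewrite -/(m (- a)) mz => /(_ _ _).
have -> : m (- a) = -2 by rewrite /m dotNl; field.
rewrite opprK => /(_ erefl); rewrite NegzE mulrNz opprK => /(_ erefl).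
by rewrite mulNrn opprK scaleNr opprK scaler_nat.
Qed.

Lemma character_winvariant : (forall c, wclass X (wt c)) -> winvariant X ch.
Proof. by move=> cl; apply: winvariant_simple => a b sa; apply: character_reflection. Qed.

(** The traces of [mX M a b *m mX M b a] on the weight spaces, gathered into one element. *)
Definition rootT a b : galg 'rV[rat]_k C :=
  \sum_c gC _ ((mX M a b *m mX M b a) c c) * ge C (wt c).

(** Cyclicity of the trace: translating by the root exchanges the two root vectors, and the
    difference is the trace of their bracket. *)
Lemma rootTE a b : (ge C (pw a - pw b) - 1) * rootT a b =
  gder (pw a - pw b) ch *+ cc a b.
Proof.
have E1 : ge C (pw a - pw b) * rootT a b =
    \sum_c gC _ ((mX M b a *m mX M a b) c c) * ge C (wt c).
  rewrite /rootT mulr_sumr.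
  under eq_bigr => c _ do rewrite mxE raddf_sum mulr_suml mulr_sumr.
  rewrite exchange_big /=; apply: eq_bigr => e _.
  rewrite mxE raddf_sum mulr_suml; apply: eq_bigr => c _ /=.
  have [->|x0] := eqVneq (mX M a b c e) 0; first by rewrite mulr0 mul0r raddf0 !mul0r mulr0.
  rewrite (weight_shift hw x0) [mX M a b c e * _]mulrC mulrCA -geD.
  by rewrite [wt c + _]addrC.
rewrite mulrBl mul1r E1 /rootT -sumrB /gder /character raddf_sum -sumrMnl.
apply: eq_bigr => c _ /=; rewrite -/(gder _ _) gder_ge -mulrBl -raddfB /= -mulrnAl.
rewrite -raddfMn /=; congr (gC _ _ * _).
have := congr1 (fun m : 'M_(mdim M) => m c c) (mX_comm M a b).
rewrite !(mX_diag_weight hw) -linearB /= -[diag_mx _ *+ _]scaler_nat.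
rewrite [X in X = _]mxE [X in _ + X = _]mxE => ->.
by rewrite !mxE eqxx dotBr rmorphB /= mulr1n mulr_natl.
Qed.

Lemma rootT0 a b : a != b -> cc a b = 0%N -> rootT a b = 0.
Proof.
move=> nab c0; apply: big1 => c _; rewrite /mX lieX0// linear0 mul0mx mxE raddf0.
exact: mul0r.
Qed.

(** The trace of the Casimir element on each weight space. The diagonal pairs contribute the sum of
    (x, pw a)^2 over the positions, which is 2 (x, x). *)
Lemma casimir_trace (t : C) : casimir M = t%:M ->
  glap ch *+ 2 + \sum_(p : 'I_N * 'I_N) (if p.1 == p.2 then 0 else rootT p.1 p.2) =
  gC _ t * ch.
Proof.
move=> cas.
have E : gC _ t * ch = \sum_(p : 'I_N * 'I_N) rootT p.1 p.2.
  rewrite /rootT exchange_big mulr_sumr /=; apply: eq_bigr => c _.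
  rewrite -mulr_suml -raddf_sum /=; congr (gC _ _ * _).
  have := congr1 (fun m : 'M_(mdim M) => m c c) cas.
  rewrite /casimir !summxE [RHS]mxE eqxx mulr1n => <-.
  rewrite -(pair_bigA _ (fun a b => (mX M a b *m mX M b a) c c)) /=.
  by apply: eq_bigr => a _; rewrite summxE.
rewrite E.
have -> : \sum_(p : 'I_N * 'I_N) rootT p.1 p.2 =
    \sum_(p : 'I_N * 'I_N) (if p.1 == p.2 then rootT p.1 p.1 else 0) +
    \sum_(p : 'I_N * 'I_N) (if p.1 == p.2 then 0 else rootT p.1 p.2).
  rewrite -big_split /=; apply: eq_bigr => p _.
  by case: (p.1 =P p.2) => [<-|_]; rewrite ?addr0 ?add0r.
congr (_ + _); rewrite -(pair_bigA _ (fun a b => if a == b then rootT a a else 0)) /=.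
rewrite [RHS](eq_bigr _ (fun a _ => sum_diag a _)).
rewrite /rootT exchange_big /glap /character raddf_sum -sumrMnl; apply: eq_bigr => c _ /=.
rewrite gweight_ge gmonomE -mulr_suml -raddf_sum /= -mulrnAl -raddfMn /=; congr (gC _ _ * _).
under [RHS]eq_bigr => a _ do rewrite !(mX_diag_weight hw) mul_diag_mx !mxE eqxx !mulr1n.
rewrite (pw_sum X (fun v => ratr (dot (wt c) v) * ratr (dot (wt c) v) : C)).
rewrite dot0r rmorph0 mul0r.
have -> : (if X is TypeB then 0 else 0) = 0 :> C by case: (X).
rewrite addr0 /dot rmorph_sum -sumrMnl; apply: eq_bigr => i _ /=.
by rewrite -/(dot _ _) -/(dot _ _) dotNr !dot_epsr rmorphN /= mulrNN rmorphM /= mulr2n.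
Qed.

(** The eigenspace is a submodule, so the highest weight vector determines the scalar. On it, a
    product survives only through its bracket or on the diagonal, for a total of 2 (l, l) + 4 (l,
    rho). *)
Lemma casimir_scalar l c0 : irreducible_module M -> hwv (M := M) l (delta_mx 0 c0) ->
  casimir M = (ratr (2 * (dot (l + rho X k) (l + rho X k) - dot (rho X k) (rho X k))))%:M.
Proof.
move=> [_ irr] [v0 vn vH]; set v := delta_mx 0 c0 in v0 vn vH.
set t := ratr _.
have vdiag a : v *m mX M a a = ratr (dot l (pw a)) *: v.
  rewrite mX_diag mulmx_sumr /dot rmorph_sum scaler_suml; apply: eq_bigr => i _ /=.
  by rewrite -scalemxAr vH scalerA rmorphM /= mulrC.
pose G (y : 'rV[rat]_k) := if y \in pos_roots X k then y else 0.
have term a b : v *m (mX M a b *m mX M b a) =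
    ratr (dot l (G (pw b - pw a) *+ cc b a) + (if a == b then dot l (pw a) ^+ 2 else 0)) *: v.
  case: (ltngtP a b) => [ab|ba|/val_inj <-].
  - rewrite mulmxA vn// mul0mx; have -> : (a == b) = false by rewrite -val_eqE /= ltn_eqF.
    suff -> : G (pw b - pw a) *+ cc b a = 0 by rewrite dot0r addr0 rmorph0 scale0r.
    have [->|cab] := eqVneq (cc b a) 0%N; first by rewrite mulr0n.
    rewrite ccC in cab; have r1 := pw_root_lt ab cab; rewrite /G; case: ifP => [r2|_]; last by rewrite mul0rn.
    exfalso; have := root_height_ge1 r1; have := root_height_ge1 r2.
    by rewrite !raddfB /=; lra.
  - have -> : (a == b) = false by rewrite -val_eqE /= gtn_eqF.
    have -> : mX M a b *m mX M b a = mX M b a *m mX M a b + (mX M b b - mX M a a) *+ cc b a.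
      by rewrite -mX_comm addrC subrK.
    rewrite mulmxDr mulmxA vn// mul0mx add0r addr0 -scaler_nat -scalemxAr mulmxBr !vdiag.
    have [->|cab] := eqVneq (cc b a) 0%N; first by rewrite mulr0n dot0r rmorph0 !scale0r.
    rewrite /G (pw_root_lt ba cab) -[(pw b - pw a) *+ _]scaler_nat dotZr rmorphM /= ratr_nat.
    by rewrite -scalerBl scalerA -rmorphB /= -dotBr.
  - rewrite eqxx mulmxA vdiag -scalemxAl vdiag scalerA /cc eqxx mulr0n dot0r add0r.
    by rewrite rmorphXn /= expr2.
have vcas : v *m casimir M = t *: v.
  rewrite /casimir mulmx_sumr.
  under eq_bigr => a _.
    rewrite mulmx_sumr; under eq_bigr => b _ do rewrite term.
    rewrite -scaler_suml -rmorph_sum /=.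
    over.
  rewrite -scaler_suml -rmorph_sum /=; congr (ratr _ *: _).
  under eq_bigr => a _ do rewrite big_split /= sum_diag.
  rewrite big_split /=.
  have -> : \sum_(a < N) dot l (pw a) ^+ 2 = 2 * dot l l.
    rewrite (pw_sum X (fun y => dot l y ^+ 2)) dot0r expr0n /=.
    have -> : (if X is TypeB then 0 else 0) = 0 :> rat by case: (X).
    rewrite addr0 [in RHS]/dot mulr_sumr; apply: eq_bigr => i _.
    by rewrite dotNr dot_epsr sqrrN; ring.
  rewrite exchange_big /= pair_big /=.
  rewrite -(dot_sumr (index_enum _) xpredT (fun p : 'I_N * 'I_N => G (pw p.1 - pw p.2) *+ cc p.1 p.2)).
  have G0 : G 0 = 0 by rewrite /G; case: ifP.
  rewrite sum_roots_pairs//.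
  have -> : \sum_(a <- pos_roots X k) (G a + G (- a)) = rho X k *+ 2.
    rewrite -rho_half_sum big_seq [RHS]big_seq; apply: eq_bigr => a ha.
    rewrite /G ha; case: ifP => [r2|_]; last by rewrite addr0.
    exfalso; have := root_height_ge1 ha; have := root_height_ge1 r2.
    by rewrite raddfN /=; lra.
  rewrite -mulrnA -scaler_nat dotZr !dotDl !dotDr (dotC (rho X k) l); ring.
have full : row_full (eigenspace (casimir M) t).
  apply: irr.
    move=> A gA; apply: comm_mx_stable_eigenspace; exact: casimir_comm.
  apply: contraNneq v0 => e0; rewrite -submx0 -e0; apply/eigenspaceP; exact: vcas.
have : (1%:M <= eigenspace (casimir M) t)%MS by rewrite sub1mx.
move/eigenspaceP.
by rewrite mul1mx scalemx1.
Qed.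
End Weighted.

Theorem weyl_character M l : irreducible_module M -> has_highest_weight M l ->
  wclass X l ->
  exists M' (wt : 'I_(mdim M') -> 'rV[rat]_k),
    [/\ module_iso M' M, has_weights wt, forall c, qcone X (l - wt c), wdom X l &
        [/\ nabla X k C * character C wt = alt X C (l + rho X k),
         winvariant X (character C wt) &
         exists c0, forall c, (wt c == l) = (c == c0)]].
Proof.
move=> irr hl cl; have [M' [wt [iso hw qc [c0 c0E]]]] := hw_basis irr hl.
exists M', wt.
have irr' : irreducible_module M' by apply: module_iso_irr irr; apply: module_iso_sym.
have wcl c : wclass X (wt c).
  have -> : wt c = l + - (l - wt c) by rewrite opprB addrC subrK.
  by apply: wclassD => // i; rewrite mxE rpredN; apply: qcone_int (qc c).
have winv := character_winvariant hw wcl.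
have wc0 : wt c0 = l by apply/eqP; rewrite c0E.
have bch : below X l (character C wt).
  move=> x; rewrite gcoef_character pnatr_eq0 -lt0n => /card_gt0P[c].
  by rewrite unfold_in => /eqP <-.
have chl : character C wt l = 1.
  rewrite gcoef_character; have -> : #|[pred c | (wt c == l)%R]| = 1%N; last by [].
  by rewrite -[RHS](card1 c0); apply: eq_card => c; rewrite !unfold_in /= c0E.
have wl : wdom X l.
  (* By invariance the reflection of [l] is again a weight; a negative pairing would place it
     strictly above [l]. *)
  move=> a sa; rewrite leNgt; apply/negP => lt0.
  have : character C wt (l *m reflection_mx a) != 0.
    by rewrite (character_reflection hw)// chl oner_eq0.
  move/bch; rewrite mulmx_reflection opprB addrC subrK.
  have pa := is_simple_pos sa; have a0 := pos_root_neq0 pa.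
  have d0 := dot_gt0 a0; set z := _ / _.
  have z0 : z < 0 by rewrite /z pmulr_llt0 ?invr_gt0// pmulr_rlt0.
  move=> q; have := qcone_height q; rewrite scaler_eq0 (negPf a0) lt_eqF//= => /(_ isT).
  rewrite root_height_dot dotZl -root_height_dot ltNge => /negP; apply.
  by rewrite mulr_le0_ge0 ?(ltW z0)// (le_trans _ (root_height_ge1 pa)).
split=> //; split=> //; last by exists c0.
have hc0 := top_hwv hw qc wc0.
have cas := casimir_scalar irr' hc0; have tr := casimir_trace hw cas.
have [bn n1] := nabla_below X k C.
have [bD D1] := belowM bn bch.
rewrite addrC; apply: antisym_sphere bD _ _ _.
- by apply: antisymM winv; apply: nabla_antisym.
- by rewrite D1 n1 chl mulr1.
- by rewrite addrC; apply: wdom_sdomD => //; apply: sdom_rho.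
have lapE : glap (nabla X k C * character C wt) =
   gC _ (ratr (dot (l + rho X k) (l + rho X k))) * (nabla X k C * character C wt).
  pose t : C := ratr (dot (l + rho X k) (l + rho X k) - dot (rho X k) (rho X k)).
  have -> : ratr (dot (l + rho X k) (l + rho X k)) = t + ratr (dot (rho X k) (rho X k)) :> C.
    by rewrite /t rmorphB /= subrK.
  refine (@nabla_casimir X k C _ (fun p : 'I_N * 'I_N => pw p.1 - pw p.2)
    (fun p => cc p.1 p.2) (fun p => if p.1 == p.2 then 0 else rootT wt p.1 p.2) _ _ _ _ _ _ _).
  - by move=> p; apply: pw_root.
  - by move=> p p0; case: eqP => // /eqP ne; apply: rootT0.
  - move=> p; case: eqP => [e|_]; last exact: rootTE.
    by rewrite mulr0 /cc e eqxx mulr0n.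
  - exact: sum_roots_pairs.
  rewrite tr -mulrnAl -raddfMn /=; congr (gC _ _ * _).
  by rewrite /t rmorphM /= ratr_nat mulr_natl.
move=> x Dx; have := congr1 (fun f : galg _ _ => f x) lapE.
rewrite gcoef_weight gcoef_CM => /(mulIf Dx)/(fmorph_inj (@ratr C)) ->.
by rewrite addrC.
Qed.
End Character.

(** * Uniqueness of irreducible modules *)

Section IsoUniqueness.
Variables (C : numClosedFieldType) (X : lie_type) (k : nat).
Local Notation N := (natural_dim X k).
Local Notation g := (@lie_alg C X k).
Implicit Types (M S L : lie_module C X k) (a b : 'I_N).

Lemma schur_free S L (f : 'M[C]_(mdim S, mdim L)) : irreducible_module S ->
  intertwines f -> f != 0 -> row_free f.
Proof.
move=> [_ irr] fi f0; rewrite -kermx_eq0; apply: contraTT f0 => k0; rewrite negbK.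
have : row_full (kermx f).
  apply: irr k0 => A gA; apply/sub_kermxP.
  by rewrite -mulmxA fi// mulmxA mulmx_ker mul0mx.
by rewrite -sub1mx => /sub_kermxP; rewrite mul1mx => ->.
Qed.

Lemma mX_dsum S L a b : mX (dsum_module S L) a b = block_mx (mX S a b) 0 0 (mX L a b).
Proof. by []. Qed.
Lemma mH_dsum S L i : mH (dsum_module S L) i = block_mx (mH S i) 0 0 (mH L i).
Proof. by []. Qed.

(* The submodule of the direct sum generated by the sum of the two highest weight
   vectors is the graph of an isomorphism: the linear form [phi] shows that it
   does not contain the highest weight vector of [L]. *)
Lemma hw_iso_weights S L l (wS : 'I_(mdim S) -> 'rV[rat]_k) (wL : 'I_(mdim L) -> 'rV[rat]_k)
    (a0 : 'I_(mdim S)) (b0 : 'I_(mdim L)) : irreducible_module S -> irreducible_module L ->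
  has_weights wS -> has_weights wL ->
  (forall c, qcone X (l - wS c)) -> (forall c, qcone X (l - wL c)) ->
  wS a0 = l -> wL b0 = l -> module_iso S L.
Proof.
move=> irS irL hS hL qS qL wa wb.
have [vS0 vSn vSH] := top_hwv hS qS wa; have [vL0 vLn vLH] := top_hwv hL qL wb.
pose T := dsum_module S L.
pose v : 'rV[C]_(mdim T) := row_mx (delta_mx 0 a0) (delta_mx 0 b0).
have hv : hwv (M := T) l v.
  split.
  - by apply: contraNneq vS0 => /eqP; rewrite row_mx_eq0 => /andP[].
  - move=> a b ab; rewrite mX_dsum mul_row_block !mulmx0 addr0 add0r vSn// vLn//.
    exact: row_mx0.
  - by move=> i; rewrite mH_dsum mul_row_block !mulmx0 addr0 add0r vSH vLH scale_row_mx.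
pose phi : 'M[C]_(mdim T, 1) := col_mx (delta_mx a0 0) (- delta_mx b0 0).
have nU : nstable (M := T) (kermx phi).
  move=> a b ba; apply/sub_kermxP; rewrite -mulmxA mX_dsum /phi.
  rewrite [block_mx _ _ _ _ *m _]mul_block_col !mul0mx addr0 add0r mulmxN.
  have -> : mX S a b *m (delta_mx a0 0 : 'cV[C]_(mdim S)) = 0 :> 'cV[C]_(mdim S).
    apply/matrixP => c j; rewrite mxE [RHS]mxE big1// => d _; rewrite [delta_mx _ _ _ _]mxE.
    by case: (d =P a0) => [->|_]; rewrite ?mulr0// (weight_lower c hS qS wa ba) mul0r.
  have -> : mX L a b *m (delta_mx b0 0 : 'cV[C]_(mdim L)) = 0 :> 'cV[C]_(mdim L).
    apply/matrixP => c j; rewrite mxE [RHS]mxE big1// => d _; rewrite [delta_mx _ _ _ _]mxE.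
    by case: (d =P b0) => [->|_]; rewrite ?mulr0// (weight_lower c hL qL wb ba) mul0r.
  by rewrite oppr0 col_mx0 mulmx0.
have vU : (v <= kermx phi)%MS.
  apply/sub_kermxP; rewrite /phi [_ *m _]mul_row_col mulmxN !mul_delta_mx subrr //.
have [U0 [vU0 U0U gU0]] := hwv_submodule hv vU nU.
pose u := row_base U0; pose u1 : 'M_(_, mdim S) := lsubmx u; pose u2 : 'M_(_, mdim L) := rsubmx u.
have uE : u = row_mx u1 u2 by rewrite hsubmxK.
have vu : (v <= u)%MS by rewrite eq_row_base.
have sub_u m (y : 'M_(m, mdim T)) : (y <= u)%MS -> y *m phi = 0.
  by rewrite eq_row_base => h; apply/sub_kermxP/(submx_trans h).
have st A : A \in g -> exists D, u1 *m mact S A = D *m u1 /\ u2 *m mact L A = D *m u2.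
  move=> gA; have h : (u *m mact T A <= u)%MS.
    by rewrite (eqmxMr _ (eq_row_base U0)) eq_row_base; apply: (gstableP _).1.
  have /submxP[D] := h; rewrite uE /= /dsum_act.
  rewrite [_ *m block_mx _ _ _ _]mul_row_block !mulmx0 addr0 add0r.
  by rewrite mul_mx_row => /eq_row_mx[]; exists D.
have [x vx] := submxP vu.
have [v1 v2] : delta_mx 0 a0 = x *m u1 /\ delta_mx 0 b0 = x *m u2.
  by move: vx; rewrite uE mul_mx_row => /eq_row_mx.
have full1 : row_full u1.
  have e : (<<u1>> :=: u1)%MS by exact: genmxE.
  rewrite -sub1mx -e sub1mx; have [_ irr] := irS; apply: irr.
    move=> A gA; rewrite (eqmxMr _ e) e; have [D [-> _]] := st A gA; exact: submxMl.
  apply: contraNneq vS0 => z; rewrite -submx0 v1 -z e; exact: submxMl.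
have full2 : row_full u2.
  have e : (<<u2>> :=: u2)%MS by exact: genmxE.
  rewrite -sub1mx -e sub1mx; have [_ irr] := irL; apply: irr.
    move=> A gA; rewrite (eqmxMr _ e) e; have [D [_ ->]] := st A gA; exact: submxMl.
  apply: contraNneq vL0 => z; rewrite -submx0 v2 -z e; exact: submxMl.
(* The kernel of [u1] yields a submodule [K] of [L]. If it were nonzero it would contain the highest
   weight vector of [L], on which [phi] takes the value -1. *)
have free1 : row_free u1.
  pose K := kermx u1 *m u2.
  have sK A : A \in g -> (K *m mact L A <= K)%MS.
    move=> gA; have [D [D1 D2]] := st A gA.
    have /submxP[D' D'E] : (kermx u1 *m D <= kermx u1)%MS.
      by apply/sub_kermxP; rewrite -mulmxA -D1 mulmxA mulmx_ker mul0mx.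
    by rewrite /K -mulmxA D2 mulmxA D'E -mulmxA submxMl.
  have kE : kermx u1 *m u = row_mx 0 K by rewrite uE mul_mx_row mulmx_ker.
  have K0 : K = 0.
    apply: contrapT => /eqP K0; have e : (<<K>> :=: K)%MS by exact: genmxE.
    have : row_full (<<K>>)%MS.
      have [_ irr] := irL; apply: irr.
        by move=> A gA; rewrite (eqmxMr _ e) e sK.
      by apply: contraNneq K0 => z; rewrite -submx0 -e z.
    move=> fK; have : ((delta_mx 0 b0 : 'rV[C]_(mdim L)) <= K)%MS.
      by apply: (submx_trans (submx_full _ fK)); rewrite genmxE.
    move=> /submxP[y yE].
    have : (y *m (kermx u1 *m u)) *m phi = 0.
      by apply: sub_u; rewrite mulmxA; apply: submxMl.
    rewrite kE mul_mx_row mulmx0 -yE /phi [_ *m _]mul_row_col mul0mx add0r.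
    rewrite mulmxN mul_delta_mx => /matrixP/(_ 0 0)/eqP; rewrite !mxE !eqxx oppr_eq0 oner_eq0 //.
  rewrite -kermx_eq0; apply/eqP; apply: (row_free_inj (row_base_free U0)).
  by rewrite -/u kE K0 row_mx0 mul0mx.
pose f := pinvmx u1 *m u2.
have fi : intertwines f.
  move=> A gA; have [D [D1 D2]] := st A gA; rewrite /f mulmxA.
  by rewrite (pinvmx_intertwine free1 full1 (esym D1)) -!mulmxA D2.
have u1f : u1 *m f = u2 by rewrite /f mulmxA mulmxVp// mul1mx.
exists f; split=> //; last first.
  rewrite -sub1mx; apply: submx_trans (submxMl u1 f); rewrite u1f sub1mx //.
apply: schur_free irS fi _; apply: contraNneq vL0 => f0.
by rewrite v2 -u1f mulmxA f0 mulmx0.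
Qed.

Lemma hw_iso S L l : irreducible_module S -> irreducible_module L ->
  has_highest_weight S l -> has_highest_weight L l -> module_iso S L.
Proof.
move=> irS irL hS hL.
have [S' [wS [isoS hwS qS [a0 a0E]]]] := hw_basis irS hS.
have [L' [wL [isoL hwL qL [b0 b0E]]]] := hw_basis irL hL.
apply: (module_iso_trans (module_iso_sym isoS)); apply: (fun h => module_iso_trans h isoL).
apply: (hw_iso_weights _ _ hwS hwL qS qL (a0 := a0) (b0 := b0)).
- exact: module_iso_irr (module_iso_sym isoS) irS.
- exact: module_iso_irr (module_iso_sym isoL) irL.
- by apply/eqP; rewrite a0E.
- by apply/eqP; rewrite b0E.
Qed.

(** Each highest weight is a weight, hence lies below the other one, and the order is
    antisymmetric. *)
Lemma hw_unique M l l' : irreducible_module M ->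
  has_highest_weight M l -> has_highest_weight M l' -> l = l'.
Proof.
have le m m' : irreducible_module M -> has_highest_weight M m ->
    has_highest_weight M m' -> qcone X (m - m').
  move=> irM hm hm'; have [M' [wt [iso hw qc _]]] := hw_basis irM hm.
  have /hwvP[v [v0 _ vH]] := module_iso_hwv (module_iso_sym iso) hm'.
  have /rV0Pn[c vc] := v0.
  suff <- : wt c = m' by [].
  apply/rowP => i; have /rowP/(_ c) := vH i; rewrite hw mul_mx_diag !mxE mulrC.
  by move/(mulIf vc)/(fmorph_inj (@ratr C)).
move=> irM hl hl'; apply/eqP; rewrite -subr_eq0; apply/eqP.
by apply: qcone_antisym (le _ _ irM hl hl') _; rewrite opprB; apply: le.
Qed.
End IsoUniqueness.

(** * Characters of direct sums *)

Section Sums.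
Variables (C : numClosedFieldType) (X : lie_type) (k : nat).
Local Notation N := (natural_dim X k).
Local Notation g := (@lie_alg C X k).
Implicit Types (M S T L : lie_module C X k).

(** The multiplicity of a weight is the trace of the projector onto its weight space, and an
    isomorphism intertwines these projectors. *)
Lemma iso_character M S (wM : 'I_(mdim M) -> 'rV[rat]_k) (wS : 'I_(mdim S) -> 'rV[rat]_k)
    (R : comNzRingType) :
  has_weights wM -> has_weights wS -> module_iso M S ->
  character R wM = character R wS.
Proof.
move=> hM hS [f [ff fF fi]]; apply: galgP => x; rewrite !gcoef_character; congr _%:R.
pose P n (w : 'I_n -> 'rV[rat]_k) : 'M[C]_n := diag_mx (\row_c (w c == x)%:R).
have trP n (w : 'I_n -> 'rV[rat]_k) : \tr (P n w) = #|[pred c | (w c == x)%R]|%:R.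
  rewrite mxtrace_diag -sum1_card natr_sum [RHS]big_mkcond /=.
  by apply: eq_bigr => c _; rewrite mxE unfold_in /=; case: eqP.
have Pf : P _ wM *m f = f *m P _ wS.
  apply/matrixP => c d; rewrite mul_mx_diag mul_diag_mx !mxE.
  have [->|fcd] := eqVneq (f c d) 0; first by rewrite mulr0 mul0r.
  suff -> : wM c = wS d by rewrite mulrC.
  apply/rowP => i; have := fi _ (lieX_in C (cartan_pos X i) (cartan_pos X i)).
  rewrite -/(lieH C X i) -/(mH M i) -/(mH S i) hM hS => /matrixP/(_ c d).
  rewrite mul_mx_diag mul_diag_mx !mxE mulrC => /(mulfI fcd).
  exact: (fmorph_inj (@ratr C)).
apply/eqP; rewrite -(eqr_nat C) -!trP; apply/eqP.
rewrite -[P _ wM]mulmx1 -(mulmxVp ff) mulmxA Pf -mulmxA mxtrace_mulC.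
by rewrite -mulmxA mulVpmx// mulmx1.
Qed.

Definition dsum_weights m n (wM : 'I_m -> 'rV[rat]_k) (wS : 'I_n -> 'rV[rat]_k)
  (c : 'I_(m + n)) : 'rV[rat]_k :=
  match fintype.split c with inl a => wM a | inr b => wS b end.

Lemma dsum_has_weights M S (wM : 'I_(mdim M) -> 'rV[rat]_k)
    (wS : 'I_(mdim S) -> 'rV[rat]_k) :
  has_weights wM -> has_weights wS ->
  has_weights (M := dsum_module M S) (dsum_weights wM wS).
Proof.
move=> hM hS i; rewrite mH_dsum hM hS.
rewrite (_ : \row_c _ = row_mx (\row_c ratr (wM c 0 i)) (\row_c ratr (wS c 0 i))).
  by rewrite diag_mx_row.
apply/rowP => c; rewrite !mxE /dsum_weights.
by case: fintype.splitP => e _; rewrite !mxE.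
Qed.

Lemma dsum_character m n (wM : 'I_m -> 'rV[rat]_k) (wS : 'I_n -> 'rV[rat]_k)
    (R : comNzRingType) :
  character R (dsum_weights wM wS) = character R wM + character R wS.
Proof.
rewrite /character big_split_ord /=; congr (_ + _); apply: eq_bigr => c _.
  by rewrite /dsum_weights (fintype.unsplitK (inl c)).
by rewrite /dsum_weights (fintype.unsplitK (inr c)).
Qed.

Lemma dsum_iso M M' S S' : module_iso M M' -> module_iso S S' ->
  module_iso (dsum_module M S) (dsum_module M' S').
Proof.
move=> [f [ff fF fi]] [h [hf hF hi]].
exists (block_mx f 0 0 h); split.
- apply/row_freeP; exists (block_mx (pinvmx f) 0 0 (pinvmx h)).
  by rewrite [_ *m _]mulmx_block !mulmx0 !mul0mx !addr0 !add0r !mulmxVp// -scalar_mx_block.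
- apply/row_fullP; exists (block_mx (pinvmx f) 0 0 (pinvmx h)).
  by rewrite [_ *m _]mulmx_block !mulmx0 !mul0mx !addr0 !add0r !mulVpmx// -scalar_mx_block.
move=> A gA; rewrite /= /dsum_act [LHS]mulmx_block [RHS]mulmx_block.
by rewrite !mulmx0 !mul0mx !addr0 !add0r fi// hi.
Qed.

Lemma dsum_proj1 M S : intertwines (M := dsum_module M S) (S := M) (col_mx 1%:M 0) /\
  row_full (col_mx 1%:M 0 : 'M[C]_(mdim (dsum_module M S), mdim M)).
Proof.
split=> [A gA|]; last by apply/row_fullP; exists (row_mx 1%:M 0); rewrite [_ *m _]mul_row_col mulmx0 addr0 mul1mx.
by rewrite /= /dsum_act [LHS]mul_block_col mul_col_mx !mulmx0 !mul0mx mulmx1 mul1mx !addr0.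
Qed.
Lemma dsum_proj2 M S : intertwines (M := dsum_module M S) (S := S) (col_mx 0 1%:M) /\
  row_full (col_mx 0 1%:M : 'M[C]_(mdim (dsum_module M S), mdim S)).
Proof.
split=> [A gA|]; last by apply/row_fullP; exists (row_mx 0 1%:M); rewrite [_ *m _]mul_row_col mul0mx add0r mul1mx.
by rewrite /= /dsum_act [LHS]mul_block_col mul_col_mx !mulmx0 !mul0mx mulmx1 mul1mx !add0r.
Qed.

Lemma iso_summand M T S (wt : 'I_(mdim M) -> 'rV[rat]_k) (p : 'M[C]_(mdim T, mdim S)) :
  has_weights wt -> module_iso M T -> intertwines p -> row_full p ->
  exists S' (wt' : 'I_(mdim S') -> 'rV[rat]_k),
    [/\ module_iso S' S, has_weights wt' & forall c, exists d, wt' c = wt d].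
Proof.
move=> hw [f [ff fF fi]] ip fp; apply: (quotient_weights (p := f *m p)) => //.
  have [q qf] := row_fullP fF; have [q' q'p] := row_fullP fp.
  by apply/row_fullP; exists (q' *m q); rewrite mulmxA -(mulmxA q') qf mulmx1.
by move=> A gA; rewrite mulmxA fi// -!mulmxA ip.
Qed.

End Sums.

(** * Tensor products *)

Section Dominant.
Variables (X : lie_type) (k : nat).

Lemma dominantE (l : 'rV[rat]_k) : dominant X l <-> wclass X l /\ wdom X l.
Proof.
rewrite /dominant -/(wclass X l); split.
  case/and3P=> -> /forallP mono pos; split=> //.
  have mn (i j : 'I_k) : (i < j)%N -> l 0 i <= l 0 j.
    by move=> ij; move/forallP/(_ j)/implyP: (mono i); apply; apply: ltnW.
  move=> a [[i [j [ij ->]]]|].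
    by rewrite dotBr !dot_epsr subr_ge0 mn ?ij.
  move: pos; case: (X) => [/forallP pos [i [_ ->]]|/forallP pos [i [_ ->]]|].
  - by rewrite dot_epsr.
  - by rewrite dotC dotZl dotC dot_epsr mulr_ge0.
  move=> /forallP pos [i [j [i0 j1 ->]]]; rewrite dotDr !dot_epsr.
  have /forallP/(_ j)/implyP := pos i; rewrite i0 j1 => /(_ isT).
  by rewrite ler_norml => /andP[h _]; rewrite -[l 0 i]opprK subr_ge0 lerNl.
move=> [-> wl] /=; have pr a := wdom_pos_root (a := a) wl.
have mn (i j : 'I_k) : (i <= j)%N -> l 0 i <= l 0 j.
  rewrite leq_eqVlt => /orP[/eqP/val_inj->//|ij].
  have := pr (eps j - eps i); rewrite dotBr !dot_epsr subr_ge0; apply.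
  by apply/pos_rootsP; left; exists j, i; split=> //; right.
apply/andP; split; first by apply/forallP => i; apply/forallP => j; apply/implyP/mn.
move: pr; case: (X) => pr.
- apply/forallP => i; have := pr (eps i); rewrite dot_epsr; apply.
  by apply/pos_rootsP; right; exists i.
- apply/forallP => i; have := pr (2 *: eps i).
  rewrite dotC dotZl dotC dot_epsr pmulr_rge0//; apply.
  by apply/pos_rootsP; right; exists i.
apply/forallP => i; apply/forallP => j; apply/implyP => /andP[/eqP i0 j0].
have ij : (i < j)%N by rewrite i0.
have := pr (eps j + eps i); rewrite dotDr !dot_epsr => h.
have h0 : 0 <= l 0 j + l 0 i.
  by apply: h; apply/pos_rootsP; left; exists j, i; split=> //; left.
by rewrite ler_norml mn ?(ltnW ij)// andbT -subr_ge0 opprK addrC.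
Qed.

Lemma dominant_sdom (l : 'rV[rat]_k) : dominant X l -> sdom X (l + rho X k).
Proof. by move=> /dominantE[_ wl]; apply: wdom_sdomD wl (@sdom_rho X k). Qed.
End Dominant.

(** * Change of coefficients *)

Section BaseChange.
Variables (k : nat) (S : comNzRingType).
Local Notation G := ('rV[rat]_k).

(** Carries identities of characters, proved over the field, back to the integers by [gint_inj] and
    from there to [{poly int}]. *)
Definition gint : galg G int -> galg G S := geval ((@gC G S) \o (intr : int -> S)) (ge S).
HB.instance Definition _ := GRing.Additive.on gint.

Lemma gintM : {morph gint : f h / f * h}.
Proof. by apply: gevalM => x y; rewrite geD. Qed.
Lemma gint_ge x : gint (ge int x) = ge S x.
Proof. exact: geval_ge. Qed.

Lemma gcoef_gint f x : gint f x = (f x)%:~R.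
Proof.
rewrite {1}(gsum_monom f) raddf_sum gcoef_sum.
rewrite [in RHS](gsum_monom f) gcoef_sum rmorph_sum; apply: eq_bigr => y _.
rewrite /= [gint _]geval_monom /= -gmonomE !gcoef_monom.
by case: (x == y); rewrite ?mulr1 ?mulr0 //= ?rmorph0.
Qed.

Lemma gint_alt X b : gint (alt X int b) = alt X S b.
Proof.
rewrite /alt raddf_sum; apply: eq_bigr => w _.
by rewrite !mulr_sign; case: (wodd w); rewrite ?raddfN /= gint_ge.
Qed.

Lemma gint_character d (wt : 'I_d -> G) : gint (character int wt) = character S wt.
Proof. by rewrite /character raddf_sum; apply: eq_bigr => c _; exact: gint_ge. Qed.
End BaseChange.

Lemma gint_inj k (S : numDomainType) : injective (@gint k S).
Proof.
move=> f h e; apply: galgP => x; have := gcoef_gint S f x.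
by rewrite e gcoef_gint => /eqP; rewrite eqr_int => /eqP.
Qed.

Section TensorWeights.
Variables (C : numClosedFieldType) (X : lie_type) (k : nat).
Implicit Types (M S T L : lie_module C X k).

Definition tensor_weights m n (wM : 'I_m -> 'rV[rat]_k) (wS : 'I_n -> 'rV[rat]_k)
  (c : 'I_(m * n)) : 'rV[rat]_k :=
  wM (mxtens_unindex c).1 + wS (mxtens_unindex c).2.

Lemma tensor_has_weights M S (wM : 'I_(mdim M) -> 'rV[rat]_k)
    (wS : 'I_(mdim S) -> 'rV[rat]_k) :
  has_weights wM -> has_weights wS ->
  has_weights (M := tensor_module M S) (tensor_weights wM wS).
Proof.
move=> hM hS i; rewrite /mH /= /tensor_act -/(mH M i) -/(mH S i) hM hS.
apply/matrixP => c d; case: (mxtens_indexP c) => a b; case: (mxtens_indexP d) => a' b'.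
rewrite [LHS]mxE !tensmxE !mxE /tensor_weights !mxtens_indexK /=.
rewrite (can_eq (@mxtens_indexK _ _)) rmorphD /= xpair_eqE.
by case: (a == a'); case: (b == b') => /=; rewrite ?mulr1 ?mulr0 ?mul0r ?mul1r ?mulr0n ?addr0.
Qed.

Lemma tensor_character m n (wM : 'I_m -> 'rV[rat]_k) (wS : 'I_n -> 'rV[rat]_k)
    (R : comNzRingType) :
  character R (tensor_weights wM wS) = character R wM * character R wS.
Proof.
rewrite /character big_distrlr /= pair_big /=.
rewrite (reindex (fun ab => @mxtens_index m n ab)) /=; last first.
  by exists (@mxtens_unindex m n) => x _; rewrite ?mxtens_indexK ?mxtens_unindexK.
by apply: eq_bigr => ab _; rewrite /tensor_weights mxtens_indexK geD.
Qed.

Lemma tens1mx1 m n : 1%:M *t 1%:M = 1%:M :> 'M[C]_(m * n).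
Proof.
apply/matrixP => c d; case: (mxtens_indexP c) => a b; case: (mxtens_indexP d) => a' b'.
by rewrite tensmxE !mxE (can_eq (@mxtens_indexK _ _)) xpair_eqE -natrM mulnb.
Qed.

Lemma tensor_iso M M' S S' : module_iso M M' -> module_iso S S' ->
  module_iso (tensor_module M S) (tensor_module M' S').
Proof.
move=> [f [ff fF fi]] [h [hf hF hi]].
exists (f *t h); split.
- by apply/row_freeP; exists (pinvmx f *t pinvmx h); rewrite tensmx_mul !mulmxVp// tens1mx1.
- by apply/row_fullP; exists (pinvmx f *t pinvmx h); rewrite tensmx_mul !mulVpmx// tens1mx1.
move=> A gA; rewrite /= /tensor_act mulmxDl mulmxDr !tensmx_mul !mul1mx !mulmx1.
by rewrite fi// hi.
Qed.

(** The summands come without a highest weight. As a quotient of [M] each inherits a weight basis,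
    in which a weight of maximal height provides one. *)
Lemma module_sum_character (s : seq (lie_module C X k)) M (wt : 'I_(mdim M) -> 'rV[rat]_k) :
  has_weights wt -> (forall c, wclass X (wt c)) ->
  List.Forall (fun S => irreducible_module S) s ->
  module_iso M (foldr (@dsum_module C X k) (zero_module C X k) s) ->
  exists ls : seq 'rV[rat]_k,
    [/\ List.Forall2 (fun S l => has_highest_weight S l) s ls, all (@dominant X k) ls &
        alt X C (rho X k) * character C wt = \sum_(l <- ls) alt X C (l + rho X k)].
Proof.
elim: s M wt => [|S s ih] M wt hw cl.
  move=> _ iso; exists [::]; split=> //; rewrite big_nil.
  rewrite [character _ _]big1 ?mulr0// => c _; exfalso.
  by move: c; rewrite (module_iso_dim iso) => -[].
move=> irs iso; have [irS {}irs] : irreducible_module S /\ List.Forall (@irreducible_module C X k) s.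
  by inversion irs.
set T := foldr _ _ s in iso ih.
have [i1 f1] := dsum_proj1 S T; have [i2 f2] := dsum_proj2 S T.
have [S' [wS [isoS hwS wSE]]] := iso_summand hw iso i1 f1.
have [T' [wT [isoT hwT wTE]]] := iso_summand hw iso i2 f2.
have clS c : wclass X (wS c) by have [d ->] := wSE c.
have [ls [hls dls chls]] : exists ls : seq 'rV[rat]_k,
    [/\ List.Forall2 (fun S l => has_highest_weight S l) s ls, all (@dominant X k) ls &
        alt X C (rho X k) * character C wT = \sum_(l <- ls) alt X C (l + rho X k)].
  by apply: ih hwT _ irs isoT => c; have [d ->] := wTE c.
have irS' : irreducible_module S' by apply: module_iso_irr irS; apply: module_iso_sym.
have [c hc] : exists c, hwv (M := S') (wS c) (delta_mx 0 c).
  by apply: max_weight_hwv => //; case: irS'.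
have hS : has_highest_weight S (wS c).
  by apply: module_iso_hwv isoS _; apply/hwvP; exists (delta_mx 0 c).
have [M' [wt' [iso' hw' _ wd [ch' _ _]]]] := weyl_character irS hS (clS c).
exists (wS c :: ls); split.
- exact: List.Forall2_cons.
- by rewrite /= dls andbT; apply/dominantE.
rewrite big_cons -chls -ch' nabla_alt -mulrDr.
rewrite (iso_character C hw' hwS (module_iso_trans iso' (module_iso_sym isoS))).
rewrite -dsum_character; congr (_ * _).
apply: (iso_character C hw (dsum_has_weights hwS hwT)).
by apply: (module_iso_trans iso); apply: dsum_iso; apply: module_iso_sym.
Qed.

Lemma multiplicity_character M (wt : 'I_(mdim M) -> 'rV[rat]_k) L l m :
  has_weights wt -> (forall c, wclass X (wt c)) -> is_irreducible_of l L ->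
  dominant X l -> multiplicity M L m ->
  exists2 ls : seq 'rV[rat]_k, all (@dominant X k) ls &
    alt X C (rho X k) * character C wt = \sum_(l <- ls) alt X C (l + rho X k) /\
    m = count_mem l ls.
Proof.
move=> hw cl [irL hL] dl [s [irs iso]].
have irs' : List.Forall (fun S => irreducible_module S) (nseq m L ++ s).
  apply/List.Forall_app; split; last by apply: List.Forall_impl irs => S [].
  by elim: (m) => //= m' ih; apply: List.Forall_cons.
have [ls [hls dls chls]] := module_sum_character hw cl irs' iso.
exists ls => //; split=> //.
(* The copies of [L] have highest weight [l] by uniqueness; any other summand of highest weight [l]
   would be isomorphic to [L]. *)
elim: m ls {irs' dls chls iso} hls => [|m ih] ls hls.
  elim: irs ls hls => [|S s' [irS niso] irs ih] ls hls; first by inversion hls.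
  inversion hls as [|S0 l0 s0 ls0 hS hls' e1 e2]; subst => /=.
  rewrite -ih// addn0; case: (l0 =P l) => // e; case: niso.
  by rewrite e in hS; apply: hw_iso hS hL.
inversion hls as [|S0 l0 s0 ls0 hS hls' e1 e2]; subst => /=.
by rewrite (hw_unique irL hS hL) eqxx -ih.
Qed.

Lemma count_alt (ls : seq 'rV[rat]_k) l : all (@dominant X k) ls -> dominant X l ->
  (\sum_(l' <- ls) alt X int (l' + rho X k)) (l + rho X k) = (count_mem l ls)%:R.
Proof.
move=> dls dl; rewrite gcoef_sum -sum1_count natr_sum [RHS]big_mkcond /=.
rewrite [LHS]big_seq [RHS]big_seq; apply: eq_bigr => l' l's.
have dl' : dominant X l' := allP dls _ l's.
rewrite gcoef_alt_sdom; [|exact: dominant_sdom..].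
by rewrite (inj_eq (addIr _)) eq_sym; case: eqP.
Qed.

(** The character [ch] is fixed before [g2], so that it can later be factored out of a sum over all
    one-row weights. *)
Theorem tensor_multiplicities (V : 'rV[rat]_k -> lie_module C X k)
    (V_irr : forall l, dominant X l -> is_irreducible_of l (V l)) g1 : dominant X g1 ->
  exists2 ch : galg 'rV[rat]_k int, alt X int (rho X k) * ch = alt X int (g1 + rho X k) &
    forall g2 (c : 'rV[rat]_k -> nat), dominant X g2 -> (forall i, g2 0 i \is a Num.int) ->
      (forall l, dominant X l -> multiplicity (tensor_module (V g1) (V g2)) (V l) (c l)) ->
    exists ls : seq 'rV[rat]_k,
    [/\ all (@dominant X k) ls, forall l, dominant X l -> c l = count_mem l ls &
        \sum_(l <- ls) alt X int (l + rho X k) = ch * alt X int (g2 + rho X k)].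
Proof.
move=> d1; have [ir1 h1] := V_irr _ d1; have [cl1 _] := (dominantE X g1).1 d1.
have [M1 [w1 [iso1 hw1 q1 _ [ch1 _ _]]]] := weyl_character ir1 h1 cl1.
exists (character int w1).
  by apply: (@gint_inj _ C); rewrite gintM !gint_alt gint_character -ch1 nabla_alt.
move=> g2 c d2 g2i cE.
have [ir2 h2] := V_irr _ d2; have [cl2 _] := (dominantE X g2).1 d2.
have [M2 [w2 [iso2 hw2 q2 _ [ch2 _ _]]]] := weyl_character ir2 h2 cl2.
have hw := tensor_has_weights hw1 hw2.
have cl x : wclass X (tensor_weights w1 w2 x).
  apply: wclassD => [|i].
    have -> : w1 (mxtens_unindex x).1 = g1 + - (g1 - w1 (mxtens_unindex x).1).
      by rewrite opprB addrC subrK.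
    by apply: wclassD => // i; rewrite mxE rpredN; apply: qcone_int (q1 _).
  have := qcone_int i (q2 (mxtens_unindex x).2).
  by rewrite mxE [X in _ + X]mxE -rpredN opprB => h; rewrite -[w2 _ _ _](subrK (g2 0 i)) rpredD.
have isoT := tensor_iso iso1 iso2.
have cE' l : dominant X l -> multiplicity (tensor_module M1 M2) (V l) (c l).
  move=> dl; have [s [irs iso]] := cE l dl; exists s; split=> //.
  exact: module_iso_trans isoT iso.
have chE : alt X int (rho X k) * character int (tensor_weights w1 w2) =
    character int w1 * alt X int (g2 + rho X k).
  rewrite tensor_character mulrCA; congr (_ * _); apply: (@gint_inj _ C).
  by rewrite gintM !gint_alt gint_character -ch2 nabla_alt.
have all_l l : dominant X l -> exists2 ls : seq 'rV[rat]_k, all (@dominant X k) ls &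
    character int w1 * alt X int (g2 + rho X k) = \sum_(l <- ls) alt X int (l + rho X k) /\
    c l = count_mem l ls.
  move=> dl; have [ls dls [e1 e2]] := multiplicity_character hw cl (V_irr _ dl) dl (cE' l dl).
  exists ls => //; split=> //; rewrite -chE; apply: (@gint_inj _ C).
  rewrite gintM gint_alt gint_character e1 raddf_sum.
  by apply: eq_bigr => l' _; apply/esym/gint_alt.
(* Each [l] comes with its own decomposition. The list of one of them serves for all, since
   multiplicities are coefficients of the common alternating sum. *)
have [ls dls [lsE _]] := all_l _ d1.
exists ls; split=> // l dl; have [ls' dls' [ls'E ->]] := all_l _ dl; apply/eqP.
by rewrite -(eqr_nat int) -!count_alt// -lsE -ls'E.
Qed.
End TensorWeights.

(** * Alternating sums of one-row weights *)

Section Geometric.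
Variables (A : comNzRingType) (d : nat).

(** Power series are replaced by polynomials compared up to degree [d], see [eqmodX]. *)
Definition geom (f : A) : A := \sum_(m < d.+1) f ^+ m.

Lemma geomE f : (1 - f) * geom f = 1 - f ^+ d.+1.
Proof.
rewrite -[in RHS](expr1n _ d.+1) subrXX; congr (_ * _).
by apply: eq_bigr => i _; rewrite expr1n mul1r.
Qed.
End Geometric.

Lemma rmorph_geom (A B : comNzRingType) (h : {rmorphism A -> B}) d f :
  h (geom d f) = geom d (h f).
Proof. by rewrite /geom rmorph_sum; apply: eq_bigr => m _; rewrite rmorphXn. Qed.

Section EqPoly.
Variables (A : comNzRingType) (d : nat).
Implicit Types f g : {poly A}.

Definition eqmodX f g := forall i, (i <= d)%N -> f`_i = g`_i.

Lemma eqmodXM f f' g g' : eqmodX f f' -> eqmodX g g' -> eqmodX (f * g) (f' * g').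
Proof.
move=> e1 e2 i id; rewrite !coefM; apply: eq_bigr => -[j /= ji] _.
by rewrite e1 ?e2//; lia.
Qed.
Lemma eqmodX_refl f : eqmodX f f. Proof. by []. Qed.
Lemma eqmodX_prod (I : finType) (F G : I -> {poly A}) :
  (forall i, eqmodX (F i) (G i)) -> eqmodX (\prod_i F i) (\prod_i G i).
Proof. by move=> h; apply: (big_ind2 eqmodX) => // *; apply: eqmodXM. Qed.

Lemma geom_inv (c : A) : eqmodX ((1 - c *: 'X) * geom d (c *: 'X)) 1.
Proof.
move=> i le_id; rewrite geomE exprZn coefB coefZ coefXn.
by rewrite (ltn_eqF (n := d.+1) (m := i)) ?ltnS// mulr0 subr0.
Qed.

Lemma geom_stable s (f : {poly A}) : (d <= s)%N -> eqmodX (geom s ('X * f)) (geom d ('X * f)).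
Proof.
move=> ds i le_id; rewrite /geom; have -> : s.+1 = (d.+1 + (s - d))%N by lia.
rewrite big_split_ord /= coefD [X in _ + X]coef_sum [X in _ + X]big1 ?addr0// => m _.
by rewrite exprMn coefXnM ifT//; lia.
Qed.
End EqPoly.

Section Rescale.
Variables (A : comNzRingType) (d : nat) (c : A).

Lemma coef_comp_scale (p : {poly A}) i : (p \Po (c *: 'X))`_i = c ^+ i * p`_i.
Proof.
rewrite comp_polyE coef_sum; have [ip|ip] := ltnP i (size p).
  rewrite (bigD1 (Ordinal ip)) //= big1 => [|j ji].
    by rewrite addr0 coefZ exprZn coefZ coefXn eqxx mulr1 mulrC.
  rewrite coefZ exprZn coefZ coefXn; move: ji; rewrite -val_eqE /= eq_sym => /negPf ->.
  by rewrite !mulr0.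
rewrite [p`_i]nth_default// mulr0 big1// => j _.
rewrite coefZ exprZn coefZ coefXn gtn_eqF ?mulr0//; exact: leq_trans (ltn_ord j) ip.
Qed.

Lemma eqmodX_comp_scale (p q : {poly A}) : eqmodX d p q ->
  eqmodX d (p \Po (c *: 'X)) (q \Po (c *: 'X)).
Proof. by move=> e i le_id; rewrite !coef_comp_scale e. Qed.

Lemma geom_comp (p q : {poly A}) : geom d p \Po q = geom d (p \Po q).
Proof. exact: rmorph_geom. Qed.

Lemma geom_sqrt (p : {poly A}) : eqmodX d ((1 - p) * geom d p) 1 ->
  eqmodX d ((1 - p ^+ 2) * geom d (p ^+ 2)) 1 ->
  eqmodX d ((1 + p) * geom d (p ^+ 2)) (geom d p).
Proof.
move=> e1 e2 i le_id.
transitivity ((((1 - p) * geom d p) * ((1 + p) * geom d (p ^+ 2)))`_i).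
  by rewrite (eqmodXM e1 (@eqmodX_refl _ d _) le_id) mul1r.
have -> : ((1 - p) * geom d p) * ((1 + p) * geom d (p ^+ 2)) =
    ((1 - p ^+ 2) * geom d (p ^+ 2)) * geom d p by ring.
by rewrite (eqmodXM e2 (@eqmodX_refl _ d _) le_id) mul1r.
Qed.
End Rescale.

Section Quadratic.
Variables (A : comNzRingType).

Lemma coef_quad (y : A) (P : {poly A}) j : ((1 - y *: 'X + 'X^2) * P)`_j =
  P`_j - y * ('X * P)`_j + ('X^2 * P)`_j.
Proof. by rewrite !mulrDl mul1r mulNr -scalerAl !coefD coefN coefZ. Qed.

(* [('X * E)`_(m.*2)] is the coefficient of index [m.*2 - 1], also when [m = 0]. *)
Lemma prod_quad m (y : 'I_m -> A) (E := \prod_(i < m) (1 - y i *: 'X + 'X^2)) :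
  [/\ forall j, (m.*2 < j)%N -> E`_j = 0, E`_0 = 1, E`_(m.*2) = 1 &
      E`_1 = ('X * E)`_(m.*2)].
Proof.
(* The induction needs the common value of the second and the last but one coefficients. *)
rewrite {}/E; suff : [/\ forall j, (m.*2 < j)%N -> (\prod_(i < m) (1 - y i *: 'X + 'X^2))`_j = 0,
   (\prod_(i < m) (1 - y i *: 'X + 'X^2))`_0 = 1, (\prod_(i < m) (1 - y i *: 'X + 'X^2))`_(m.*2) = 1,
    (\prod_(i < m) (1 - y i *: 'X + 'X^2))`_1 = - (\sum_i y i) &
    ('X * \prod_(i < m) (1 - y i *: 'X + 'X^2))`_(m.*2) = - (\sum_i y i)].
  by case=> h1 h2 h3 -> ->.
elim: m y => [|m ih] y.
  rewrite !big_ord0 mulr1 coefX !coef1 oppr0; split=> // -[|j] //.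
  by rewrite coef1.
rewrite !big_ord_recr /=; set P := \prod_i _; have := ih (fun i => y (widen_ord (leqnSn m) i)).
rewrite -/P => -[h1 h2 h3 h4 h5].
rewrite [P * _]mulrC; split.
- move=> j jm; rewrite coef_quad coefXM coefXnM (h1 j) ?(h1 j.-1) ?(h1 (j - 2)%N); try lia.
  by rewrite !if_same mulr0 subr0 addr0.
- by rewrite coef_quad coefXM coefXnM /= h2 mulr0 subr0 addr0.
- rewrite doubleS coef_quad coefXM coefXnM /= (h1 m.*2.+2) ?(h1 m.*2.+1); try lia.
  by rewrite subn2 /= h3 mulr0 subr0 add0r.
- by rewrite coef_quad coefXM coefXnM /= h2 h4 mulr1 addr0 opprD.
rewrite coefXM doubleS /= coef_quad h1; try lia.
by rewrite coefXM /= h3 mulr1 sub0r exprS expr1 -mulrA coefXM /= h5 opprD addrC.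
Qed.
End Quadratic.

(** * The linear recurrence of one-row alternating sums *)

Section RowWeights.
Variables (S : comNzRingType) (X : lie_type) (n : nat).
Hypothesis S_tf : forall x : S, x = - x -> x = 0.
Local Notation k := n.+1.
Local Notation G := 'rV[rat]_k.
Local Notation mx := (ord_max : 'I_k).
Local Notation A := (galg G S).
Local Notation gE := (ge S).

Lemma galg_tf (f : A) : f = - f -> f = 0.
Proof.
by move=> e; apply: galgP => x; apply: S_tf; rewrite -gcoefN -e.
Qed.

(** An odd element fixes [b]. For opposite coordinates it is a swap with two flips, allowed in type
    D as well. *)
Lemma alt_repeat (b : G) i j : i != j -> b 0 i = b 0 j \/ b 0 i = - b 0 j ->
  alt X S b = 0.
Proof.
move=> nij H; apply: galg_tf; case: H => bij.
  apply: (@alt_fixed _ _ _ (wswap i j)).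
  - by rewrite in_weyl; case: (X) => //; rewrite big1// => l _; rewrite ffunE.
  - by rewrite /wodd odd_tperm nij big1// => l _; rewrite ffunE.
  by apply/rowP => l; rewrite weyl_actE ffunE mul1r /=; case: tpermP => [->|->|].
apply: (@alt_fixed _ _ _ (wflipswap i j)).
- rewrite in_weyl (bigD1 i)//= (bigD1 j) 1?eq_sym//= !ffunE !eqxx orbT big1//.
    by case: (X).
  by move=> l /andP[/negPf h1 /negPf h2]; rewrite ffunE h1 h2.
- rewrite /wodd odd_tperm nij (bigD1 i)//= (bigD1 j) 1?eq_sym//= !ffunE !eqxx orbT big1//.
  by move=> l /andP[/negPf h1 /negPf h2]; rewrite ffunE h1 h2.
apply/rowP => l; rewrite weyl_actE ffunE /=.
case: tpermP => [->|->|/eqP/negPf hi /eqP/negPf hj].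
- by rewrite eqxx mulN1r bij.
- by rewrite eqxx orbT mulN1r bij opprK.
- by rewrite hi hj mul1r.
Qed.

Lemma alt_flip (b : G) i : X <> TypeD -> alt X S (b - (2 * b 0 i) *: eps i) = - alt X S b.
Proof.
move=> nD; have -> : b - (2 * b 0 i) *: eps i = weyl_act (wflip i) b.
  apply/rowP => l; rewrite weyl_actE ffunE perm1 !mxE eqxx /=.
  by case: (l =P i) => [->|_] /=; ring.
rewrite alt_weyl; last by rewrite in_weyl; case: X nD.
by rewrite /wodd odd_perm1 (bigD1 i)//= ffunE eqxx big1 ?mulN1r// => l /negPf h; rewrite ffunE h.
Qed.

Lemma alt_zero_coord (b : G) i : X <> TypeD -> b 0 i = 0 -> alt X S b = 0.
Proof.
move=> nD bi; apply: galg_tf; rewrite -{1}[b]subr0 -(scale0r (eps i)) -(mulr0 2) -bi.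
exact: alt_flip.
Qed.

(** In type D the zero coordinate absorbs the second flip. *)
Lemma alt_flip2 (b : G) i : X = TypeD -> i != ord0 -> b 0 ord0 = 0 ->
  alt X S (b - (2 * b 0 i) *: eps i) = alt X S b.
Proof.
move=> XD i0 b0; pose w : signed_perm k := (1%g, [ffun l => (l == i) || (l == ord0)]).
have -> : b - (2 * b 0 i) *: eps i = weyl_act w b.
  apply/rowP => l; rewrite weyl_actE ffunE perm1 !mxE eqxx /=.
  case: (l =P i) => [->|_] /=; first ring.
  by case: (l =P ord0) => [->|_] /=; rewrite ?b0; ring.
have e0 : \big[addb/false]_l w.2 l = false.
  rewrite (bigD1 i)//= (bigD1 ord0) 1?eq_sym//= !ffunE !eqxx orbT big1//.
  by move=> l /andP[/negPf h1 /negPf h2]; rewrite ffunE h1 h2.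
by rewrite alt_weyl ?in_weyl ?e0 ?XD// /wodd e0 odd_perm1 mul1r.
Qed.

(** Extended to negative [z], where the initial values of the recurrence lie. *)
Definition arow (z : int) : A := alt X S (rho X k + z%:~R *: eps mx).

Definition epoly : {poly A} :=
  \prod_(i < k) ((1 - gE (eps i) *: 'X) * (1 - gE (- eps i) *: 'X)).

Lemma epolyE : epoly = \prod_(i < k) (1 - (gE (eps i) + gE (- eps i)) *: 'X + 'X^2).
Proof.
apply: eq_bigr => i _; rewrite -!mul_polyC polyCD.
have : (gE (eps i))%:P * (gE (- eps i))%:P = 1 by rewrite -polyCM -geD subrr ge0.
move: (gE (eps i))%:P (gE (- eps i))%:P => a b ab.
transitivity (1 - (a + b) * 'X + (a * b) * 'X^2); first ring.
by rewrite ab mul1r.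
Qed.

(** For each [w] the terms form a geometric sequence of ratio e^y, where y is eps_i or -eps_i, and
    [epoly] vanishes at e^(-y). *)
Lemma arow_rec z : \sum_(j < k.*2.+1) epoly`_j * arow (z - j%:Z) = 0.
Proof.
have sE : (size epoly <= k.*2.+1)%N.
  apply/leq_sizeP => j hj; rewrite epolyE; have [h _ _ _] := prod_quad (fun i : 'I_k => gE (eps i) + gE (- eps i)).
  exact: h.
under eq_bigr => j _ do rewrite /arow mulr_sumr.
rewrite exchange_big big1 // => w wW /=; pose y := weyl_act w (eps mx).
transitivity ((-1) ^+ wodd w * gE (weyl_act w (rho X k) + z%:~R *: y) *
    \sum_(j < k.*2.+1) epoly`_j * gE (- y) ^+ j).
  rewrite mulr_sumr; apply: eq_bigr => j _; rewrite mulrCA -mulrA; congr (_ * _).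
  rewrite mulrCA; congr (_ * _).
  rewrite -geMn -geD; congr (ge S _).
  rewrite /weyl_act mulmxDl -scalemxAl -!/(weyl_act _ _) -/y -addrA; congr (_ + _).
  by rewrite rmorphB scalerBl mulNrn -scaler_nat.
rewrite -(horner_coef_wide _ sE) /epoly horner_prod (bigD1 ((w.1^-1)%g mx)) //=.
have lin c x : (1 - c *: 'X).[x] = 1 - c * x :> A.
  by rewrite hornerD hornerN hornerZ hornerX hornerC.
rewrite hornerM !lin /y weyl_act_eps; set i := (w.1^-1)%g mx.
have e : gE (eps i) * gE (- eps i) = 1 by rewrite -geD subrr ge0.
case: (w.2 i); rewrite ?expr1 ?expr0 ?scaleN1r ?scale1r ?opprK.
  by rewrite [gE (- _) * _]mulrC e subrr !(mulr0, mul0r).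
by rewrite e subrr !(mulr0, mul0r).
Qed.

(** Within this range, subtracting [s] makes the last coordinate of [rho] equal or opposite to
    another one, or zero for s = n + 1 in type C. *)
Lemma arow_neg s : (0 < s)%N ->
  (s <= match X with TypeB => n.*2 | TypeC => n.*2.+1 | TypeD => n.*2.-1 end)%N ->
  arow (- s%:Z) = 0.
Proof.
move=> s0 sB.
have bmx : (rho X k + (- s%:Z)%:~R *: eps mx) 0 mx = rho X k 0 mx - s%:R.
  by rewrite mxE [X in _ + X]mxE eps_coef eqxx mulr1 rmorphN.
have bi (i : 'I_k) : i != mx -> (rho X k + (- s%:Z)%:~R *: eps mx) 0 i = rho X k 0 i.
  by move=> imx; rewrite mxE [X in _ + X]mxE eps_coef eq_sym (negPf imx) mulr0 addr0.
have rep i0 : (i0 < n)%N -> rho X k 0 mx - s%:R = rho X k 0 (inord i0) \/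
    rho X k 0 mx - s%:R = - rho X k 0 (inord i0) -> arow (- s%:Z) = 0.
  move=> hi h; have nmx : inord i0 != mx by rewrite -val_eqE /= inordK; lia.
  by apply: (@alt_repeat _ mx (inord i0)); rewrite 1?eq_sym// bmx bi.
have [sn|ns] := leqP s n.
  apply: (rep (n - s)%N); first lia.
  left; rewrite !mxE inordK ?leq_subr//=; last lia.
  by case: (X); rewrite -?[(_ - _).+1]addn1 -?[n.+1]addn1 ?natrD natrB//; ring.
have [XB|[XC|XD]] : X = TypeB \/ X = TypeC \/ X = TypeD by case: (X); tauto.
- rewrite XB in sB; apply: (rep (s - n.+1)%N); first lia.
  right; rewrite !mxE XB inordK; last lia.
  by rewrite /= natrB ?leqW// -[n.+1]addn1 natrD; field.
- rewrite XC in sB; have [e|ne] := eqVneq s n.+1.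
    apply: (@alt_zero_coord _ mx); first by rewrite XC.
    by rewrite bmx mxE XC e subrr.
  apply: (rep (s - n.+2)%N); first lia.
  right; rewrite !mxE XC inordK; last lia.
  rewrite (_ : (s - n.+2).+1 = (s - n.+1)%N); last lia.
  by rewrite natrB ?opprB// ltnW.
rewrite XD in sB; apply: (rep (s - n)%N); first lia.
right; rewrite !mxE XD inordK; last lia.
by rewrite /= natrB ?(ltnW ns)// opprB.
Qed.

Lemma rho_mx : rho X k 0 mx = n%:R + match X with
  TypeB => 2^-1 | TypeC => 1 | TypeD => 0 end.
Proof. by rewrite mxE; case: (X); rewrite /= ?addr0// natr1. Qed.

Lemma arow_negB : X = TypeB -> arow (- n.*2.+1%:Z) = - arow 0.
Proof.
move=> XB; rewrite /arow scale0r addr0 -(@alt_flip _ mx) ?XB//.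
congr (alt _ _ _); rewrite -scaleNr -XB rho_mx XB -[n.*2.+1]addn1 -addnn; congr (_ + _ *: _).
by rewrite rmorphN /= -!pmulrn !natrD; field.
Qed.

Lemma arow_negD : X = TypeD -> (0 < n)%N ->
  arow (- n.*2%:Z) = arow 0 /\ arow (- n.*2.+1%:Z) = arow 1.
Proof.
move=> XD n0; have mx0 : mx != ord0 by rewrite -val_eqE /=; lia.
have r0 : rho X k 0 ord0 = 0 by rewrite mxE XD.
split; rewrite /arow.
  rewrite scale0r addr0 -[RHS](@alt_flip2 _ mx)//; congr (alt _ _ _).
  by rewrite -scaleNr rho_mx XD addr0 -addnn rmorphN /= -!pmulrn natrD; congr (_ + _ *: _); ring.
rewrite scale1r -[RHS](@alt_flip2 (rho X k + _) mx)//; last first.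
  by rewrite mxE r0 eps_coef (negPf mx0) addr0.
congr (alt _ _ _); rewrite [in RHS]mxE rho_mx XD eps_coef eqxx -addrA; congr (_ + _).
rewrite -{2}[eps mx]scale1r -scalerBl; congr (_ *: _).
by rewrite -[n.*2.+1]addn1 -addnn rmorphN /= -!pmulrn !natrD; ring.
Qed.

(* The generating series of the [arow r] is [arow 0 * row_num / epoly]. *)
Definition row_num : {poly A} :=
  match X with TypeB => 1 + 'X | TypeC => 1 | TypeD => 1 - 'X^2 end.

(** The recurrence expresses this sum through the indices -1, ..., -(2n + 1), where [arow] vanishes
    or is known by a flip. *)
Lemma epoly_arow i (n0 : if X is TypeD then (0 < n)%N else true) :
  \sum_(j < i.+1) epoly`_j * arow (i%:Z - j%:Z) = arow 0 * row_num`_i.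
Proof.
have [hE E0 EN E1] := prod_quad (fun i : 'I_k => gE (eps i) + gE (- eps i)).
rewrite -epolyE in hE E0 EN E1.
have {}E1 : epoly`_1 = epoly`_(n.*2.+1) by rewrite E1 coefXM.
case: i => [|i].
  rewrite big_ord1 E0 mul1r subrr /row_num.
  by case: (X); rewrite ?coefB ?coefD coef1 ?coefX ?coefXn /= ?subr0 ?addr0 mulr1.
have neg : \sum_(j < i.+2) epoly`_j * arow (i.+1%:Z - j%:Z) =
    - (\sum_(s < n.*2) epoly`_(i.+1 + s.+1) * arow (- s.+1%:Z) +
       epoly`_(i.+1 + n.*2.+1) * arow (- n.*2.+1%:Z)).
  apply/eqP; rewrite -addr_eq0; apply/eqP.
  transitivity (\sum_(j < i.+2 + k.*2) epoly`_j * arow (i.+1%:Z - j%:Z)).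
    rewrite big_split_ord /=; congr (_ + _); rewrite doubleS !big_ord_recr /=.
    rewrite [epoly`_(i.+2 + n.*2.+1)]hE ?mul0r ?addr0; last lia.
    congr (_ + _); last by rewrite (addSnnS i.+1); congr (_ * arow _); lia.
    by apply: eq_bigr => s _; rewrite (addSnnS i.+1); congr (_ * arow _); lia.
  have e : (i.+2 + k.*2 = k.*2.+1 + i.+1)%N by lia.
  rewrite -(big_mkord xpredT (fun j => epoly`_j * arow (i.+1%:Z - j%:Z))) e big_mkord.
  by rewrite big_split_ord /= arow_rec add0r big1// => j' _; rewrite hE ?mul0r//; lia.
have [XB|[XC|XD]] : X = TypeB \/ X = TypeC \/ X = TypeD by case: (X); tauto.
- rewrite neg big1 ?add0r => [|s _]; last first.
    by rewrite arow_neg ?mulr0// XB.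
  rewrite arow_negB// mulrN opprK /row_num XB coefD coef1 coefX /= add0r mulrC.
  case: i {neg} => [|i]; last by rewrite hE ?mulr0//; lia.
  by rewrite add1n EN.
- rewrite neg big1 ?add0r => [|s _]; last first.
    by rewrite arow_neg ?mulr0// XC; have := ltn_ord s; lia.
  by rewrite arow_neg ?XC// mulr0 oppr0 /row_num XC coef1 mulr0.
rewrite XD in n0; have [a0 a1] := arow_negD XD n0.
have rest : \sum_(s < n.*2) epoly`_(i.+1 + s.+1) * arow (- s.+1%:Z) =
    epoly`_(i.+1 + n.*2) * arow 0.
  have : (0 < n.*2)%N by lia.
  have z s : (0 < s)%N -> (s <= n.*2.-1)%N -> arow (- s%:Z) = 0 by move=> *; rewrite arow_neg ?XD.
  move: a0 z; case: (n.*2) => [|N] a0 z _ //.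
  rewrite big_ord_recr /= big1 ?add0r ?a0 // => s _.
  by rewrite z ?mulr0// /=; have := ltn_ord s.
rewrite neg rest a1 /row_num XD coefB coef1 coefXn /= sub0r.
case: i neg rest => [|i] neg rest; last first.
  rewrite (hE (i.+2 + n.*2.+1)%N) ?mul0r ?addr0; last lia.
  case: i {neg rest} => [|i]; first by rewrite add2n EN mul1r mulrN1.
  by rewrite hE ?mul0r ?oppr0 ?mulr0//; lia.
rewrite /= oppr0 mulr0; apply/eqP; rewrite oppr_eq0; apply/eqP.
(* In degree 1 and type D the recurrence reads x = -x, as the coefficients of [epoly] in degrees 1
   and 2n + 1 agree. *)
apply: galg_tf.
move: neg; rewrite rest a1 => <-.
rewrite !big_ord_recr big_ord0 /= add0r E0 mul1r subr0 subrr.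
by rewrite !add1n EN E1 mul1r addrC.
Qed.
(** Inverse of [epoly] up to degree [d]; its coefficients are the complete symmetric functions of
    the e^(eps_i) and e^(-eps_i). *)
Definition hpoly (d : nat) : {poly A} :=
  \prod_(i < k) (geom d (gE (eps i) *: 'X) * geom d (gE (- eps i) *: 'X)).

Lemma epoly_hpoly d : eqmodX d (epoly * hpoly d) 1.
Proof.
have -> : 1 = \prod_(i < k) 1 :> {poly A} by rewrite big1.
rewrite /epoly /hpoly -big_split /=; apply: eqmodX_prod => i.
by rewrite mulrACA => j le_jd; rewrite (eqmodXM (@geom_inv _ d _) (@geom_inv _ d _) le_jd) mulr1.
Qed.

Lemma arow_hpoly d (n0 : if X is TypeD then (0 < n)%N else true) :
  eqmodX d (\poly_(r < d.+1) arow r) (arow 0 *: (row_num * hpoly d)).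
Proof.
set a := \poly_(r < d.+1) _.
have ea : eqmodX d (epoly * a) (arow 0 *: row_num).
  move=> i le_id; rewrite coefZ -epoly_arow// coefM; apply: eq_bigr => -[j /= ji] _.
  by rewrite coef_poly ifT; [congr (_ * arow _)|]; lia.
move=> i le_id; rewrite scalerAl.
transitivity ((epoly * hpoly d * a)`_i).
  by rewrite (eqmodXM (@epoly_hpoly d) (@eqmodX_refl _ d a) le_id) mul1r.
by rewrite mulrAC (eqmodXM ea (@eqmodX_refl _ d _) le_id).
Qed.

(** The factor of the positive roots that involve the last coordinate: [c] stands for q and the
    degree in ['X] records that coordinate. *)
Definition hqpoly (c : A) (d : nat) : {poly A} :=
  (\prod_(i < k) (geom d ((c * gE (eps i)) *: 'X) * geom d ((c * gE (- eps i)) *: 'X))) *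
  match X with
  | TypeB => geom d (c *: 'X)
  | TypeC => geom d (c *: 'X^2)
  | TypeD => 1
  end.

(** With p = c t, this is (1 + p) / (1 - p^2) = 1 / (1 - p) in type B and (1 - p^2) / (1 - p^2) = 1
    in type D. In type C the factor 1 / (1 - c t^2) is already present. *)
Lemma hqpolyE c d : eqmodX d (hqpoly c d)
  (((row_num * hpoly d) \Po (c *: 'X)) *
   geom d ((if X is TypeC then c else c ^+ 2) *: 'X^2)).
Proof.
rewrite comp_polyM mulrAC mulrC /hqpoly; apply: eqmodXM.
  suff -> : hpoly d \Po (c *: 'X) = \prod_(i < k)
    (geom d ((c * gE (eps i)) *: 'X) * geom d ((c * gE (- eps i)) *: 'X)) by exact: eqmodX_refl.
  rewrite /hpoly rmorph_prod; apply: eq_bigr => i _.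
  by rewrite /= comp_polyM !geom_comp !comp_polyZ !comp_polyX !scalerA ![_ * c]mulrC.
have e2 : eqmodX d ((1 - (c *: 'X) ^+ 2) * geom d ((c *: 'X) ^+ 2)) 1.
  move=> i le_id; rewrite geomE -exprM exprZn coefB coefZ coefXn.
  by rewrite ltn_eqF ?mulr0 ?subr0//; lia.
have e1 : eqmodX d ((1 - c *: 'X) * geom d (c *: 'X)) 1 by exact: geom_inv.
have [XB|[XC|XD]] : X = TypeB \/ X = TypeC \/ X = TypeD by case: (X); tauto.
- rewrite /row_num XB comp_polyD comp_polyX comp_polyC -exprZn => i le_id.
  by rewrite (geom_sqrt e1 e2).
- by rewrite /row_num XC comp_polyC mul1r; exact: eqmodX_refl.
rewrite /row_num XD comp_polyB comp_polyC rmorphXn /= comp_polyX -exprZn => i le_id.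
by rewrite e2.
Qed.

Lemma row_series c d R (n0 : if X is TypeD then (0 < n)%N else true) : (R <= d)%N ->
  \sum_(r < R.+1) \sum_(m < R.+1 | (r + 2 * m == R)%N)
    c ^+ (if X is TypeC then R - m else R) * arow r =
  arow 0 * (hqpoly c d)`_R.
Proof.
move=> le_Rd; set w := if X is TypeC then c else c ^+ 2.
rewrite (hqpolyE c le_Rd) -/w -coefZ scalerAl.
have ea : eqmodX d ((\poly_(r < d.+1) arow r) \Po (c *: 'X))
    (arow 0 *: ((row_num * hpoly d) \Po (c *: 'X))).
  by rewrite -comp_polyZ; apply/eqmodX_comp_scale/arow_hpoly.
rewrite -(eqmodXM ea (@eqmodX_refl _ d _) le_Rd) coefM; apply: eq_bigr => -[r /= rR] _.
rewrite coef_comp_scale coef_poly ifT; last lia.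
rewrite /geom coef_sum (big_ord_widen_cond d.+1 (fun m => (r + 2 * m == R)%N)
  (fun m => c ^+ (if X is TypeC then R - m else R)%N * arow r)) ?ltnS//.
rewrite mulr_sumr big_mkcond /=; apply: eq_bigr => -[m /= md] _.
rewrite exprZn coefZ -exprM coefXn.
have [e|ne] := eqVneq (r + 2 * m)%N R; last first.
  by rewrite (_ : _ == _ = false) ?mulr0 ?mulr0//; apply/eqP => e; move/eqP: ne; lia.
rewrite ifT; last lia.
rewrite (_ : _ == _ = true) ?mulr1; last by apply/eqP; lia.
rewrite [c ^+ r * _]mulrC -mulrA mulrC; congr (_ * _); rewrite /w.
by case: (X); rewrite -?exprM -exprD; congr (_ ^+ _); lia.
Qed.
End RowWeights.

(** * The generating series of the q-partition function *)

Section Gmap.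
Variables (G H : zmodType) (R : comNzRingType) (h : {additive G -> H}).

Definition gmap : galg G R -> galg H R := geval (@gC H R) (fun x => ge R (h x)).
Fact gmap_zmod : zmod_morphism gmap.
Proof. exact: geval_is_zmod_morphism. Qed.
HB.instance Definition _ := GRing.isZmodMorphism.Build _ _ gmap gmap_zmod.
Lemma gmap_ge x : gmap (ge R x) = ge R (h x).
Proof. exact: geval_ge. Qed.
Lemma gmap_C c : gmap (gC G c) = gC H c.
Proof. by rewrite /gmap geval_monom raddf0 ge0 mulr1. Qed.
Fact gmap_monoid : monoid_morphism gmap.
Proof.
split; first by rewrite -ge0 gmap_ge raddf0.
by apply: gevalM => a b; rewrite raddfD geD.
Qed.
HB.instance Definition _ := GRing.isMonoidMorphism.Build _ _ gmap gmap_monoid.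

Lemma gcoef_gmapM f g x : (gmap f * g) x = \sum_(y <- gsupp f) f y * g (x - h y).
Proof.
rewrite {1}(gsum_monom f) raddf_sum /= mulr_suml gcoef_sum; apply: eq_bigr => y _.
by rewrite [gmap _]geval_monom -gmonomE gcoef_monomM.
Qed.
Lemma gcoef_gmap f x : gmap f x = \sum_(y <- gsupp f) f y * (x == h y)%:R.
Proof.
rewrite -[gmap f]mulr1 gcoef_gmapM; apply: eq_bigr => y _.
by rewrite gcoef1 subr_eq0.
Qed.
End Gmap.

Section Partition.
Variables (X : lie_type) (k : nat).
Local Notation S := {poly int}.
Local Notation G := 'rV[rat]_k.

Definition root_series (d : nat) : galg G S :=
  \prod_(a <- pos_roots X k) geom d (gC G 'X * ge S a).

Lemma big_seq_sub (R : Type) (idx : R) (op : Monoid.com_law idx) (F : G -> R) :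
  \big[op/idx]_(a <- pos_roots X k) F a =
  \big[op/idx]_(a : seq_sub (pos_roots X k)) F (val a).
Proof.
rewrite -(big_map val xpredT) /=; apply: perm_big; apply: uniq_perm.
- exact: pos_roots_uniq.
- by rewrite map_inj_uniq ?index_enum_uniq//; apply: val_inj.
move=> a; apply/idP/mapP => [ha|[b _ ->]]; last exact: ssvalP.
by exists (SeqSub ha) => //; rewrite mem_index_enum.
Qed.

Lemma card_root_partitions beta d e : (e <= d)%N ->
  #|root_partitions X beta e| =
  #|[set m : {ffun seq_sub (pos_roots X k) -> 'I_d.+1} |
     (\sum_a m a == e)%N && (\sum_a val a *+ m a == beta)]|.
Proof.
move=> ed; have we : (e.+1 <= d.+1)%N by [].
pose f (m : {ffun seq_sub (pos_roots X k) -> 'I_e.+1}) :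
  {ffun seq_sub (pos_roots X k) -> 'I_d.+1} := [ffun a => widen_ord we (m a)].
have f_inj : injective f.
  move=> m m' /ffunP e1; apply/ffunP => a; have := e1 a; rewrite !ffunE => /(congr1 val) /= h.
  exact: val_inj.
rewrite -(card_imset _ f_inj); congr #|pred_of_set _|.
have sumf (m : {ffun seq_sub (pos_roots X k) -> 'I_e.+1}) :
    (\sum_a f m a = \sum_a m a)%N /\ \sum_a val a *+ f m a = \sum_a val a *+ m a.
  by split; apply: eq_bigr => a _; rewrite ffunE.
apply/finset.setP => m; apply/finset.imsetP/idP => [[m' + ->]|].
  by rewrite !finset.inE; have [-> ->] := sumf m'.
rewrite finset.inE => /andP[/eqP s1 s2].
have le_m a : (m a < e.+1)%N by rewrite ltnS -s1 (bigD1 a) //= leq_addr.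
pose m' : {ffun seq_sub (pos_roots X k) -> 'I_e.+1} := [ffun a => Ordinal (le_m a)].
have fm' : f m' = m by apply/ffunP => a; rewrite !ffunE; apply: val_inj.
exists m' => //; rewrite finset.inE; have [<- <-] := sumf m'.
by rewrite fm' s1 eqxx.
Qed.

(** Positive roots have height at least 1, so no multiplicity exceeds [d] and the truncation is
    harmless. *)
Lemma gcoef_root_series d beta : root_height beta <= d%:R ->
  root_series d beta = qpartition X beta.
Proof.
move=> hd; rewrite /root_series big_seq_sub /geom bigA_distr_bigA /= gcoef_sum.
have term (f : {ffun seq_sub (pos_roots X k) -> 'I_d.+1}) :
    (\prod_a (gC G 'X * ge S (val a)) ^+ f a) beta =
    'X^(\sum_a f a)%N * (beta == \sum_a val a *+ f a)%:R.
  transitivity (gmonom ('X^(\sum_a f a)%N : S) (\sum_a val a *+ f a) beta); last first.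
    by rewrite gcoef_monom; case: eqP; rewrite ?mulr1 ?mulr0.
  rewrite gmonomE -prodrXr rmorph_prod ge_sum -big_split /=; congr (gcoef _ _).
  by apply: eq_bigr => a _; rewrite exprMn geMn rmorphXn.
under eq_bigr => f _ do rewrite term.
apply/polyP => e; rewrite coef_sum.
have -> : \sum_(f : {ffun seq_sub (pos_roots X k) -> 'I_d.+1})
      ('X^(\sum_a f a)%N * (beta == \sum_a val a *+ f a)%:R : S)`_e =
    #|[set m : {ffun seq_sub (pos_roots X k) -> 'I_d.+1} |
     (\sum_a m a == e)%N && (\sum_a val a *+ m a == beta)]|%:R.
  rewrite -sum1_card natr_sum [RHS]big_mkcond /=; apply: eq_bigr => f _.
  rewrite finset.inE mulr_natr coefMn coefXn eq_sym [beta == _]eq_sym.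
  by case: eqP; case: eqP.
have [ed|de] := leqP e d; first by rewrite coef_qpartition (card_root_partitions _ ed).
(* In degrees above [d] both sides vanish, as the height bounds the number of roots. *)
rewrite coef_poly ifF; last first.
  apply/negbTE; rewrite -leqNgt; apply: leq_ltn_trans de.
  by have := le_truncn hd; rewrite natrK.
apply/eqP; rewrite pnatr_eq0 cards_eq0; apply/eqP/finset.setP => m.
rewrite finset.inE finset.in_set0; apply: contraTF de => /andP[/eqP sm /eqP sb].
rewrite -leqNgt -(ler_nat rat); apply: le_trans hd.
rewrite -sb raddf_sum -sm natr_sum ler_sum// => a _.
by rewrite raddfMn ler_wMn2r// (root_height_ge1 (ssvalP a)).
Qed.
End Partition.

(** * Positive roots of consecutive ranks *)

Section Embedding.
Variables (n : nat).
Local Notation mx := (ord_max : 'I_n.+1).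

Definition embed (v : 'rV[rat]_n) : 'rV[rat]_n.+1 :=
  \row_j if unlift mx j is Some i then v 0 i else 0.
Fact embed_zmod : zmod_morphism embed.
Proof.
move=> u v; apply/rowP => j; rewrite !mxE.
by case: unliftP => [i _|_]; rewrite ?mxE ?subr0.
Qed.
HB.instance Definition _ := GRing.isZmodMorphism.Build _ _ embed embed_zmod.

Lemma embed_max v : embed v 0 mx = 0.
Proof. by rewrite mxE unlift_none. Qed.
Lemma embed_lift v i : embed v 0 (lift mx i) = v 0 i.
Proof. by rewrite mxE liftK. Qed.
Lemma embed_eps i : embed (eps i) = eps (lift mx i).
Proof.
apply/rowP => j; rewrite eps_coef; case: (unliftP mx j) => [i' ->|->].
  by rewrite embed_lift eps_coef (inj_eq lift_inj).
by rewrite embed_max eq_sym (negPf (neq_lift _ _)).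
Qed.
Lemma weight_tailE v i : weight_tail v 0 i = v 0 (lift mx i).
Proof. by rewrite mxE. Qed.
Lemma embedP v w : (v == embed w) = (v 0 mx == 0) && (weight_tail v == w).
Proof.
apply/eqP/andP => [->|[/eqP v0 /eqP <-]].
  rewrite embed_max; split=> //; apply/eqP/rowP => i.
  by rewrite weight_tailE embed_lift.
apply/rowP => j; case: (unliftP mx j) => [i ->|->].
  by rewrite embed_lift weight_tailE.
by rewrite embed_max.
Qed.

Lemma gcoef_gmap_embed (R : comNzRingType) (f : galg 'rV[rat]_n R) x :
  gmap embed f x = if x 0 mx == 0 then f (weight_tail x) else 0.
Proof.
rewrite gcoef_gmap; under eq_bigr => y _ do rewrite embedP.
case: eqP => _ /=; last by rewrite big1// => y _; rewrite mulr0.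
have [hx|hx] := boolP (weight_tail x \in gsupp f); last first.
  rewrite gsuppP// big1_seq// => y /andP[_ yf]; case: eqP => [e|]; rewrite ?mulr0//.
  by rewrite e yf in hx.
rewrite (bigD1_seq (weight_tail x)) ?gsupp_uniq//= eqxx mulr1 big1 ?addr0// => y.
by rewrite eq_sym => /negPf ->; rewrite mulr0.
Qed.

Lemma prod_pos_roots_max X (R : comNzRingType) (F : 'rV[rat]_n.+1 -> R) :
  \prod_(a <- pos_roots X n.+1) F a =
  \prod_(a <- pos_roots X n) F (embed a) *
  (\prod_(i < n) (F (eps mx - embed (eps i)) * F (eps mx + embed (eps i))) *
   match X with TypeB => F (eps mx) | TypeC => F (2 *: eps mx) | TypeD => 1 end).
Proof.
have wl (i : 'I_n) : widen_ord (leqnSn n) i = lift mx i.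
  by apply: val_inj; rewrite /= /bump leqNgt ltn_ord.
have pairs (H : 'I_n.+1 -> 'I_n.+1 -> R) :
    \prod_(ij in [pred ij : 'I_n.+1 * 'I_n.+1 | (ij.2 < ij.1)%N]) H ij.1 ij.2 =
    \prod_(ij in [pred ij : 'I_n * 'I_n | (ij.2 < ij.1)%N]) H (lift mx ij.1) (lift mx ij.2) *
    \prod_(j < n) H mx (lift mx j).
  rewrite -(pair_big_dep xpredT (fun i j : 'I_n.+1 => (j < i)%N) H) /=.
  rewrite -(pair_big_dep xpredT (fun i j : 'I_n => (j < i)%N)
    (fun i j => H (lift mx i) (lift mx j))) /=.
  rewrite big_ord_recr /=; congr (_ * _).
    apply: eq_bigr => i _; rewrite big_mkcond big_ord_recr /= wl ifF ?mulr1; last first.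
      by apply/negbTE; rewrite -leqNgt -?wl /= ltnW.
    rewrite [RHS]big_mkcond; apply: eq_bigr => j _; rewrite !wl.
    by rewrite -!wl /=.
  rewrite big_mkcond big_ord_recr /= ltnn mulr1; apply: eq_bigr => j _.
  by rewrite ltn_ord wl.
have short : \prod_(a <- match X with
     | TypeB => [seq eps i | i : 'I_n.+1]
     | TypeC => [seq 2 *: eps i | i : 'I_n.+1]
     | TypeD => [::] end) F a =
   \prod_(a <- match X with
     | TypeB => [seq eps i | i : 'I_n]
     | TypeC => [seq 2 *: eps i | i : 'I_n]
     | TypeD => [::] end) F (embed a) *
   match X with TypeB => F (eps mx) | TypeC => F (2 *: eps mx) | TypeD => 1 end.
  case: X; rewrite ?big_image ?big_nil ?mulr1//= big_ord_recr /=; congr (_ * _).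
  - by apply: eq_bigr => i _; rewrite embed_eps wl.
  - by apply: eq_bigr => i _; rewrite !scaler_nat raddfMn /= embed_eps wl.
rewrite /pos_roots !big_cat !big_image /= short.
rewrite (pairs (fun i j => F (eps i + eps j))) (pairs (fun i j => F (eps i - eps j))).
rewrite big_split /=.
have -> : \prod_(ij in [pred ij : 'I_n * 'I_n | (ij.2 < ij.1)%N]) F (embed (eps ij.1 + eps ij.2)) =
  \prod_(ij in [pred ij : 'I_n * 'I_n | (ij.2 < ij.1)%N]) F (eps (lift mx ij.1) + eps (lift mx ij.2)).
  by apply: eq_bigr => ij _; rewrite raddfD /= !embed_eps.
have -> : \prod_(ij in [pred ij : 'I_n * 'I_n | (ij.2 < ij.1)%N]) F (embed (eps ij.1 - eps ij.2)) =
  \prod_(ij in [pred ij : 'I_n * 'I_n | (ij.2 < ij.1)%N]) F (eps (lift mx ij.1) - eps (lift mx ij.2)).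
  by apply: eq_bigr => ij _; rewrite raddfB /= !embed_eps.
have -> : \prod_(i < n) F (eps mx - embed (eps i)) = \prod_(i < n) F (eps mx - eps (lift mx i)).
  by apply: eq_bigr => i _; rewrite embed_eps.
have -> : \prod_(i < n) F (eps mx + embed (eps i)) = \prod_(i < n) F (eps mx + eps (lift mx i)).
  by apply: eq_bigr => i _; rewrite embed_eps.
ring.
Qed.
End Embedding.

(** * Branching of the q-partition function *)

Section Branch.
Variables (X : lie_type) (n : nat).
Local Notation S := {poly int}.
Local Notation G := 'rV[rat]_n.+1.
Local Notation H := 'rV[rat]_n.+2.
Local Notation mx := (ord_max : 'I_n.+2).
Local Notation q := ('X : S).
Local Notation hq := (@hqpoly S X n (gC G q)).

Lemma hqpoly_stable d s : (s <= d)%N -> eqmodX s (hq d) (hq s).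
Proof.
move=> sd; rewrite /hqpoly.
have st (a : galg G S) : eqmodX s (geom d (a *: 'X)) (geom s (a *: 'X)).
  by rewrite -mul_polyC mulrC; apply: geom_stable.
apply: eqmodXM; first by apply: eqmodX_prod => i; apply: eqmodXM.
case: (X); [exact: st| |exact: eqmodX_refl].
by rewrite exprS scalerAr; apply: geom_stable.
Qed.

Definition embedN (v : G) : H := - embed v.
Fact embedN_zmod : zmod_morphism embedN.
Proof. by move=> u v; rewrite /embedN raddfB /= opprB opprK addrC. Qed.
HB.instance Definition _ := GRing.isZmodMorphism.Build _ _ embedN embedN_zmod.

(* Reads the variable of the polynomial as [e ^ eps mx]; the exponents of the
   coefficients change sign, so that evaluating a coefficient of the product
   below adds these exponents. *)
Definition theta : {poly galg G S} -> galg H S :=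
  horner_eval (ge S (eps mx)) \o map_poly (gmap embedN).
HB.instance Definition _ := GRing.RMorphism.on theta.

Lemma theta_monom a j : theta (a *: 'X^j) = gmap embedN a * ge S (eps mx *+ j).
Proof. by rewrite /theta /= map_polyZ map_polyXn /horner_eval hornerZ hornerXn geMn. Qed.
Lemma theta_lin a : theta (a *: 'X) = gmap embedN a * ge S (eps mx).
Proof. by rewrite -[eps mx]mulr1n -theta_monom. Qed.

Lemma root_series_branch d :
  root_series X n.+2 d = gmap (@embed n.+1) (root_series X n.+1 d) * theta (hq d).
Proof.
rewrite /root_series prod_pos_roots_max rmorph_prod /=; congr (_ * _).
  by apply: eq_bigr => a _; rewrite rmorph_geom /= rmorphM /= gmap_C gmap_ge.
rewrite /hqpoly rmorphM rmorph_prod /=; congr (_ * _).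
  apply: eq_bigr => i _; rewrite rmorphM !rmorph_geom /= !theta_lin !rmorphM /=.
  rewrite !gmap_C !gmap_ge raddfN /= opprK -!mulrA -!geD.
  by rewrite /embedN ![_ + eps mx]addrC.
case: (X); last by rewrite rmorph1.
- by rewrite rmorph_geom /= theta_lin gmap_C.
- by rewrite rmorph_geom /= theta_monom gmap_C scaler_nat.
Qed.

Lemma gcoef_root_series_branch d (b : H) :
  root_series X n.+2 d b =
  \sum_(s < size (hq d) | b 0 mx == s%:R)
    \sum_(x <- gsupp (hq d)`_s) (hq d)`_s x * root_series X n.+1 d (weight_tail b + x).
Proof.
rewrite root_series_branch -[in theta _](coefK (hq d)) poly_def raddf_sum mulr_sumr.
rewrite gcoef_sum [RHS]big_mkcond /=; apply: eq_bigr => s _.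
rewrite theta_monom mulrCA gcoef_gmapM.
have tm : (eps mx *+ s) 0 mx = s%:R :> rat.
  by rewrite -scaler_nat mxE eps_coef eqxx mulr1.
have tl i : (eps mx *+ s) 0 (lift mx i) = 0 :> rat.
  by rewrite -scaler_nat mxE eps_coef (negPf (neq_lift _ _)) mulr0.
have xm y : (b - embedN y - eps mx *+ s) 0 mx = b 0 mx - s%:R.
  rewrite mxE [X in _ + X]mxE tm mxE [X in _ + X - _]mxE [X in _ - X - _]mxE.
  by rewrite embed_max oppr0 subr0.
have xt y : weight_tail (b - embedN y - eps mx *+ s) = weight_tail b + y.
  apply/rowP => i; rewrite !weight_tailE mxE [X in _ + X]mxE tl subr0.
  rewrite mxE [X in _ + X]mxE [X in _ - X]mxE embed_lift opprK.
  by rewrite [RHS]mxE weight_tailE.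
have cf y : (gmap (@embed n.+1) (root_series X n.+1 d) * ge S (eps mx *+ s)) (b - embedN y) =
    if b 0 mx == s%:R then root_series X n.+1 d (weight_tail b + y) else 0.
  by rewrite mulrC gcoef_geM gcoef_gmap_embed xm subr_eq0 xt.
transitivity (\sum_(y <- gsupp (hq d)`_s) (hq d)`_s y *
    if b 0 mx == s%:R then root_series X n.+1 d (weight_tail b + y) else 0).
  by apply: eq_bigr => y _; congr (_ * _); exact: cf.
by case: eqP => [//|_]; rewrite big1// => y _; rewrite mulr0.
Qed.

Lemma qpartition_branch (b : H) s : b 0 mx = s%:R ->
  qpartition X b = \sum_(x <- gsupp (hq s)`_s) (hq s)`_s x * qpartition X (weight_tail b + x).
Proof.
move=> bs; pose h : galg G S := (hq s)`_s; rewrite -/h; pose D x := Num.truncn (root_height (weight_tail b + x)).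
(* Large enough for the coefficient of index [s] to be stable, and for all the finitely many heights
   involved. *)
pose d := (s + (Num.truncn (root_height b)).+1 + \sum_(x <- gsupp h) (D x).+1)%N.
have sd : (s <= d)%N by rewrite /d -addnA leq_addr.
have le_d y (m : nat) : (Num.truncn y < m)%N -> (m <= d)%N -> y <= d%:R :> rat.
  move=> h1 h2; apply: le_trans (_ : m%:R <= _); last by rewrite ler_nat.
  by apply: ltW; apply: lt_le_trans (truncnS_gt y) _; rewrite ler_nat.
rewrite -(@gcoef_root_series _ _ d); last first.
  by apply: le_d (ltnSn _) _; rewrite /d; lia.
rewrite gcoef_root_series_branch.
transitivity (\sum_(x <- gsupp (hq d)`_s) (hq d)`_s x * root_series X n.+1 d (weight_tail b + x)).
  have [ss|ss] := ltnP s (size (hq d)).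
    rewrite (big_pred1 (Ordinal ss)) // => i; rewrite bs eqr_nat.
    by rewrite /= eq_sym.
  rewrite big_pred0 => [|i].
    by rewrite nth_default// big1// => x _; rewrite gcoef0 mul0r.
  by rewrite bs eqr_nat; apply/negbTE; have := ltn_ord i; lia.
rewrite (hqpoly_stable sd (leqnn s)) -/h !big_seq; apply: eq_bigr => x xs.
rewrite gcoef_root_series//; apply: le_d (ltnSn _) _.
by apply: (@leq_trans (\sum_(x <- gsupp h) (D x).+1)); [rewrite (big_rem x xs) leq_addr|rewrite leq_addl].
Qed.

Lemma qpartition_eq0 (b : H) : (forall s : nat, b 0 mx <> s%:R) -> qpartition X b = 0.
Proof.
move=> bs; rewrite -(@gcoef_root_series _ _ (Num.truncn (root_height b)).+1).
  by rewrite gcoef_root_series_branch big_pred0// => s; apply/eqP/bs.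
exact/ltW/truncnS_gt.
Qed.
End Branch.

(** * Branching of the Kostka-Foulkes polynomials *)

Section LiftSigned.
Variable (m : nat).
Local Notation mx := (ord_max : 'I_m.+1).

Definition drop_coord (k : 'I_m.+1) (b : 'rV[rat]_m.+1) : 'rV[rat]_m :=
  \row_i b 0 (lift k i).

(** The signed permutations that put the coordinate [k] last without changing its sign. *)
Definition lift_signed (k : 'I_m.+1) (w : signed_perm m) : signed_perm m.+1 :=
  (lift_perm mx k w.1, [ffun j => if unlift mx j is Some i then w.2 i else false]).

Lemma weyl_act_lift_max k w b : weyl_act (lift_signed k w) b 0 mx = b 0 k.
Proof. by rewrite weyl_actE ffunE unlift_none mul1r lift_perm_id. Qed.

Lemma weyl_act_lift k w b :
  weight_tail (weyl_act (lift_signed k w) b) = weyl_act w (drop_coord k b).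
Proof.
by apply/rowP => i; rewrite weight_tailE !weyl_actE ffunE liftK lift_perm_lift mxE.
Qed.

Lemma flips_lift_signed k w :
  \big[addb/false]_i (lift_signed k w).2 i = \big[addb/false]_i w.2 i.
Proof.
rewrite big_ord_recr /= ffunE unlift_none addbF; apply: eq_bigr => i _.
have -> : widen_ord (leqnSn m) i = lift mx i.
  by apply: val_inj; rewrite /= /bump leqNgt ltn_ord.
by rewrite ffunE liftK.
Qed.

Lemma lift_signed_weyl X k w : (lift_signed k w \in weyl X m.+1) = (w \in weyl X m).
Proof. by rewrite !in_weyl flips_lift_signed. Qed.

Lemma wodd_lift_signed k w : wodd (lift_signed k w) = odd (m + k) (+) wodd w.
Proof. by rewrite /wodd flips_lift_signed odd_lift_perm /= oddD addbA. Qed.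

Lemma lift_signed_inj : injective (fun kw => lift_signed kw.1 kw.2).
Proof.
move=> [k [s e]] [k' [s' e']] /= [/permP hs /ffunP he].
have kk : k = k' by have := hs mx; rewrite !lift_perm_id.
congr (_, (_, _)) => //.
  apply/permP => i; have := hs (lift mx i); rewrite !lift_perm_lift kk; exact: lift_inj.
by apply/ffunP => i; have := he (lift mx i); rewrite !ffunE liftK.
Qed.

Lemma lift_signed_onto (w : signed_perm m.+1) : ~~ w.2 mx ->
  exists k w', w = lift_signed k w'.
Proof.
case: w => s e /= emx; pose f i := odflt i (unlift (s mx) (s (lift mx i))).
have fE i : lift (s mx) (f i) = s (lift mx i).
  have ne : s mx != s (lift mx i) by rewrite (inj_eq perm_inj) neq_lift.
  by rewrite /f; have [j -> ->] := unlift_some ne.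
have f_inj : injective f.
  by move=> i j e1; apply: (@lift_inj _ mx); apply: (@perm_inj _ s); rewrite -!fE e1.
exists (s mx), (perm f_inj, [ffun i => e (lift mx i)]); congr (_, _).
  apply/permP => j; case: (unliftP mx j) => [i ->|->].
    by rewrite lift_perm_lift permE fE.
  by rewrite lift_perm_id.
apply/ffunP => j; rewrite ffunE; case: (unliftP mx j) => [i ->|->].
  by rewrite ffunE.
exact/negbTE.
Qed.

Lemma sum_lift_signed (R : nmodType) (P : pred (signed_perm m.+1))
    (F : signed_perm m.+1 -> R) : (forall w, P w -> w.2 mx -> F w = 0) ->
  \sum_(w | P w) F w = \sum_k \sum_(w | P (lift_signed k w)) F (lift_signed k w).
Proof.
move=> F0; rewrite pair_big_dep /= (bigID (fun w : signed_perm m.+1 => w.2 mx)) /=.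
rewrite big1 ?add0r => [|w /andP[]]; last exact: F0.
pose h kw := lift_signed kw.1 kw.2.
pose A := finset.finset (fun kw => P (h kw)).
transitivity (\sum_(w in finset.imset h (mem A)) F w); last first.
  rewrite big_imset; last by move=> x y _ _; apply: lift_signed_inj.
  by apply: eq_bigl => kw; rewrite finset.inE.
apply: eq_bigl => w; apply/andP/finset.imsetP => [[Pw /lift_signed_onto[k [w' e]]]|[kw + ->]].
  by exists (k, w'); rewrite ?finset.inE /h -?e.
by rewrite finset.inE => ->; rewrite ffunE unlift_none.
Qed.
End LiftSigned.

Section KostkaBranch.
Variables (X : lie_type).
Local Notation S := {poly int}.

(** The functional that turns alternating sums into Kostka-Foulkes polynomials, see
    [kostka_formE]. *)
Definition kostka_form n (mu : 'rV[rat]_n) : galg 'rV[rat]_n S -> S :=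
  geval idfun (fun x => qpartition X (x - (mu + rho X n))).
HB.instance Definition _ n mu := GRing.Additive.on (@kostka_form n mu).

Lemma kostka_form_geM n (mu b : 'rV[rat]_n) f :
  kostka_form mu (ge S b * f) =
  \sum_(x <- gsupp f) f x * qpartition X (b + x - (mu + rho X n)).
Proof.
rewrite {1}(gsum_monom f) mulr_sumr raddf_sum; apply: eq_bigr => x _.
by rewrite /= mulrC gmonomM addrC [kostka_form _ _]geval_monom mulr1.
Qed.

Lemma kostka_form_C n (mu : 'rV[rat]_n) c f :
  kostka_form mu (gC _ c * f) = c * kostka_form mu f.
Proof.
rewrite (gsum_monom f) mulr_sumr !raddf_sum mulr_sumr; apply: eq_bigr => x _.
by rewrite /gC /= gmonomM add0r /kostka_form !geval_monom mulrA.
Qed.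

Lemma kostka_form_sign n (mu : 'rV[rat]_n) (e : bool) f :
  kostka_form mu ((-1) ^+ e * f) = (-1) ^+ e * kostka_form mu f.
Proof. by rewrite !mulr_sign; case: e => //; rewrite raddfN. Qed.

Lemma kostka_formE n (la mu : 'rV[rat]_n) :
  kostka_foulkes X la mu = kostka_form mu (alt X S (la + rho X n)).
Proof.
rewrite /alt raddf_sum; apply: eq_bigr => w wW.
by rewrite sign_weyl_length//= kostka_form_sign [kostka_form _ (ge _ _)]geval_ge.
Qed.

(** The test says that [R k] is a natural number; otherwise no sum of positive roots has this last
    coordinate. *)
Theorem kostka_branch n (nu mu : 'rV[rat]_n.+2) :
  (forall k, - (nu + rho X n.+2) 0 k < (mu + rho X n.+2) 0 ord_max) ->
  let R k := R_index nu mu k in let T k := Num.truncn (R k) in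
  kostka_foulkes X nu mu =
  \sum_(k < n.+2) (-1) ^+ (n.+1 - k) * (if R k == (T k)%:R then
    kostka_form (weight_tail mu) (alt X S (weight_gamma nu k + rho X n.+1) *
      (hqpoly X (gC _ 'X) (T k))`_(T k)) else 0).
Proof.
move=> neg R T; rewrite /kostka_foulkes (sum_lift_signed (P := [in weyl X n.+2])); last first.
  move=> w wW wmx; rewrite qpartition_eq0 ?mulr0// => s.
  rewrite mxE [X in _ + X]mxE weyl_actE wmx mulN1r => e.
  have := neg (w.1 ord_max); rewrite -subr_lt0 e => h; have := ler0n rat s; lra.
have rho_tail : weight_tail (rho X n.+2) = rho X n.+1.
  by apply/rowP => i; rewrite !mxE; case: (X); rewrite lift_max.
(* Coordinates beyond [k] move down by one index, where [rho] is smaller by 1: this is the origin of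
   the added 1 in gamma_k. *)
have gammaE k : drop_coord k (nu + rho X n.+2) = weight_gamma nu k + rho X n.+1.
  apply/rowP => i; rewrite !mxE /= /bump; case: (leqP k i) => _ /=; rewrite ?add1n ?add0n ?addr0//.
  by rewrite -addrA; congr (_ + _); case: (X); rewrite -?[i.+2]addn1 -?[i.+1]addn1 ?natrD; ring.
apply: eq_bigr => k _.
have Rk w : (weyl_act (lift_signed k w) (nu + rho X n.+2) - (mu + rho X n.+2)) 0 ord_max = R k.
  rewrite mxE [X in _ + X]mxE weyl_act_lift_max /R /R_index.
  by rewrite !mxE; case: (X); rewrite /= -?[k.+1%:R]natr1 -?[n.+2%:R]natr1; ring.
have tl w : weight_tail (weyl_act (lift_signed k w) (nu + rho X n.+2) - (mu + rho X n.+2)) =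
    weyl_act w (weight_gamma nu k + rho X n.+1) - (weight_tail mu + rho X n.+1).
  rewrite -gammaE -weyl_act_lift -rho_tail; apply/rowP => i.
  by rewrite weight_tailE !mxE.
transitivity ((-1) ^+ (n.+1 - k) * \sum_(w in weyl X n.+1) (-1) ^+ wodd w *
    (if R k == (T k)%:R then kostka_form (weight_tail mu)
      (ge S (weyl_act w (weight_gamma nu k + rho X n.+1)) * (hqpoly X (gC _ 'X) (T k))`_(T k))
     else 0)).
  rewrite mulr_sumr; apply: eq_big => [w|w wW]; first exact: lift_signed_weyl.
  rewrite sign_weyl_length// wodd_lift_signed signr_addb mulrA.
  have -> : (-1) ^+ (n.+1 - k) = (-1) ^+ odd (n.+1 + k) :> S.
    by rewrite -signr_odd oddB ?oddD// -ltnS.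
  congr (_ * _); case: eqP => [e|ne]; last first.
    apply: qpartition_eq0 => s; rewrite Rk => e; apply: ne.
    by rewrite /T e natrK.
  rewrite (qpartition_branch X (etrans (Rk w) e)) kostka_form_geM; apply: eq_bigr => x _.
  by rewrite tl addrAC.
congr (_ * _); case: eqP => _; last by rewrite big1// => w _; rewrite mulr0.
rewrite /alt mulr_suml raddf_sum; apply: eq_bigr => w _.
by rewrite -mulrA /= kostka_form_sign.
Qed.
End KostkaBranch.

(** * The recurrence *)

Section DominantWeights.
Variable (X : lie_type).

Lemma dominant_mono m (b : 'rV[rat]_m) (i j : 'I_m) : dominant X b -> (i <= j)%N -> b 0 i <= b 0 j.
Proof. by case/and3P=> _ /forallP/(_ i)/forallP/(_ j)/implyP. Qed.
Lemma dominant_ge0 m (b : 'rV[rat]_m) (i : 'I_m) : dominant X b -> X <> TypeD -> 0 <= b 0 i.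
Proof. by case/and3P=> _ _; case: (X) => // /forallP/(_ i). Qed.
Lemma dominant_normD m (b : 'rV[rat]_m) (i j : 'I_m) : dominant X b -> X = TypeD ->
  i = 0%N :> nat -> (0 < j)%N -> `|b 0 i| <= b 0 j.
Proof.
case/and3P=> _ _ + XD i0 j0; rewrite XD => /forallP/(_ i)/forallP/(_ j)/implyP.
by rewrite i0 j0; apply.
Qed.

Lemma gamma_dominant n (nu : 'rV[rat]_n.+1) k : dominant X nu ->
  dominant X (weight_gamma nu k).
Proof.
move=> d; have gE i : weight_gamma nu k 0 i = nu 0 (lift k i) + (k <= i)%N%:R by rewrite mxE.
have lift_le (i j : 'I_n) : (i <= j)%N -> (lift k i <= lift k j)%N.
  by rewrite /= leq_bump2.
apply/and3P; split.
- have i1 : [forall i, nu 0 i \is a Num.int] -> [forall i, weight_gamma nu k 0 i \is a Num.int].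
    by move/forallP => h; apply/forallP => i; rewrite gE rpredD// natr_int.
  have i2 : [forall i, nu 0 i - 2^-1 \is a Num.int] ->
      [forall i, weight_gamma nu k 0 i - 2^-1 \is a Num.int].
    by move/forallP => h; apply/forallP => i; rewrite gE addrAC rpredD// natr_int.
  move: d => /and3P[+ _ _]; case: (X) => [/orP[/i1->//|/i2->]|/i1//|/orP[/i1->//|/i2->]]; rewrite ?orbT//.
- apply/forallP => i; apply/forallP => j; apply/implyP => ij; rewrite !gE.
  apply: lerD; first exact: dominant_mono (lift_le _ _ ij).
  by rewrite ler_nat; case: (leqP k i) => // ki; rewrite (leq_trans ki ij).
have B : X <> TypeD -> [forall i, 0 <= weight_gamma nu k 0 i].
  by move=> nD; apply/forallP => i; rewrite gE addr_ge0// dominant_ge0.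
have D : X = TypeD -> [forall i : 'I_n, forall j : 'I_n, (i == 0 :> nat) && (0 < j)%N ==>
    (`|weight_gamma nu k 0 i| <= weight_gamma nu k 0 j)].
  move=> XD; apply/forallP => i; apply/forallP => j; apply/implyP => /andP[/eqP i0 j0].
  rewrite !gE; have ij : (i <= j)%N by rewrite i0.
  (* Removing the first part, the only one that may be negative, leaves nonnegative parts, all
     raised by 1. *)
  have [k0|k0] := posnP k.
    have pos l : (0 < lift k l)%N by rewrite /= /bump k0.
    have nn l : 0 <= nu 0 (lift k l).
      by apply: le_trans (dominant_normD (i := ord0) d XD _ (pos l)).
    by rewrite k0 /= ger0_norm ?addr_ge0// lerD2r dominant_mono ?lift_le.
  rewrite [(k <= i)%N]leqNgt i0 k0 addr0 /=.
  apply: le_trans (_ : nu 0 (lift k j) <= _); last by rewrite lerDl.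
  apply: dominant_normD => //=; first by rewrite /bump i0 leqNgt k0.
  by rewrite /bump addn_gt0 j0 orbT.
by case: (X) B D => B D; [exact: B|exact: B|exact: D].
Qed.

Lemma row_weightE n r : row_weight n.+1 r = r%:R *: eps ord_max.
Proof.
by apply/rowP => i; rewrite !mxE natrM eqSS.
Qed.

Lemma row_weight_int n r i : row_weight n r 0 i \is a Num.int.
Proof. by rewrite mxE natr_int. Qed.

Lemma row_weight_dominant n r : dominant X (row_weight n r).
Proof.
have hi := @row_weight_int n r.
have ge0 i : 0 <= row_weight n r 0 i by rewrite mxE.
apply/and3P; split.
- by case: (X); rewrite ?(introT forallP hi).
- apply/forallP => i; apply/forallP => j; apply/implyP => ij; rewrite !mxE ler_nat leq_mul2l.
  case: (i.+1 =P n) => [e|]; last by rewrite orbT.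
  by rewrite (_ : j.+1 == n) ?orbT//; apply/eqP; have := ltn_ord j; lia.
case: (X); [exact/forallP|exact/forallP|].
apply/forallP => i; apply/forallP => j; apply/implyP => /andP[/eqP i0 j0].
rewrite mxE i0 (_ : (1%N == n) = false) ?muln0 ?normr0//.
by apply/negbTE/eqP; have := ltn_ord j; lia.
Qed.

(** Only the part of index 0 in type D can be negative, whence the hypothesis restricted to it. *)
Lemma neg_entries n (nu mu : 'rV[rat]_n.+2) : dominant X nu -> dominant X mu ->
  (X = TypeD -> - nu 0 ord0 < mu 0 ord_max + n.+1%:R) ->
  forall k, - (nu + rho X n.+2) 0 k < (mu + rho X n.+2) 0 ord_max.
Proof.
move=> dn dm hD k.
have [XB|[XC|XD]] : X = TypeB \/ X = TypeC \/ X = TypeD by case: (X); tauto.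
- have h1 : 0 <= nu 0 k by apply: dominant_ge0 => //; rewrite XB.
  have h2 : 0 <= mu 0 ord_max by apply: dominant_ge0 => //; rewrite XB.
  have h3 : 0 <= (k : nat)%:R :> rat by [].
  have h4 : 0 <= (n.+1)%:R :> rat by [].
  by rewrite !mxE XB /=; lra.
- have h1 : 0 <= nu 0 k by apply: dominant_ge0 => //; rewrite XC.
  have h2 : 0 <= mu 0 ord_max by apply: dominant_ge0 => //; rewrite XC.
  have h3 : 0 <= (k.+1 : nat)%:R :> rat by [].
  have h4 : 0 < (n.+2)%:R :> rat by [].
  by rewrite !mxE XC /=; lra.
have [k0|k0] := posnP k.
  have -> : k = ord0 by apply: val_inj.
  by have := hD XD; rewrite !mxE XD /=; lra.
have h1 : 0 <= nu 0 k by apply: le_trans (dominant_normD (i := ord0) dn XD _ k0).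
have h2 : 0 <= mu 0 ord_max by apply: le_trans (dominant_normD (i := ord0) (j := ord_max) dm XD _ _).
have h3 : 0 <= (k : nat)%:R :> rat by [].
have h4 : 0 < (n.+1)%:R :> rat by [].
by rewrite !mxE XD /=; lra.
Qed.
End DominantWeights.

Lemma poly_int_tf (x : {poly int}) : x = - x -> x = 0.
Proof.
move=> e; apply/polyP => i; apply/eqP; have := congr1 (fun p : {poly int} => p`_i) e.
by rewrite coefN coef0 => /eqP; rewrite -subr_eq0 opprK -mulr2n mulrn_eq0.
Qed.

Section Recurrence.
Variables (C : numClosedFieldType) (X : lie_type) (n : nat).
Hypothesis n0 : if X is TypeD then (0 < n)%N else true.
Variable V : 'rV[rat]_n.+1 -> lie_module C X n.+1.
Hypothesis V_irr : forall lambda, dominant X lambda -> is_irreducible_of lambda (V lambda).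
Variable b : 'rV[rat]_n.+1 -> nat -> 'rV[rat]_n.+1 -> nat.
Hypothesis b_mult : forall gamma r lambda, dominant X gamma -> dominant X lambda ->
  multiplicity (tensor_module (V gamma) (V (row_weight n.+1 r))) (V lambda)
    (b gamma r lambda).
Local Notation S := {poly int}.

Lemma tensor_sum gam mu : dominant X gam ->
  exists2 ch : galg 'rV[rat]_n.+1 S, ch * alt X S (rho X n.+1) = alt X S (gam + rho X n.+1) &
  forall r, \sum_(lambda \in tensor_set X b gam r)
    (b gam r lambda)%:R * kostka_foulkes X lambda mu =
    kostka_form X mu (ch * arow S X n r%:Z).
Proof.
move=> dg; have [ch chE tens] := tensor_multiplicities V_irr dg.
exists (gint S ch); first by rewrite mulrC -!(gint_alt S) -gintM chE.
move=> r; have [ls [dls bE lsE]] := tens _ _ (row_weight_dominant X n.+1 r)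
  (@row_weight_int n.+1 r) (fun l dl => b_mult r dg dl).
(* The set consists of the distinct elements of [ls], and each multiplicity counts occurrences. *)
have -> : tensor_set X b gam r = [set` undup ls]%classic.
  apply/seteqP; split=> l /=.
    move=> [dl]; rewrite bE// mem_undup => /eqP; rewrite -lt0n -has_count.
    by move/hasP => [x xl /eqP <-].
  rewrite mem_undup => ll; have dl := allP dls _ ll; split=> //.
  by rewrite bE//; apply/eqP; rewrite -lt0n -has_count; apply/hasP; exists l => /=.
rewrite -fsbig_seq ?undup_uniq//.
transitivity (\sum_(l <- ls) kostka_foulkes X l mu).
  rewrite -(@big_undup_iterop_count _ _ _ _ ls xpredT) /= !big_seq; apply: eq_bigr => l.
  by rewrite mem_undup => ll; rewrite bE ?(allP dls)// mulr_natl.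
under eq_bigr => l _ do rewrite kostka_formE.
rewrite -raddf_sum; congr (kostka_form _ _ _).
transitivity (gint S (\sum_(l <- ls) alt X int (l + rho X n.+1))).
  by rewrite raddf_sum; apply: eq_bigr => l _; apply/esym/gint_alt.
by rewrite lsE gintM gint_alt row_weightE addrC.
Qed.

Lemma inner_sum gam mu T : dominant X gam ->
  \sum_(r < T.+1) \sum_(m < T.+1 | (r + 2 * m)%:R == T%:R :> rat)
     'X^(if X is TypeC then T - m else T) *
      (\sum_(lambda \in tensor_set X b gam r)
        (b gam r lambda)%:R * kostka_foulkes X lambda mu) =
  kostka_form X mu (alt X S (gam + rho X n.+1) * (hqpoly X (gC _ 'X) T)`_T).
Proof.
move=> dg; have [ch chE chr] := tensor_sum mu dg.
rewrite -chE -mulrA.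
have a0 : alt X S (rho X n.+1) = arow S X n 0 by rewrite /arow scale0r addr0.
rewrite a0 -(row_series poly_int_tf (gC _ 'X) n0 (leqnn T)).
rewrite mulr_sumr raddf_sum; apply: eq_bigr => r _.
rewrite mulr_sumr raddf_sum; apply: eq_big => [m|m _]; first by rewrite eqr_nat.
by rewrite chr mulrCA -rmorphXn /= kostka_form_C.
Qed.

Lemma recurrence (nu mu : 'rV[rat]_n.+2) (p : 'I_n.+2) : dominant X nu -> dominant X mu ->
  (X = TypeD -> - nu 0 ord0 < mu 0 ord_max + n.+1%:R) ->
  (forall j : 'I_n.+2, 0 <= R_index nu mu j -> (p <= j)%N) ->
  let R k := R_index nu mu k in let T k := Num.truncn (R k) in
  kostka_foulkes X nu mu =
  \sum_(k < n.+2 | (p <= k)%N) (-1) ^+ (n.+1 - k) *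
    \sum_(r < (T k).+1) \sum_(m < (T k).+1 | (r + 2 * m)%:R == R k)
     'X^(if X is TypeC then T k - m else T k) *
      (\sum_(lambda \in tensor_set X b (weight_gamma nu k) r)
        (b (weight_gamma nu k) r lambda)%:R * kostka_foulkes X lambda (weight_tail mu)).
Proof.
move=> dn dm hD pmin R T; rewrite (kostka_branch (neg_entries dn dm hD)).
rewrite [RHS]big_mkcond /=; apply: eq_bigr => k _.
case: eqP => [e|ne].
  rewrite -/(R k) -/(T k) in e *.
  (* A natural [R k] is nonnegative, so minimality of [p] puts [k] in the range. *)
  rewrite pmin; last by rewrite -/(R k) e.
  congr (_ * _); rewrite -(@inner_sum _ _ (T k)) ?gamma_dominant//.
  by apply: eq_bigr => r _; apply: eq_bigl => m; rewrite -e.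
(* If [R k] is not natural, no pair satisfies r + 2m = R k. *)
rewrite mulr0; case: ifP => // _; rewrite big1 ?mulr0// => r _; rewrite big1// => m /eqP h.
by exfalso; apply: ne; rewrite -/(R k) -h natrK.
Qed.
End Recurrence.

Theorem theorem3p2p3 (C : numClosedFieldType) (X : lie_type) (n : nat)
  (n_big : if X is TypeD then (2 <= n)%N else (1 <= n)%N)
  (V : 'rV[rat]_n -> lie_module C X n)
  (V_irr : forall lambda, dominant X lambda -> is_irreducible_of lambda (V lambda))
  (b : 'rV[rat]_n -> nat -> 'rV[rat]_n -> nat)
  (b_mult : forall gamma r lambda, dominant X gamma -> dominant X lambda ->
     multiplicity (tensor_module (V gamma) (V (row_weight n r))) (V lambda)
       (b gamma r lambda))
  (nu mu : 'rV[rat]_n.+1) (nu_dom : dominant X nu) (mu_dom : dominant X mu)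
  (p : 'I_n.+1) (p_ge0 : 0 <= R_index nu mu p)
  (p_min : forall j : 'I_n.+1, 0 <= R_index nu mu j -> (p <= j)%N) :
  let R k := R_index nu mu k in
  let T k := Num.truncn (R k) in
  let gamma k := weight_gamma nu k in
  let mu' := weight_tail mu in
  [/\ X = TypeB ->
        kostka_foulkes X nu mu =
        \sum_(k < n.+1 | (p <= k)%N) (-1) ^+ (n - k) * 'X^(T k) *
          \sum_(r < (T k).+1) \sum_(m < (T k).+1 | (r + 2 * m)%:R == R k)
            \sum_(lambda \in tensor_set X b (gamma k) r)
              (b (gamma k) r lambda)%:R * kostka_foulkes X lambda mu',
      X = TypeC ->
        kostka_foulkes X nu mu =
        \sum_(k < n.+1 | (p <= k)%N) (-1) ^+ (n - k) *
          \sum_(r < (T k).+1) \sum_(m < (T k).+1 | (r + 2 * m)%:R == R k)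
            \sum_(lambda \in tensor_set X b (gamma k) r)
              'X^(T k - m) * (b (gamma k) r lambda)%:R * kostka_foulkes X lambda mu'
    & X = TypeD -> - nu 0 ord0 < mu 0 ord_max + n%:R ->
        kostka_foulkes X nu mu =
        \sum_(k < n.+1 | (p <= k)%N) (-1) ^+ (n - k) * 'X^(T k) *
          \sum_(r < (T k).+1) \sum_(m < (T k).+1 | (r + 2 * m)%:R == R k)
            \sum_(lambda \in tensor_set X b (gamma k) r)
              (b (gamma k) r lambda)%:R * kostka_foulkes X lambda mu'].
Proof.
move=> R T gamma mu'.
case: n n_big V V_irr b b_mult nu mu nu_dom mu_dom p p_ge0 p_min @R @T @gamma @mu'
  => [|n'] n_big V' V_irr b' b_mult nu mu nu_dom mu_dom p _ p_min R T gamma mu'.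
  by exfalso; case: (X) n_big.
have n0 : is_true (if X is TypeD then (0 < n')%N else true) by case: (X) n_big.
have rec (hD : X = TypeD -> - nu 0 ord0 < mu 0 ord_max + n'.+1%:R) := @recurrence C X n' n0 V' V_irr b' b_mult nu mu p nu_dom mu_dom hD p_min.
split=> [XX|XX|XX hD].
- rewrite rec ?XX//; apply: eq_bigr => k _; rewrite -mulrA; congr (_ * _).
  rewrite [RHS]mulr_sumr; apply: eq_bigr => r _; rewrite [RHS]mulr_sumr; apply: eq_bigr => m _.
  by [].
- rewrite rec ?XX//; apply: eq_bigr => k _; congr (_ * _).
  apply: eq_bigr => r _; apply: eq_bigr => m _.
  rewrite mulr_fsumr; apply: eq_fsbigr => l _; by rewrite mulrA.
rewrite rec// ?XX//; apply: eq_bigr => k _; rewrite -mulrA; congr (_ * _).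
by rewrite [RHS]mulr_sumr; apply: eq_bigr => r _; rewrite [RHS]mulr_sumr; apply: eq_bigr => m _.
Qed.
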